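(* For all positive integers $n,d$ and every set $\mathcal{I}\subset\{(j,k)\in\mathbb{Z}_{\ge0}^2: j+k\le n-1\}$ with $|\mathcal{I}|=n$, $$|MS^d_{\mathcal{I}}|=\pm|MP_{\mathcal{I}}|^{(d+1)d/2}\,\operatorname{Res}_n(x_1,x_2,x_3)^{(d+1)d(d-1)/6}.$$
   Context: Let $n\ge1$ and let $x_i(s,t,u)=\sum_{j+k\le n}c^i_{jk}s^jt^ku^{n-j-k}$, $i=1,\dots,4$, be four generic homogeneous polynomials of degree $n$ (the $c^i_{jk}$ are independent indeterminates). Let $\mathbb{K}=\mathbb{Q}(c^i_{jk})$ and let $S_l$ be the $\mathbb{K}$-space of homogeneous polynomials of degree $l$ in $s,t,u$. All spaces have monomial bases, each with a fixed order, and matrices are taken in these bases. $|A|$ denotes the determinant of a square matrix $A$, and $x^\gamma=x_1^{\gamma_1}x_2^{\gamma_2}x_3^{\gamma_3}x_4^{\gamma_4}$. $MP$ is the $(2n^2+n)\times(2n^2+2n)$ matrix of $\phi:S_{n-1}^4\to S_{2n-1}$, $(p_1,\dots,p_4)\mapsto\sum_i p_ix_i$. $MP_{\mathcal{I}}$ is the square matrix obtained from $MP$ by removing the $n$ columns corresponding to $s^it^ju^{n-1-i-j}x_4$, $(i,j)\in\mathcal{I}$. Let $\Gamma_0=\{\gamma\in\mathbb{Z}_{\ge0}^4:|\gamma|=d,\ \gamma_4\le1\}$. $MS^d$ is the matrix of $\psi^d:S_{n-1}^{\Gamma_0}\to S_{(d+1)n-1}$, $(p_\gamma)\mapsto\sum_{\gamma\in\Gamma_0}p_\gamma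 x^\gamma$. $MS^d_{\mathcal{I}}$ is the square matrix obtained from $MS^d$ by removing all columns corresponding to $s^it^ju^{n-1-i-j}x^\gamma$ with $(i,j)\in\mathcal{I}$, $\gamma\in\Gamma_0$, $\gamma_4=1$. $\operatorname{Res}_n(f_1,f_2,f_3)$ is the multivariate resultant of three generic homogeneous polynomials of degree $n$ in three variables: the irreducible polynomial with integer coefficients (unique up to sign) in the coefficients of the $f_i$ which vanishes, after specializing the coefficients in an algebraically closed field $k$, if and only if $f_1=f_2=f_3=0$ has a solution in $\mathbb{P}^2(k)$. *)

(* Defs.v *)
From mathcomp Require Import all_boot all_order all_algebra.
From mathcomp Require Import finmap mpoly fraction.
From mathcomp Require Import zify ring.

Set Implicit Arguments.
Unset Strict Implicit.
Unset Printing Implicit Defensive.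

Import GRing.Theory.
Local Open Scope ring_scope.

(* The monomials of degree l in s, t, u, as exponent vectors: the variables
   s, t, u are 'X_0, 'X_1, 'X_2, and s^j t^k u^(l-j-k) is the monomial m with
   m 0 = j and m 1 = k.  The fixed order on this basis of S_l is [enum]. *)
Definition mono (l : nat) : finType := {m : 'X_{1..3 < l.+1} | mdeg m == l}.
Definition expo l (m : mono l) : 'X_{1..3} := val (val m).

(* Matrix, in the monomial bases, of the map
     S_l^I -> S_L,  (p_i)_i |-> \sum_i p_i y_i
   where L = l + e when the y_i are homogeneous of degree e. *)
Section Matrices.
Variables (A : comNzRingType) (I : finType) (y : I -> {mpoly A[3]}).

Definition mulmap (p : {ffun I -> {mpoly A[3]}}) : {mpoly A[3]} :=
  \sum_i p i * y i.

Lemma mulmap_homog l e (p : {ffun I -> {mpoly A[3]}}) :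
    (forall i, y i \is e.-homog) -> (forall i, p i \is l.-homog) ->
  mulmap p \is (l + e).-homog.
Proof. by move=> hy hp; apply: rpred_sum => i _; apply: dhomogM. Qed.

(* The element of S_l^I with 'X_[m] in position i and 0 elsewhere. *)
Definition bvec l (im : I * mono l) : {ffun I -> {mpoly A[3]}} :=
  [ffun i => if i == im.1 then 'X_[expo im.2] else 0].

Definition mulmap_mx l L : 'M[A]_(#|mono L|, #|{: I * mono l}|) :=
  \matrix_(r, c) (mulmap (bvec (enum_val c)))@_(expo (enum_val r)).

End Matrices.

Definition remove_cols (A : Type) (T : finType) m (M : 'M[A]_(m, #|T|))
    (D : {set T}) : 'M[A]_(m, #|~: D|) :=
  colsub (fun j : 'I_#|~: D| => enum_rank (enum_val j)) M.

(* The set of columns s^j t^k u^(l-j-k) y_i with (j, k) in J and i in P. *)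
Definition cols_in (I : finType) l (P : pred I) (J : {fset nat * nat}) :
    {set I * mono l} :=
  [set c | P c.1 & (expo c.2 ord0, expo c.2 (inord 1)) \in J].

Section Generic.
Variable n : nat.

(* Q(c^i_jk): the indeterminate c^i_jk has index enum_rank (i, m), where m is
   the monomial s^j t^k u^(n-j-k).  The index i runs over 0, ..., 3, so that
   the x_4 of the usual numbering is [xx ord_max]. *)
Definition KK : fieldType :=
  {fraction {mpoly rat[#|{: 'I_4 * mono n}|]}}.

Definition cc (i : 'I_4) (m : mono n) : KK :=
  tofrac ('X_(enum_rank (i, m)) : {mpoly rat[#|{: 'I_4 * mono n}|]}).

Definition xx (i : 'I_4) : {mpoly KK[3]} :=
  \sum_(m : mono n) cc i m *: 'X_[expo m].

Definition MP := mulmap_mx xx n.-1 (2 * n).-1.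

Definition Gamma0 (d : nat) : finType :=
  {g : 'X_{1..4 < d.+1} | (mdeg g == d) && (g ord_max <= 1)%N}.

Definition gexp d (g : Gamma0 d) : 'X_{1..4} := val (val g).

Definition xpow d (g : Gamma0 d) : {mpoly KK[3]} := \prod_i xx i ^+ gexp g i.

Definition MS d := mulmap_mx (@xpow d) n.-1 (d.+1 * n).-1.

Definition MP_removed (J : {fset nat * nat}) :=
  @cols_in 'I_4 n.-1 (pred1 ord_max) J.

Definition MS_removed d (J : {fset nat * nat}) :=
  @cols_in (Gamma0 d) n.-1 [pred g | gexp g ord_max == 1%N] J.

End Generic.

Lemma xx_homog n i : xx n i \is n.-homog.
Proof.
apply: rpred_sum => m _; apply: rpredZ; rewrite dhomogX; exact: (valP m).
Qed.

Lemma xpow_homog n d (g : Gamma0 d) : xpow n g \is (d * n).-homog.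
Proof.
have /andP[/eqP h _] := valP g.
have -> : (d * n = (\sum_i gexp g i) * n)%N by rewrite -mdegE h.
rewrite /xpow big_distrl /=.
elim/big_rec2: _ => [|i e p _ hp]; first exact: dhomog1.
by apply: dhomogM => //; rewrite mulnC; apply/dhomogMn/xx_homog.
Qed.


Lemma card_mono l : #|mono l| = 'C(l.+2, 2).
Proof.
rewrite cardE -(size_map (@expo l)).
set b := [seq s2m t | t : l.-tuple 'I_3 <- enum (basis 3 l)].
have /perm_size-> : perm_eq [seq expo m | m <- enum (mono l)] b.
  apply: uniq_perm => [||m].
  - by rewrite map_inj_uniq ?enum_uniq // => m m' /val_inj/val_inj.
  - exact: uniq_basis.
  rewrite -basis_cover; apply/mapP/idP => [[m' _ ->]|hm]; first exact: (valP m').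
  have lm : (mdeg m < l.+1)%N by rewrite (eqP hm).
  by exists (Sub (BMultinom lm) hm : mono l); rewrite ?mem_enum.
by rewrite size_basis -bin_sub ?leq_addr // addKn addn2.
Qed.

Lemma mdeg3 (m : 'X_{1..3}) :
  mdeg m = (m ord0 + m (inord 1) + m (inord 2))%N.
Proof.
rewrite mdegE !big_ord_recl big_ord0 addn0 addnA.
by congr (_ + m _ + m _)%N; apply/val_inj; rewrite /= inordK.
Qed.

Lemma card_mono_in l (J : {fset nat * nat}) :
    (forall p, p \in J -> (p.1 + p.2 <= l)%N) ->
  #|[set m : mono l | (expo m ord0, expo m (inord 1)) \in J]| = #|` J|.
Proof.
move=> hJ; pose f (m : mono l) := (expo m ord0, expo m (inord 1)).
set S := [set m | _]; rewrite cardE -(size_map f).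
apply: perm_size; apply: uniq_perm => [||[j k]].
- rewrite map_inj_uniq ?enum_uniq // => m m' [e0 e1]; apply/val_inj/val_inj.
  have : mdeg (expo m) = l := eqP (valP m).
  have : mdeg (expo m') = l := eqP (valP m').
  rewrite !mdeg3 -/(expo m) -/(expo m') => h' h.
  apply/mnmP => -[[|[|[|//]]] hi].
  + by move: e0; rewrite /expo (_ : ord0 = Ordinal hi) //; apply/val_inj.
  + by move: e1; rewrite /expo (_ : inord 1 = Ordinal hi) //;
       apply/val_inj; rewrite /= inordK.
  have -> : Ordinal hi = inord 2 by apply/val_inj; rewrite /= inordK.
  by rewrite -/(expo m) -/(expo m'); lia.
- exact: fset_uniq.
apply/mapP/idP => [[m]|hjk]; first by rewrite mem_enum inE => hm ->.
pose m := [multinom nth 0%N [:: j; k; (l - j - k)%N] i | i < 3].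
have jk := hJ _ hjk; rewrite /= in jk.
have hm : mdeg m == l.
  by rewrite mdeg3 !mnmE /= !inordK //=; apply/eqP; lia.
have lm : (mdeg m < l.+1)%N by rewrite (eqP hm).
have E : f (Sub (BMultinom lm) hm : mono l) = (j, k).
  by rewrite /f /expo /= !mnmE /= inordK.
by exists (Sub (BMultinom lm) hm); rewrite // mem_enum inE -/(f _) E.
Qed.

Lemma card_cols_in (I : finType) l (P : pred I) (J : {fset nat * nat}) :
    (forall p, p \in J -> (p.1 + p.2 <= l)%N) ->
  #|@cols_in I l P J| = (#|P| * #|` J|)%N.
Proof.
move=> hJ; rewrite -(card_mono_in hJ).
have -> : #|P| = #|[set i | P i]| by rewrite cardsE.
rewrite -cardsX; apply: eq_card => -[i m].
by rewrite !inE.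
Qed.

Definition ext4 e (m : 'X_{1..3}) : 'X_{1..4} :=
  [multinom (if unlift ord_max i is Some j then m j else e) | i < 4].

Lemma mdeg_ext4 e m : mdeg (ext4 e m) = (mdeg m + e)%N.
Proof.
rewrite !mdegE big_ord_recr /= !mnmE unlift_none; congr (_ + _)%N.
apply: eq_bigr => i _; rewrite mnmE.
have -> : widen_ord (leqnSn 3) i = lift ord_max i.
  by apply/val_inj; rewrite /= /bump leqNgt ltn_ord.
by rewrite liftK.
Qed.

Lemma mdeg_gexp d (g : Gamma0 d) : mdeg (gexp g) = d.
Proof. by have /andP[/eqP] := valP g. Qed.

Lemma gexp0 (g : Gamma0 0) : gexp g = 0%MM.
Proof. by apply/eqP; rewrite -mdeg_eq0 mdeg_gexp. Qed.

Lemma card_Gamma0_eq d e : (e <= 1)%N -> (e <= d)%N ->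
  #|[pred g : Gamma0 d | gexp g ord_max == e]| = 'C((d - e).+2, 2).
Proof.
move=> e1 ed; rewrite -card_mono cardE -(size_map (@gexp d)).
rewrite [RHS]cardE -(size_map (ext4 e \o @expo (d - e))).
apply: perm_size; apply: uniq_perm => [||g].
- by rewrite map_inj_uniq ?enum_uniq // => m m' /val_inj/val_inj.
- rewrite map_inj_uniq ?enum_uniq // => m m' /mnmP h.
  apply/val_inj/val_inj/mnmP => i.
  by have := h (lift ord_max i); rewrite !mnmE liftK.
apply/mapP/mapP => [[g' + ->]|[m _ ->]].
  rewrite mem_enum inE => /eqP ge.
  pose m := [multinom gexp g' (lift ord_max i) | i < 3].
  have E : gexp g' = ext4 e m.
    apply/mnmP => i; rewrite mnmE; case: unliftP => [j ->|->] //.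
    by rewrite mnmE.
  have /andP[/eqP dg _] := valP g'.
  have hm : mdeg m == (d - e)%N.
    by rewrite -dg -[val (val g')]/(gexp g') E mdeg_ext4 addnK.
  have lm : (mdeg m < (d - e).+1)%N by rewrite (eqP hm).
  by exists (Sub (BMultinom lm) hm : mono (d - e)); rewrite ?mem_enum.
have hg : mdeg (ext4 e (expo m)) == d.
  by rewrite mdeg_ext4 (eqP (valP m)) subnK.
have lg : (mdeg (ext4 e (expo m)) < d.+1)%N by rewrite (eqP hg).
have ge : ext4 e (expo m) ord_max = e by rewrite mnmE unlift_none.
have hg' : (mdeg (BMultinom lg) == d) && ((BMultinom lg) ord_max <= 1)%N.
  by rewrite hg /= ge.
by exists (Sub (BMultinom lg) hg' : Gamma0 d); rewrite // mem_enum inE /= ge.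
Qed.

Lemma bin2_double m : ('C(m, 2) * 2 = m * m.-1)%N.
Proof.
by rewrite bin2 muln2 -[RHS]odd_double_half; case: m => //= m;
   rewrite oddM /= andNb.
Qed.

Lemma card_Gamma0 d : #|Gamma0 d| = (d.+1 ^ 2)%N.
Proof.
case: d => [|d].
  rewrite -(@eq_card _ [pred g : Gamma0 0 | gexp g ord_max == 0%N]).
    by rewrite card_Gamma0_eq.
  by move=> g; rewrite !inE gexp0 mnmE.
rewrite -(cardC [pred g | gexp g ord_max == 0%N]) card_Gamma0_eq //.
rewrite (@eq_card _ _ [pred g : Gamma0 d.+1 | gexp g ord_max == 1%N]).
  rewrite card_Gamma0_eq // subn0 subn1.
  have := bin2_double d.+3; have := bin2_double d.+2; rewrite -mulnn /=.
  by move: 'C(d.+3, 2) 'C(d.+2, 2) => a b ha hb; nia.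
move=> g; rewrite !inE; have /andP[_] := valP g.
by rewrite -[val (val g)]/(gexp g); case: (gexp g ord_max) => [|[]].
Qed.

Lemma MS_square n d (J : {fset nat * nat}) :
    (0 < n)%N -> (forall p, p \in J -> (p.1 + p.2 <= n.-1)%N) -> #|` J| = n ->
  #|~: MS_removed n d J| = #|mono (d.+1 * n).-1|.
Proof.
move=> n0 hJ cJ.
have := cardsC (MS_removed n d J); rewrite card_cols_in // cJ.
rewrite card_prod card_Gamma0 !card_mono.
case: n n0 {hJ cJ} => // n _.
have -> : #|[pred g : Gamma0 d | gexp g ord_max == 1%N]| = 'C(d.+1, 2).
  case: d => [|d]; last by rewrite card_Gamma0_eq // subn1.
  rewrite bin_small //; by apply: eq_card0 => g; rewrite !inE gexp0 mnmE.
have := bin2_double d.+1; have := bin2_double n.+2.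
have := bin2_double (d.+1 * n.+1).-1.+2.
rewrite prednK /=; last by rewrite muln_gt0.
set a := 'C(_, _); set b := 'C(_, _); set c := 'C(_, _); set r := #|_|.
move=> ha hb hc hr; nia.
Qed.

Lemma MP_square n (J : {fset nat * nat}) :
    (0 < n)%N -> (forall p, p \in J -> (p.1 + p.2 <= n.-1)%N) -> #|` J| = n ->
  #|~: MP_removed n J| = #|mono (2 * n).-1|.
Proof.
move=> n0 hJ cJ.
have := cardsC (MP_removed n J); rewrite card_cols_in // cJ.
rewrite card1 card_prod card_ord !card_mono.
case: n n0 {hJ cJ} => // n _.
have := bin2_double n.+2; have := bin2_double (2 * n.+1).-1.+2.
rewrite prednK /=; last by rewrite muln_gt0.
set a := 'C(_, _); set b := 'C(_, _); set r := #|_|.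
move=> ha hb hr; nia.
Qed.

Definition MPI n (J : {fset nat * nat}) (n0 : (0 < n)%N)
    (hJ : forall p, p \in J -> (p.1 + p.2 <= n.-1)%N) (cJ : #|` J| = n) :
    'M[KK n]_#|mono (2 * n).-1| :=
  castmx (erefl, MP_square n0 hJ cJ) (remove_cols (MP n) (MP_removed n J)).

Definition MSI n d (J : {fset nat * nat}) (n0 : (0 < n)%N)
    (hJ : forall p, p \in J -> (p.1 + p.2 <= n.-1)%N) (cJ : #|` J| = n) :
    'M[KK n]_#|mono (d.+1 * n).-1| :=
  castmx (erefl, MS_square d n0 hJ cJ)
    (remove_cols (MS n d) (MS_removed n d J)).

(* Integer polynomials in the coefficients of three forms of degree n in three
   variables, and their value at the coefficients of given forms f. *)
Definition res_poly n := {mpoly int[#|{: 'I_3 * mono n}|]}.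

Definition res_eval n (A : comNzRingType) (R : res_poly n)
    (f : 'I_3 -> {mpoly A[3]}) : A :=
  mmap intr (fun v => let im := enum_val v in (f im.1)@_(expo im.2)) R.

Definition irreducible_elt (A : idomainType) (a : A) : Prop :=
  [/\ a != 0, a \isn't a GRing.unit &
      forall b c, a = b * c -> b \is a GRing.unit \/ c \is a GRing.unit].

(* The resultant Res_n is determined up to sign by this property. *)
Definition is_Res n (R : res_poly n) : Prop :=
  irreducible_elt R /\
  forall (k : closedFieldType) (f : 'I_3 -> {mpoly k[3]}),
    (forall i, f i \is n.-homog) ->
    (res_eval R f = 0 <->
     exists p : 'I_3 -> k, (exists i, p i != 0) /\ forall i, (f i).@[p] = 0).

Definition x123 n (i : 'I_3) : {mpoly (KK n)[3]} :=
  xx n (widen_ord (leqnSn 3) i).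

(* Main.v *)
From HB Require Import structures.
Require Import Defs.
From mathcomp Require Import all_boot all_order all_algebra.
From mathcomp Require Import separable closed_field.
From mathcomp Require Import finmap mpoly generic_quotient fraction.
From mathcomp Require Import fingroup perm.
From mathcomp Require Import zify ring.

(* Up to the order of its columns, MS^d_I is the matrix of a family filtered by the
   powers of x1, then x2, then x3: the products x^gamma m with |gamma| = d and
   gamma_4 = 0, m running over the monomials of degree n - 1, and the
   x^gamma x4 m with |gamma| = d - 1 and m in the complement of I.  Replacing x3 and
   the last block by another form and another block multiplies the determinant by
   w ^ 'C(d + 1, 2) * phi ^ 'C(d + 1, 3), where phi, the determinant of the
   multiplication by x3 modulo (x1, x2), does not depend on the block.  Exchanging
   the three forms one after the other for the powers X_i^n, whose determinant is
   1 or -1, gives det_d = +- det_1 ^ 'C(d + 1, 2) * F ^ 'C(d + 1, 3) with F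
   depending only on x1, x2, x3.  For a monomial block and d = 2 this reads
   det_2 = +- det_1 ^ 3 * F, so F can be computed there.

   To see that F = +- Res, let lam_d be det_d with x3 replaced by X_2^n.  Then
   F * lam_1 ^ 3 * lam_2 ^ (n ^ 2) = lam_2 * D, where D is the determinant of lam_2
   times the multiplication by x3 modulo (x1, x2).  The generic eigenvalues of this
   multiplication are distinct, hence D divides, up to a power of lam_2, every
   integer polynomial that vanishes when the three forms have a common zero.  As
   lam_1 and lam_2 only involve x1 and x2, permuting the forms and the variables
   cyclically gives three such denominators without common factor.  So F is an
   integer polynomial dividing Res; it vanishes at an example, so it is not a unit,
   and Res is irreducible. *)

Set Implicit Arguments.
Unset Strict Implicit.
Unset Printing Implicit Defensive.

Import GRing.Theory.
Local Open Scope ring_scope.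

(** * Families of forms and their determinants *)

(** Two obstacles shape the proof. The same columns come in different orders in the matrices, in the
    filtered families and in their permuted versions, so determinants are compared through their
    squares and [sqr_eq] restores the sign at the end. The other obstacle is divisibility among
    integer polynomials in the coefficients, where no factorization into primes is used. It is
    tested along the path [f i + T * 'X_i ^ n]: the powers of the variables dominate in T, so every
    [lam] and every [nu] has a leading coefficient of square 1 and can be divided by. Absence of a
    common factor becomes a Bezout identity with a nonzero constant on one side, and a single
    specialization where the leading coefficients survive is enough to produce it. The same device,
    with a grid of n^2 points, yields distinct eigenvalues. Divisibility by D comes from subtracting
    [T * 'X_2 ^ n] from the third form: this shifts the eigenvalues by T, so that a vanishing
    polynomial becomes, up to a power of the leading coefficient, a multiple of the characteristic
    polynomial in T. *)

Definition mulseq (A : comNzRingType) (f : {mpoly A[3]}) s : seq {mpoly A[3]} :=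
  [seq f * p | p <- s].

Definition comb (A : comNzRingType) (s : seq {mpoly A[3]}) (x : nat -> A) :=
  \sum_(j < size s) x j *: s`_j.

Definition vol (A : comNzRingType) l (s : seq {mpoly A[3]}) : A :=
  \det (\matrix_(i < #|mono l|, j < #|mono l|) (s`_j)@_(expo (enum_val i))).

Definition submodule (A : comNzRingType) (J : {mpoly A[3]} -> Prop) : Prop :=
  J 0 /\ forall a p q, J p -> J q -> J (a *: p + q).

(* [s'] is the image of [s], modulo [J], under a square matrix of determinant
   [x]; indexing by [nat] avoids casts between sizes. *)
Definition trans (A : comNzRingType) (J : {mpoly A[3]} -> Prop) s' s (x : A) :=
  exists2 X : nat -> nat -> A,
    size s' = size s /\ (forall j, (j < size s)%N -> J (s'`_j - comb s (X j)))
  & x = \det (\matrix_(i < size s, j < size s) X i j).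

Definition zeroP (A : comNzRingType) (p : {mpoly A[3]}) : Prop := p = 0.

Definition spanned (A : comNzRingType) (J : {mpoly A[3]} -> Prop) s p : Prop :=
  exists x, J (p - comb s x).

Section Trans.
Variable A : comNzRingType.
Local Notation P := {mpoly A[3]}.
Implicit Types (s : seq P) (J : P -> Prop).

Lemma size_mulseq f s : size (mulseq f s) = size s.
Proof. exact: size_map. Qed.

Lemma nth_mulseq f s j : (mulseq f s)`_j = f * s`_j.
Proof.
have [h|h] := ltnP j (size s); first exact: (nth_map 0).
by rewrite !nth_default ?size_mulseq // mulr0.
Qed.

Lemma mulseq_cat f s s' : mulseq f (s ++ s') = mulseq f s ++ mulseq f s'.
Proof. exact: map_cat. Qed.

Lemma mulseqA f g s : mulseq f (mulseq g s) = mulseq (f * g) s.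
Proof. by rewrite /mulseq -map_comp; apply: eq_map => p /=; rewrite mulrA. Qed.

Lemma mulseq1 s : mulseq 1 s = s.
Proof. by rewrite /mulseq -[RHS]map_id; apply: eq_map => p; rewrite mul1r. Qed.

Lemma submodule0 : submodule (@zeroP A).
Proof. by split=> // a p q -> ->; rewrite scaler0 addr0. Qed.

Lemma submod0 J : submodule J -> J 0. Proof. by case. Qed.

Lemma submodD J p q : submodule J -> J p -> J q -> J (p + q).
Proof. by case=> _ h hp hq; rewrite -[p]scale1r; apply: h. Qed.

Lemma submodZ J a p : submodule J -> J p -> J (a *: p).
Proof. by case=> h0 h hp; rewrite -[_ *: _]addr0; apply: h. Qed.

Lemma submodN J p : submodule J -> J p -> J (- p).
Proof. by move=> hJ hp; rewrite -scaleN1r; apply: submodZ. Qed.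

Lemma submodB J p q : submodule J -> J p -> J q -> J (p - q).
Proof. by move=> hJ hp hq; apply: submodD => //; apply: submodN. Qed.

Lemma submod_sum J (I : Type) (r : seq I) (Q : pred I) (F : I -> P) :
  submodule J -> (forall i, Q i -> J (F i)) -> J (\sum_(i <- r | Q i) F i).
Proof.
move=> hJ h; apply: (big_ind J) => //; first exact: (submod0 hJ).
by move=> p q; apply: submodD.
Qed.

Lemma eq_comb s x y : (forall j, (j < size s)%N -> x j = y j) ->
  comb s x = comb s y.
Proof. by move=> h; apply: eq_bigr => i _; rewrite h. Qed.

Lemma comb_lin s a x y :
  comb s (fun j => a * x j + y j) = a *: comb s x + comb s y.
Proof.
rewrite /comb scaler_sumr -big_split; apply: eq_bigr => i _ /=.
by rewrite scalerDl scalerA.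
Qed.

Lemma comb0 s : comb s (fun=> 0) = 0.
Proof. by rewrite /comb big1 // => i _; rewrite scale0r. Qed.

Lemma comb_sum (I : finType) s a (x : I -> nat -> A) :
  comb s (fun j => \sum_i a i * x i j) = \sum_i a i *: comb s (x i).
Proof.
rewrite /comb (eq_bigr (fun j : 'I_(size s) =>
  \sum_i a i *: (x i j *: s`_j))) => [|j _].
  by rewrite exchange_big; apply: eq_bigr => i _; rewrite scaler_sumr.
by rewrite scaler_suml; apply: eq_bigr => i _; rewrite scalerA.
Qed.

Lemma comb_delta s i : (i < size s)%N -> comb s (fun j => (j == i)%:R) = s`_i.
Proof.
move=> hi; rewrite /comb (bigD1 (Ordinal hi)) //= eqxx scale1r big1 ?addr0 //.
by move=> j /eqP hj; case: eqP => [e|]; [case: hj; apply/val_inj|rewrite scale0r].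
Qed.

Lemma comb_mul f s x : comb (mulseq f s) x = f * comb s x.
Proof.
rewrite /comb mulr_sumr size_mulseq; apply: eq_bigr => i _.
by rewrite nth_mulseq scalerAr.
Qed.

Lemma comb_cat s s' x :
  comb (s ++ s') x = comb s x + comb s' (fun j => x (size s + j)%N).
Proof.
rewrite /comb size_cat big_split_ord /=; congr (_ + _); apply: eq_bigr => i _.
  by rewrite nth_cat ltn_ord.
by rewrite nth_cat ltnNge leq_addr addKn.
Qed.

Lemma spanned_submodule J s : submodule J -> submodule (spanned J s).
Proof.
move=> hJ; split; first by exists (fun=> 0); rewrite comb0 subr0; exact: (submod0 hJ).
move=> a p q [x hx] [y hy]; exists (fun j => a * x j + y j); rewrite comb_lin.
have -> : a *: p + q - (a *: comb s x + comb s y) =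
          a *: (p - comb s x) + (q - comb s y) by rewrite scalerBr; ring.
by case: hJ => _; apply.
Qed.

Lemma spanned_weak J s p : submodule J -> J p -> spanned J s p.
Proof. by exists (fun=> 0); rewrite comb0 subr0. Qed.

Lemma trans_refl J s : submodule J -> trans J s s 1.
Proof.
move=> hJ; exists (fun i j => (j == i)%:R).
  split=> // j hj; rewrite comb_delta // subrr; exact: (submod0 hJ).
rewrite -[LHS](det1 A (size s)); congr (\det _); apply/matrixP => i j.
by rewrite !mxE eq_sym -val_eqE.
Qed.

Lemma trans_weak J J' s' s x : (forall p, J p -> J' p) ->
  trans J s' s x -> trans J' s' s x.
Proof. by move=> h [X [e hX] ->]; exists X => //; split=> // j /hX /h. Qed.

Lemma trans_mul f J J' s' s x : (forall p, J p -> J' (f * p)) ->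
  trans J s' s x -> trans J' (mulseq f s') (mulseq f s) x.
Proof.
move=> h [X [e hX] ->]; exists X; rewrite ?size_mulseq //; split=> // j hj.
by rewrite nth_mulseq comb_mul -mulrBr; apply/h/hX.
Qed.

Lemma trans_comp J s'' s' s x y : submodule J ->
  trans J s'' s' x -> trans J s' s y -> trans J s'' s (x * y).
Proof.
move=> hJ [X [e hX] ->] [Y [e' hY] ->]; rewrite e' in e hX *.
exists (fun i j => \sum_(k < size s) X i k * Y k j); last first.
  rewrite -det_mulmx; congr (\det _); apply/matrixP => i j; rewrite !mxE.
  by apply: eq_bigr => k _; rewrite !mxE.
split=> // j hj; rewrite comb_sum.
have -> : s''`_j - \sum_(i < size s) X j i *: comb s (Y i) =
  (s''`_j - comb s' (X j)) + \sum_(i < size s) X j i *: (s'`_i - comb s (Y i)).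
  rewrite /comb e' -[in RHS]addrA; congr (_ + _).
  by rewrite -sumrN -sumrN -big_split; apply: eq_bigr => i _ /=;
     rewrite scalerBr addrA addNr add0r.
apply: submodD => //; first exact: hX.
by apply: submod_sum => // i _; apply: submodZ => //; apply: hY.
Qed.

Lemma det_block_nat (m1 m2 : nat) (X Y Z : nat -> nat -> A) :
  \det (\matrix_(i < m1 + m2, j < m1 + m2)
    (if (i < m1)%N then if (j < m1)%N then X i j else 0
     else if (j < m1)%N then Z (i - m1)%N j else Y (i - m1)%N (j - m1)%N)) =
  \det (\matrix_(i < m1, j < m1) X i j) * \det (\matrix_(i < m2, j < m2) Y i j).
Proof.
rewrite -(det_lblock _ (\matrix_(i < m2, j < m1) Z i j)); congr (\det _).
apply/matrixP => i j; case: (split_ordP i) => i' ->; case: (split_ordP j) => j' ->;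
  rewrite ?block_mxEul ?block_mxEur ?block_mxEdl ?block_mxEdr !mxE /=;
  by rewrite ?(ltn_ord, ltnNge, leq_addr) /= ?addKn -?ltnNge ?ltn_ord.
Qed.

(** The matrix is block triangular: what [b'] takes from [a] lies outside the diagonal blocks, so
    the relation between [b'] and [b] is only needed modulo the span of [a]. *)
Lemma trans_cat J a' a b' b x y : submodule J ->
  trans J a' a x -> trans (spanned J a) b' b y ->
  trans J (a' ++ b') (a ++ b) (x * y).
Proof.
move=> hJ [X [e hX] ->] [Y [e' hY] ->].
(* [spanned] only asserts existence for each [j]; the induction on [m] gathers the coefficients on
   [a] into one function without a choice axiom. *)
have [Z hZ] : exists Z : nat -> nat -> A, forall j, (j < size b)%N ->
    J (b'`_j - comb b (Y j) - comb a (Z j)).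
  have : forall m, (m <= size b)%N -> exists Z : nat -> nat -> A,
      forall j, (j < m)%N -> J (b'`_j - comb b (Y j) - comb a (Z j)).
    elim=> [|m IH] hm; first by exists (fun _ _ => 0).
    have [Z hZ] := IH (ltnW hm); have [z hz] := hY m hm.
    exists (fun j => if j == m then z else Z j) => j.
    by rewrite ltnS leq_eqVlt; case: eqP => [->|_] //= /hZ.
  by move=> h; apply: (h (size b)).
exists (fun i j => if (i < size a)%N then if (j < size a)%N then X i j else 0
     else if (j < size a)%N then Z (i - size a)%N j
     else Y (i - size a)%N (j - size a)%N); last first.
  by rewrite size_cat det_block_nat.
rewrite !size_cat e e'; split=> // j hj; rewrite nth_cat comb_cat e.
case: ltnP => hja.
  rewrite (eq_comb (y := X j)) => [|i ->] //.
  rewrite [comb b _](eq_comb (y := fun=> 0)) => [|i _].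
    by rewrite comb0 addr0; apply: hX.
  by rewrite ltnNge leq_addr.
rewrite (eq_comb (y := Z (j - size a)%N)) => [|i ->] //.
rewrite [comb b _](eq_comb (y := Y (j - size a)%N)) => [|i _]; last first.
  by rewrite ltnNge leq_addr addKn.
rewrite [_ + comb b _]addrC opprD addrA; apply: hZ; lia.
Qed.

Lemma det_nat_eq (m m' : nat) (F : nat -> nat -> A) : m = m' ->
  \det (\matrix_(i < m, j < m) F i j) = \det (\matrix_(i < m', j < m') F i j).
Proof. by move->. Qed.

Lemma vol_trans l s' s x : size s = #|mono l| -> trans (@zeroP A) s' s x ->
  vol l s' = x * vol l s.
Proof.
move=> es [X [e hX] ->]; rewrite (det_nat_eq _ es) mulrC -[X in _ * X]det_tr.
rewrite -det_mulmx; congr (\det _); apply/matrixP => i j; rewrite !mxE.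
have hj : (j < size s)%N by rewrite es.
have /eqP := hX j hj; rewrite subr_eq0 => /eqP ->.
rewrite /comb raddf_sum es; apply: eq_bigr => k _.
by rewrite !mxE /= mcoeffZ mulrC.
Qed.

(** Reordering contributes a signature, which the square removes; the permutation itself never has
    to be named afterwards. *)
Lemma vol_perm l s s' : perm_eq s s' -> size s = #|mono l| ->
  vol l s ^+ 2 = vol l s' ^+ 2.
Proof.
move=> pss es; have es' : size s' = #|mono l| by rewrite -(perm_size pss).
have [I pI eI] := perm_iotaP 0 pss; have sI : size I = #|mono l|.
  by rewrite (perm_size pI) size_iota.
have ltI (j : 'I_#|mono l|) : (nth 0%N I j < #|mono l|)%N.
  have : nth 0%N I j \in I by rewrite mem_nth // sI.
  by rewrite (perm_mem pI) mem_iota add0n es'.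
pose h j := Ordinal (ltI j).
have hinj : injective h.
  move=> j j' [/eqP]; rewrite nth_uniq ?sI // => [/eqP/val_inj//|].
  by rewrite (perm_uniq pI) iota_uniq.
have -> : vol l s = (-1) ^+ (perm hinj)%g * vol l s'.
  rewrite /vol -det_perm -[in X in _ * X]det_tr -det_mulmx -row_permE -[LHS]det_tr.
  congr (\det _); apply/matrixP => i j; rewrite !mxE permE eI.
  by rewrite (nth_map 0%N) // sI.
by rewrite exprMn sqrr_sign mul1r.
Qed.

End Trans.

(** * Filtration by the powers of the forms *)

Definition volmx (A : comNzRingType) l (s : seq {mpoly A[3]}) :=
  \matrix_(i < #|mono l|, j < #|mono l|) (s`_j)@_(expo (enum_val i)).

(* Cramer numerators of the coordinates of [p] in the family [s]. *)
Definition ccoord (A : comNzRingType) l (s : seq {mpoly A[3]}) p (j : nat) : A :=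
  if insub j is Some j' then
    (\adj (volmx l s) *m \col_i p@_(expo (enum_val i))) j' 0
  else 0.

Definition mons (A : comNzRingType) l : seq {mpoly A[3]} :=
  [seq 'X_[expo m] | m <- enum (mono l)].

Definition homogs (A : comNzRingType) l (s : seq {mpoly A[3]}) : Prop :=
  forall j, s`_j \is l.-homog.

Section Coordinates.
Variable A : comNzRingType.
Local Notation P := {mpoly A[3]}.
Implicit Types (s : seq P) (p q : P).

Lemma homog_eq l p q : p \is l.-homog -> q \is l.-homog ->
  (forall m : mono l, p@_(expo m) = q@_(expo m)) -> p = q.
Proof.
move=> hp hq h; apply/mpolyP => m; have [dm|dm] := eqVneq (mdeg m) l.
  have lm : (mdeg m < l.+1)%N by rewrite dm.
  have hm : mdeg (BMultinom lm) == l by rewrite /= dm.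
  exact: (h (Sub (BMultinom lm) hm)).
by rewrite (dhomog_nemf_coeff hp dm) (dhomog_nemf_coeff hq dm).
Qed.

Lemma homogs_all l s : (forall p, p \in s -> p \is l.-homog) -> homogs l s.
Proof.
move=> h j; have [hj|hj] := ltnP j (size s); first exact/h/mem_nth.
by rewrite nth_default ?dhomog0.
Qed.

Lemma homogs_cat l s s' : homogs l s -> homogs l s' -> homogs l (s ++ s').
Proof. by move=> h h' j; rewrite nth_cat; case: ifP. Qed.

Lemma homogs_mul l e f s : f \is e.-homog -> homogs l s ->
  homogs (e + l) (mulseq f s).
Proof. by move=> hf h j; rewrite nth_mulseq dhomogM. Qed.

Lemma homogs_comb l s x : homogs l s -> comb s x \is l.-homog.
Proof. by move=> h; apply: rpred_sum => i _; apply/dhomogZ/h. Qed.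

Lemma homogs_mons l : homogs l (mons A l).
Proof.
by apply: homogs_all => p /mapP[m _ ->]; rewrite dhomogX; apply: (valP m).
Qed.

Lemma size_mons l : size (mons A l) = #|mono l|.
Proof. by rewrite size_map -cardE. Qed.

Lemma mcoeff_comb s x m : (comb s x)@_m = \sum_(j < size s) x j * (s`_j)@_m.
Proof. by rewrite /comb raddf_sum; apply: eq_bigr => j _ /=; rewrite mcoeffZ. Qed.

(** Cramer's rule kept free of division, so that it applies over the ring of polynomials in the
    coefficients, where [vol] need not be invertible. *)
Lemma comb_ccoord l s p : size s = #|mono l| -> homogs l s -> p \is l.-homog ->
  comb s (ccoord l s p) = vol l s *: p.
Proof.
move=> es hs hp; apply: (@homog_eq l) => [||m]; first exact: homogs_comb.
  exact: dhomogZ.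
rewrite mcoeff_comb mcoeffZ.
have := mul_mx_adj (volmx l s); move/(congr1 (mulmx^~ (\col_i p@_(expo (enum_val i))))).
rewrite mul_scalar_mx -mulmxA => /matrixP/(_ (enum_rank m) 0).
rewrite !mxE enum_rankK => <-; rewrite es; apply: eq_bigr => j _.
by rewrite /ccoord valK mulrC [in RHS]mxE enum_rankK.
Qed.

Lemma ccoord_comb l s x j : size s = #|mono l| -> (j < size s)%N ->
  ccoord l s (comb s x) j = vol l s * x j.
Proof.
move=> es; rewrite es => hj; rewrite /ccoord insubT /=.
have -> : \col_i (comb s x)@_(expo (enum_val i)) =
    volmx l s *m \col_(i < #|mono l|) x i.
  apply/matrixP => i k; rewrite !mxE mcoeff_comb es; apply: eq_bigr => i' _.
  by rewrite !mxE mulrC.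
by rewrite mulmxA mul_adj_mx mul_scalar_mx !mxE.
Qed.

End Coordinates.

Lemma spanned_vol (k : fieldType) l (s : seq {mpoly k[3]}) p :
  size s = #|mono l| -> homogs l s -> vol l s != 0 -> p \is l.-homog ->
  p = comb s (fun j => (vol l s)^-1 * ccoord l s p j).
Proof.
move=> es hs hv hp; rewrite (eq_comb (y := fun j => (vol l s)^-1 * ccoord l s p j + 0)).
  by rewrite comb_lin comb0 addr0 comb_ccoord // scalerA mulVf // scale1r.
by move=> j _; rewrite addr0.
Qed.

Lemma vol_mons (A : comNzRingType) l : vol l (mons A l) = 1.
Proof.
rewrite /vol -(det1 A #|mono l|); congr (\det _); apply/matrixP => i j.
rewrite !mxE (nth_map (enum_val j)) -?cardE // -[nth _ _ _](enum_val_nth _ j).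
rewrite mcoeffX; congr _%:R; rewrite eq_sym.
by rewrite (inj_eq (f := @expo l)) ?(inj_eq enum_val_inj) // => m m' /val_inj/val_inj.
Qed.

(** The degree of a product of [d] forms of degree [n] and a monomial of degree [n - 1]. *)
Definition dg (n d : nat) := (d.+1 * n).-1.

Section Families.
Variables (A : comNzRingType) (n : nat).
Local Notation P := {mpoly A[3]}.

(* [Ns f0 f1 g Q d] lists the products [f0 ^ i * f1 ^ j * g ^ k * p] with [p] a
   monomial of degree [n - 1] and [i + j + k = d], or [p] in [Q] and
   [i + j + k = d - 1].  [Ys] keeps those with [i = 0], [Zs] those with [i = j = 0]. *)
Definition Zs (g : P) (Q : seq P) d :=
  if d is d'.+1 then mulseq (g ^+ d') (mulseq g (mons A n.-1) ++ Q)
  else mons A n.-1.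

Fixpoint Ys (f1 g : P) Q d :=
  if d is d'.+1 then mulseq f1 (Ys f1 g Q d') ++ Zs g Q d else mons A n.-1.

Fixpoint Ns (f0 f1 g : P) Q d :=
  if d is d'.+1 then mulseq f0 (Ns f0 f1 g Q d') ++ Ys f1 g Q d
  else mons A n.-1.

Hypothesis n_gt0 : (0 < n)%N.

Lemma dgS d : dg n d.+1 = (n + dg n d)%N.
Proof. by rewrite /dg; nia. Qed.

Lemma dg0 : dg n 0 = n.-1. Proof. by rewrite /dg mul1n. Qed.

Lemma homog_mulS d (f p : P) : f \is n.-homog -> p \is (dg n d).-homog ->
  f * p \is (dg n d.+1).-homog.
Proof. by move=> hf hp; rewrite dgS dhomogM. Qed.

Section Sizes.
Variables (f0 f1 g : P) (Q : seq P).
Hypothesis Qsize : size Q = 'C(n, 2).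

(** This is the Bezout number of two forms of degree [n]: when [Ns] is a basis, [Zs] is a basis of
    the forms modulo the first two. *)
Lemma size_Zs d : size (Zs g Q d.+1) = (n * n)%N.
Proof.
rewrite /= size_mulseq size_cat size_mulseq size_mons card_mono Qsize.
by rewrite prednK // binS bin1; have := bin2_double n; nia.
Qed.

Lemma size_Ys d : size (Ys f1 g Q d) = ('C(n.+1, 2) + d * (n * n))%N.
Proof.
elim: d => [|d IH]; first by rewrite size_mons card_mono prednK // addn0.
by rewrite [LHS]size_cat size_mulseq IH size_Zs; nia.
Qed.

Lemma size_Ns d : size (Ns f0 f1 g Q d) = #|mono (dg n d)|.
Proof.
have -> : #|mono (dg n d)| = 'C((d.+1 * n).+1, 2).
  by rewrite card_mono /dg prednK // muln_gt0.
elim: d => [|d IH]; first by rewrite mul1n size_mons card_mono prednK.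
rewrite [LHS]size_cat size_mulseq IH size_Ys.
have := bin2_double n.+1; have := bin2_double (d.+1 * n).+1.
have := bin2_double (d.+2 * n).+1; rewrite /=.
by move: 'C(_, _) 'C(_, _) 'C(_, _) => a b c; nia.
Qed.

End Sizes.

Lemma homogs_Zs g Q d : g \is n.-homog -> homogs (dg n 1) Q ->
  homogs (dg n d) (Zs g Q d).
Proof.
move=> gh Qh; case: d => [|d]; first by rewrite dg0; apply: homogs_mons.
have -> : dg n d.+1 = (n * d + dg n 1)%N by rewrite /dg; nia.
apply: homogs_mul; first exact: dhomogMn.
by apply: homogs_cat => //; rewrite dgS dg0; apply/homogs_mul/homogs_mons.
Qed.

Lemma homogs_Ys f1 g Q d : f1 \is n.-homog -> g \is n.-homog ->
  homogs (dg n 1) Q -> homogs (dg n d) (Ys f1 g Q d).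
Proof.
move=> f1h gh Qh; elim: d => [|d IH]; first by rewrite dg0; apply: homogs_mons.
by apply: homogs_cat (homogs_Zs d.+1 gh Qh); rewrite dgS; apply: homogs_mul.
Qed.

Lemma homogs_Ns f0 f1 g Q d : f0 \is n.-homog -> f1 \is n.-homog ->
  g \is n.-homog -> homogs (dg n 1) Q -> homogs (dg n d) (Ns f0 f1 g Q d).
Proof.
move=> f0h f1h gh Qh; elim: d => [|d IH]; first by rewrite dg0; apply: homogs_mons.
by apply: homogs_cat (homogs_Ys d.+1 f1h gh Qh); rewrite dgS; apply: homogs_mul.
Qed.

End Families.
Arguments mulseq : simpl never.
Arguments Zs : simpl never.

(* The degree [dg n d.+1] part of the ideals [(f0)] and [(f0, f1)]. *)
Definition ideal1 (A : comNzRingType) n (f0 : {mpoly A[3]}) d p : Prop :=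
  exists2 q, q \is (dg n d).-homog & p = f0 * q.
Definition ideal2 (A : comNzRingType) n (f0 f1 : {mpoly A[3]}) d p : Prop :=
  exists q0 q1, [/\ q0 \is (dg n d).-homog, q1 \is (dg n d).-homog
    & p = f0 * q0 + f1 * q1].

Section Compare.
Variables (k : fieldType) (n : nat).
Hypothesis n_gt0 : (0 < n)%N.
Local Notation P := {mpoly k[3]}.
Variables (f0 f1 g : P) (Q : seq P).
Hypotheses (f0h : f0 \is n.-homog) (f1h : f1 \is n.-homog).
Hypotheses (gh : g \is n.-homog) (Qh : homogs (dg n 1) Q).
Hypothesis Qsize : size Q = 'C(n, 2).
Hypothesis vol_n0 : forall d, vol (dg n d) (Ns n f0 f1 g Q d) != 0.

Lemma submodule_ideal1 d : submodule (ideal1 n f0 d).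
Proof.
split; first by exists 0; rewrite ?mulr0 ?dhomog0.
move=> a p q [p' hp ->] [q' hq ->]; exists (a *: p' + q').
  by apply: dhomogD => //; apply: dhomogZ.
by rewrite mulrDr scalerAr.
Qed.

Lemma submodule_ideal2 d : submodule (ideal2 n f0 f1 d).
Proof.
split; first by exists 0, 0; rewrite !mulr0 addr0 dhomog0.
move=> a p q [p0 [p1 [hp0 hp1 ->]]] [q0 [q1 [hq0 hq1 ->]]].
exists (a *: p0 + q0), (a *: p1 + q1); split.
- by apply: dhomogD => //; apply: dhomogZ.
- by apply: dhomogD => //; apply: dhomogZ.
by rewrite !mulrDr scalerDr !scalerAr; ring.
Qed.

Lemma ideal2_mul d h p : h \is n.-homog -> ideal2 n f0 f1 d p ->
  ideal2 n f0 f1 d.+1 (h * p).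
Proof.
move=> hh [q0 [q1 [h0 h1 ->]]]; exists (h * q0), (h * q1).
by split; [exact: homog_mulS|exact: homog_mulS|ring].
Qed.

Lemma spanned_Ns d p : p \is (dg n d).-homog ->
  spanned (@zeroP k) (Ns n f0 f1 g Q d) p.
Proof.
move=> hp; have := spanned_vol (size_Ns n_gt0 f0 f1 g Qsize d)
  (homogs_Ns n_gt0 d f0h f1h gh Qh) (vol_n0 d) hp.
by move=> e; eexists; apply/eqP; rewrite subr_eq0; apply/eqP; exact: e.
Qed.

(** The basis [Ns] splits [q] into a multiple of [f0] and a combination of [Ys]; after
    multiplication by [f1] the former still lies in the ideal of [f0]. *)
Lemma spanned_Ys d q : q \is (dg n d).-homog ->
  spanned (ideal1 n f0 d) (mulseq f1 (Ys n f1 g Q d)) (f1 * q).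
Proof.
move=> hq; have [x /eqP] := spanned_Ns hq; rewrite subr_eq0 => /eqP ->.
case: d {hq} x => [|d] x; first by
  exists x; rewrite comb_mul subrr; apply: (submod0 (submodule_ideal1 0)).
rewrite [Ns _ _ _ _ _ _]/= comb_cat comb_mul.
exists (fun j => x (size (mulseq f0 (Ns n f0 f1 g Q d)) + j)%N).
rewrite comb_mul mulrDr addrK mulrCA.
exists (f1 * comb (Ns n f0 f1 g Q d) x) => //.
by apply: homog_mulS => //; apply/homogs_comb/homogs_Ns.
Qed.

Lemma spanned_Zs d p : p \is (dg n d.+1).-homog ->
  spanned (ideal2 n f0 f1 d) (Zs n g Q d.+1) p.
Proof.
move=> hp; have [x /eqP] := spanned_Ns hp; rewrite subr_eq0 => /eqP ->.
rewrite [Ns _ _ _ _ _ _]/= catA comb_cat.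
exists (fun j => x (size (mulseq f0 (Ns n f0 f1 g Q d) ++
  mulseq f1 (Ys n f1 g Q d)) + j)%N); rewrite addrK.
rewrite comb_cat !comb_mul; do 2!eexists; split; last reflexivity.
  by apply: homogs_comb; apply: homogs_Ns.
by apply: homogs_comb; apply: homogs_Ys.
Qed.

Section Ratio.
Variables (f2 : P) (Q' : seq P) (w phi : k).
Hypotheses (f2h : f2 \is n.-homog).
Hypothesis w_def : trans (ideal2 n f0 f1 0) (Zs n f2 Q' 1) (Zs n g Q 1) w.
Hypothesis phi_def :
  trans (ideal2 n f0 f1 1) (mulseq f2 (Zs n g Q 1)) (Zs n g Q 2) phi.

Lemma mul_Zs h R d :
  mulseq h (Zs n h R d.+1) = Zs n h R d.+2 :> seq P.
Proof. by rewrite /Zs mulseqA -exprS. Qed.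

(** Multiplication by [g] shifts both families by one level and leaves the matrix unchanged, so one
    [phi] serves all levels. *)
Lemma trans_mulZ d :
  trans (ideal2 n f0 f1 d.+1) (mulseq f2 (Zs n g Q d.+1)) (Zs n g Q d.+2) phi.
Proof.
elim: d => [//|d IH]; rewrite -mul_Zs -[Zs n g Q d.+3]mul_Zs mulseqA mulrC -mulseqA.
by apply: trans_mul IH => p; apply: ideal2_mul.
Qed.

(** Going up one level multiplies by [f2]; rewriting the result on the powers of [g] costs one
    factor [phi]. *)
Lemma trans_Zs d :
  trans (ideal2 n f0 f1 d) (Zs n f2 Q' d.+1) (Zs n g Q d.+1) (w * phi ^+ d).
Proof.
elim: d => [|d IH]; first by rewrite mulr1.
rewrite exprSr mulrA -mul_Zs; apply: trans_comp (trans_mulZ d).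
  exact: submodule_ideal2.
by apply: trans_mul IH => p; apply: ideal2_mul.
Qed.

(** The blocks contribute [w * phi ^ e] for [e] from 0 to [d], whence the first binomial; [trans_Ns]
    sums a second time, whence the exponents of the theorem. *)
Lemma trans_Ys d :
  trans (ideal1 n f0 d) (Ys n f1 f2 Q' d.+1) (Ys n f1 g Q d.+1)
    (w ^+ d.+1 * phi ^+ 'C(d.+1, 2)).
Proof.
have hZ e : trans (spanned (ideal1 n f0 e) (mulseq f1 (Ys n f1 g Q e)))
    (Zs n f2 Q' e.+1) (Zs n g Q e.+1) (w * phi ^+ e).
  apply: trans_weak (trans_Zs e) => p [q0 [q1 [h0 h1 ->]]].
  apply: submodD; first exact/spanned_submodule/submodule_ideal1.
    by apply: spanned_weak; [exact: submodule_ideal1|exists q0].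
  exact: spanned_Ys.
elim: d => [|d IH].
  have := trans_cat (submodule_ideal1 0)
    (trans_refl (mulseq f1 (mons k n.-1)) (submodule_ideal1 0)) (hZ 0).
  by rewrite mul1r expr1 bin_small.
have -> : w ^+ d.+2 * phi ^+ 'C(d.+2, 2) =
    w ^+ d.+1 * phi ^+ 'C(d.+1, 2) * (w * phi ^+ d.+1).
  by rewrite (binS d.+1 1) bin1 exprD [w ^+ d.+2]exprSr; ring.
rewrite ![Ys _ _ _ _ d.+2]/=.
apply: (trans_cat (submodule_ideal1 d.+1)); last exact: hZ.
apply: trans_mul IH => p [q hq ->]; exists (f1 * q); first exact: homog_mulS.
by rewrite mulrCA.
Qed.

Theorem trans_Ns d :
  trans (@zeroP k) (Ns n f0 f1 f2 Q' d) (Ns n f0 f1 g Q d)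
    (w ^+ 'C(d.+1, 2) * phi ^+ 'C(d.+1, 3)).
Proof.
elim: d => [|d IH].
  by rewrite !bin_small // !expr0 mulr1; apply/trans_refl/submodule0.
have -> : w ^+ 'C(d.+2, 2) * phi ^+ 'C(d.+2, 3) =
    w ^+ 'C(d.+1, 2) * phi ^+ 'C(d.+1, 3) * (w ^+ d.+1 * phi ^+ 'C(d.+1, 2)).
  by rewrite (binS d.+1 1) bin1 (binS d.+1 2) !exprD; ring.
apply: (trans_cat (submodule0 k)).
  by apply: trans_mul IH => p ->; rewrite /zeroP mulr0.
apply: trans_weak (trans_Ys d) => p [q hq ->].
have [x /eqP] := spanned_Ns hq; rewrite subr_eq0 => /eqP ->.
by exists x; rewrite comb_mul /zeroP subrr.
Qed.

Corollary vol_Ns d : vol (dg n d) (Ns n f0 f1 f2 Q' d) =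
  w ^+ 'C(d.+1, 2) * phi ^+ 'C(d.+1, 3) * vol (dg n d) (Ns n f0 f1 g Q d).
Proof. by apply: vol_trans (trans_Ns d); rewrite size_Ns. Qed.

End Ratio.

Lemma trans_Zs_ex d s : size s = (n * n)%N -> homogs (dg n d.+1) s ->
  exists x, trans (ideal2 n f0 f1 d) s (Zs n g Q d.+1) x.
Proof.
move=> es hs; pose Z := Zs n g Q d.+1.
have eZ : size Z = size s by rewrite es size_Zs.
have : forall m, exists X : nat -> nat -> k, forall j, (j < m)%N ->
    ideal2 n f0 f1 d (s`_j - comb Z (X j)).
  elim=> [|m [X hX]]; first by exists (fun _ _ => 0).
  have [x hx] := spanned_Zs (hs m); exists (fun j => if j == m then x else X j) => j.
  by rewrite ltnS leq_eqVlt; case: eqP => [->|_] //= /hX.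
by case/(_ (size Z)) => X hX; exists (\det (\matrix_(i < size Z, j < size Z) X i j)), X.
Qed.

End Compare.

(** * Exponent vectors and the symmetric description of the families *)

Definition o0 : 'I_3 := ord0.
Definition o1 : 'I_3 := Ordinal (isT : (1 < 3)%N).
Definition o2 : 'I_3 := Ordinal (isT : (2 < 3)%N).

Lemma ord3P (Q : 'I_3 -> Prop) : Q o0 -> Q o1 -> Q o2 -> forall i, Q i.
Proof.
move=> h0 h1 h2 [[|[|[|//]]] hi]; [move: h0|move: h1|move: h2];
  by congr Q; apply/val_inj.
Qed.

Lemma big_ord3 (R : Type) (idx : R) (op : Monoid.law idx) (F : 'I_3 -> R) :
  \big[op/idx]_i F i = op (F o0) (op (F o1) (F o2)).
Proof.
rewrite !big_ord_recl big_ord0 Monoid.mulm1.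
by congr (op (F _) (op (F _) (F _))); apply/val_inj.
Qed.

Definition expos l : seq 'X_{1..3} := [seq expo m | m <- enum (mono l)].

(** Degree [l - 1], but empty for [l = 0], where truncated subtraction would give degree 0 again. *)
Definition expos_pred l := if l is l'.+1 then expos l' else [::].

Definition mperm3 (s : 'S_3) (m : 'X_{1..3}) : 'X_{1..3} :=
  [multinom m (s i) | i < 3].

Section Exponents.

Lemma mdeg_o (m : 'X_{1..3}) : mdeg m = (m o0 + m o1 + m o2)%N.
Proof. by rewrite mdegE big_ord3 /= addnA. Qed.

Lemma mnm3P (m m' : 'X_{1..3}) :
  m o0 = m' o0 -> m o1 = m' o1 -> m o2 = m' o2 -> m = m'.
Proof. by move=> h0 h1 h2; apply/mnmP; apply: ord3P. Qed.

Lemma expos_uniq l : uniq (expos l).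
Proof.
by rewrite map_inj_uniq ?enum_uniq // => m m' /val_inj/val_inj.
Qed.

Lemma mem_expos l m : (m \in expos l) = (mdeg m == l).
Proof.
apply/mapP/idP => [[m' _ ->]|hm]; first exact: (valP m').
have lm : (mdeg m < l.+1)%N by rewrite (eqP hm).
by exists (Sub (BMultinom lm) hm : mono l); rewrite ?mem_enum.
Qed.

Lemma mem_expos_pred l m : (m \in expos_pred l) = (mdeg m + 1 == l)%N.
Proof. by case: l => [|l]; rewrite /= ?mem_expos ?addn1. Qed.

Lemma expos_pred_uniq l : uniq (expos_pred l).
Proof. by case: l => //= l; apply: expos_uniq. Qed.

Lemma mnmwt1E (i j : 'I_3) : (U_(i)%MM : 'X_{1..3}) j = (i == j).
Proof. by rewrite mnm1E. Qed.

(** The recursion of [Ys] and [Ns] read on exponents: either one factor of index [i] can be removed,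
    or there is none. The predicate [P] carries the condition that an earlier coordinate is 0. *)
Lemma expos_split (P : 'X_{1..3} -> bool) (i : 'I_3) l :
    (forall m, P (U_(i) + m)%MM = P m) ->
  perm_eq [seq m : 'X_{1..3} <- expos l | P m]
    ([seq (U_(i) + m)%MM | m <- [seq m : 'X_{1..3} <- expos_pred l | P m]] ++
     [seq m : 'X_{1..3} <- expos l | P m && (m i == 0%N)]).
Proof.
move=> hP; apply: uniq_perm => [||m].
- exact/filter_uniq/expos_uniq.
- rewrite cat_uniq map_inj_uniq => [|m m' /addmI//].
  rewrite !filter_uniq ?expos_uniq ?expos_pred_uniq // andbT /=.
  apply/hasPn => m; rewrite mem_filter => /andP[/andP[_ /eqP m0] _].
  by apply/mapP => -[m' _ e]; move: m0; rewrite e mnmDE mnmwt1E eqxx.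
rewrite mem_cat !mem_filter mem_expos.
apply/idP/idP => [/andP[Pm hm]|/orP[/mapP[m' + ->]|/andP[/andP[-> _]->]//]].
  rewrite Pm hm andbT /= orbC; case: eqP => //= /eqP m0.
  have e : m = (U_(i) + (m - U_(i)))%MM.
    by rewrite addmC submK // lep1mP.
  apply/mapP; exists (m - U_(i))%MM => //.
  rewrite mem_filter mem_expos_pred -hP -e Pm.
  by have := congr1 mdeg e; rewrite mdegD mdeg1 => h; apply/eqP; lia.
rewrite mem_filter mem_expos_pred hP => /andP[-> /eqP <-].
by rewrite mdegD mdeg1 addnC /= eqxx.
Qed.

Lemma mperm3_inj s : injective (mperm3 s).
Proof.
move=> m m' /mnmP h; apply/mnmP => i.
by have := h ((s^-1)%g i); rewrite !mnmE permKV.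
Qed.

Lemma mdeg_mperm3 s m : mdeg (mperm3 s m) = mdeg m.
Proof.
rewrite !mdegE [RHS](reindex_inj (@perm_inj _ s)) /=.
by apply: eq_bigr => i _; rewrite mnmE.
Qed.

Lemma mperm3VK s : cancel (mperm3 s^-1) (mperm3 s).
Proof. by move=> m; apply/mnmP => i; rewrite !mnmE permK. Qed.

Lemma perm_expos s l : perm_eq [seq mperm3 s m | m <- expos l] (expos l).
Proof.
apply: uniq_perm => [||m]; last 1 first.
- rewrite mem_expos; apply/mapP/idP => [[m' h ->]|h].
    by rewrite mdeg_mperm3 -mem_expos.
  by exists (mperm3 (s^-1)%g m); rewrite ?mperm3VK // mem_expos mdeg_mperm3.
- by rewrite (map_inj_uniq (@mperm3_inj s)) expos_uniq.
exact: expos_uniq.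
Qed.

Lemma perm_expos_pred s l :
  perm_eq [seq mperm3 s m | m <- expos_pred l] (expos_pred l).
Proof. by case: l => //= l; apply: perm_expos. Qed.

End Exponents.

Section Canonical.
Variables (A : comNzRingType) (n : nat).
Local Notation P := {mpoly A[3]}.
Implicit Types (f : 'I_3 -> P) (L : seq 'X_{1..3}) (s Q : seq P).

Definition fpow f (m : 'X_{1..3}) : P := \prod_i f i ^+ m i.

Definition allp f L s : seq P := [seq fpow f m * p | m <- L, p <- s].

Definition NN f Q d := Ns n (f o0) (f o1) (f o2) Q d.

Lemma fpowS f i m : fpow f (U_(i) + m)%MM = f i * fpow f m.
Proof.
rewrite /fpow (eq_bigr (fun j => f j ^+ (i == j) * f j ^+ m j)); last first.
  by move=> j _; rewrite mnmDE mnmwt1E exprD.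
rewrite big_split; congr (_ * _); rewrite (bigD1 i) //= eqxx big1 ?mulr1 //.
by move=> j /negPf; rewrite eq_sym => ->.
Qed.

Lemma allp_cat f L L' s : allp f (L ++ L') s = allp f L s ++ allp f L' s.
Proof. by rewrite /allp map_cat flatten_cat. Qed.

Lemma mulseq_allp f i L s :
  mulseq (f i) (allp f L s) = allp f [seq (U_(i) + m)%MM | m <- L] s.
Proof.
rewrite /allp; elim: L => //= m L IH; rewrite mulseq_cat IH; congr (_ ++ _).
by rewrite /mulseq -map_comp; apply: eq_map => p /=; rewrite fpowS mulrA.
Qed.

Lemma allp1 f m s : allp f [:: m] s = mulseq (fpow f m) s.
Proof. exact: cats0. Qed.

Lemma perm_allp f L L' s : perm_eq L L' -> perm_eq (allp f L s) (allp f L' s).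
Proof. by move=> h; apply: perm_allpairs. Qed.

Lemma perm_cat22 (T : eqType) (a b c d a' b' : seq T) :
  perm_eq a' (a ++ c) -> perm_eq b' (b ++ d) ->
  perm_eq ((a ++ b) ++ (c ++ d)) (a' ++ b').
Proof.
move=> ha hb; rewrite perm_catACA.
by rewrite perm_sym; apply: perm_cat.
Qed.

Lemma mulseq_perm (f : P) s s' : perm_eq s s' ->
  perm_eq (mulseq f s) (mulseq f s').
Proof. exact: perm_map. Qed.

Lemma Zs_canonical f Q d :
  perm_eq (Zs n (f o2) Q d.+1)
   (allp f [seq m : 'X_{1..3} <- expos d.+1 | (m o0 == 0%N) && (m o1 == 0%N)] (mons A n.-1) ++
    allp f [seq m : 'X_{1..3} <- expos d | (m o0 == 0%N) && (m o1 == 0%N)] Q).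
Proof.
have E l : [seq m : 'X_{1..3} <- expos l | (m o0 == 0%N) && (m o1 == 0%N)] = [:: (U_(o2) *+ l)%MM].
  apply: perm_small_eq => //; apply: uniq_perm; rewrite ?filter_uniq ?expos_uniq //.
  move=> m; rewrite mem_filter mem_expos inE mdeg_o.
  apply/idP/eqP => [|->]; last by rewrite !mulmnE !mnmwt1E /= mul1n !mul0n !eqxx.
  case/andP=> /andP[/eqP h0 /eqP h1] /eqP h.
  by apply: mnm3P; rewrite mulmnE mnmwt1E /= ?mul1n ?mul0n //; lia.
have Ef l : fpow f (U_(o2) *+ l)%MM = f o2 ^+ l.
  by rewrite /fpow big_ord3 /= !mulmnE !mnmwt1E /= mul1n !mul0n !expr0 !mul1r.
by rewrite !E !allp1 !Ef /Zs mulseq_cat mulseqA -exprSr.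
Qed.

Lemma Ys_canonical f Q d :
  perm_eq (Ys n (f o1) (f o2) Q d)
    (allp f [seq m : 'X_{1..3} <- expos d | m o0 == 0%N] (mons A n.-1) ++
     allp f [seq m : 'X_{1..3} <- expos_pred d | m o0 == 0%N] Q).
Proof.
elim: d => [|d IH].
  have -> : expos 0 = [:: 0%MM].
    apply: perm_small_eq => //; apply: uniq_perm; rewrite ?expos_uniq // => m.
    by rewrite mem_expos mdeg_eq0 inE.
  by rewrite /= mnm0E allp1 /fpow big1 ?mulseq1 ?cats0 // => i _; rewrite mnm0E.
have hP m : ((U_(o1) + m)%MM o0 == 0%N) = (m o0 == 0%N) by rewrite mnmDE mnmwt1E.
have h := expos_split _ hP.
apply: perm_trans (perm_cat (mulseq_perm (f o1) IH) (Zs_canonical f Q d)) _.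
rewrite mulseq_cat !mulseq_allp.
apply: perm_cat22; rewrite -allp_cat; apply: perm_allp; first exact: h d.+1.
exact: h d.
Qed.

(** The right-hand side treats the three forms alike. Hence the forms may be permuted, although the
    filtration depends on their order. *)
Lemma Ns_canonical f Q d :
  perm_eq (NN f Q d) (allp f (expos d) (mons A n.-1) ++ allp f (expos_pred d) Q).
Proof.
elim: d => [|d IH].
  have := Ys_canonical f Q 0; rewrite /= !cats0 => /permPl h.
  rewrite /NN /= h; apply: perm_allp; rewrite (eq_in_filter (a2 := xpredT)).
    by rewrite filter_predT.
  by move=> m; rewrite mem_expos mdeg_eq0 => /eqP ->; rewrite mnm0E.
have h l := @expos_split xpredT o0 l (fun=> erefl).
apply: perm_trans (perm_cat (mulseq_perm (f o0) IH) (Ys_canonical f Q d.+1)) _.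
rewrite mulseq_cat !mulseq_allp.
apply: perm_cat22; rewrite -allp_cat; apply: perm_allp.
  by have := h d.+1; rewrite !filter_predT.
by have := h d; rewrite !filter_predT.
Qed.

Lemma fpow_perm f (s : 'S_3) m : fpow (fun i => f (s i)) m = fpow f (mperm3 s^-1 m).
Proof.
rewrite /fpow [RHS](reindex_inj (@perm_inj _ s)) /=.
by apply: eq_bigr => i _; rewrite mnmE permK.
Qed.

Lemma allp_perm f (s : 'S_3) L Q :
  allp (fun i => f (s i)) L Q = allp f [seq mperm3 s^-1 m | m <- L] Q.
Proof.
rewrite /allp; elim: L => //= m L ->; congr (_ ++ _).
by apply: eq_map => p; rewrite fpow_perm.
Qed.

Lemma Ns_perm f (s : 'S_3) Q d : perm_eq (NN (fun i => f (s i)) Q d) (NN f Q d).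
Proof.
apply: perm_trans (Ns_canonical _ Q d) _; rewrite perm_sym.
apply: perm_trans (Ns_canonical _ Q d) _; rewrite perm_sym !allp_perm.
by apply: perm_cat; apply: perm_allp; [exact: perm_expos|exact: perm_expos_pred].
Qed.

Lemma Ns_perm_Q f Q Q' d : perm_eq Q Q' -> perm_eq (NN f Q d) (NN f Q' d).
Proof.
move=> h; apply: perm_trans (Ns_canonical _ Q d) _; rewrite perm_sym.
apply: perm_trans (Ns_canonical _ Q' d) _; rewrite perm_sym.
by apply: perm_cat => //; apply: perm_allpairs.
Qed.

End Canonical.

(** * Comparison with the powers of the variables *)

Definition volN (A : comNzRingType) n (f : 'I_3 -> {mpoly A[3]}) Q d : A :=
  vol (dg n d) (NN n f Q d).

Section Functoriality.
Variables (A B : comNzRingType) (e : {rmorphism A -> B}).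
Implicit Types s Q : seq {mpoly A[3]}.

Lemma map_mons l : map (map_mpoly e) (mons A l) = mons B l.
Proof.
by rewrite /mons -map_comp; apply: eq_map => m /=; rewrite map_mpolyX.
Qed.

Lemma map_mulseq f s :
  map (map_mpoly e) (mulseq f s) = mulseq (map_mpoly e f) (map (map_mpoly e) s).
Proof.
by rewrite /mulseq -!map_comp; apply: eq_map => p /=; rewrite rmorphM.
Qed.

Lemma map_Zs n g Q d : map (map_mpoly e) (Zs n g Q d) =
  Zs n (map_mpoly e g) (map (map_mpoly e) Q) d.
Proof.
case: d => [|d]; first exact: map_mons.
by rewrite /Zs map_mulseq map_cat map_mulseq map_mons rmorphXn.
Qed.

Lemma map_Ys n f1 g Q d : map (map_mpoly e) (Ys n f1 g Q d) =
  Ys n (map_mpoly e f1) (map_mpoly e g) (map (map_mpoly e) Q) d.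
Proof.
elim: d => [|d IH]; first exact: map_mons.
by rewrite /= map_cat map_mulseq IH map_Zs.
Qed.

Lemma map_Ns n f0 f1 g Q d : map (map_mpoly e) (Ns n f0 f1 g Q d) =
  Ns n (map_mpoly e f0) (map_mpoly e f1) (map_mpoly e g) (map (map_mpoly e) Q) d.
Proof.
elim: d => [|d IH]; first exact: map_mons.
rewrite [Ns _ _ _ _ _ _]/= map_cat map_mulseq IH [in RHS]/=; congr (_ ++ _).
exact: (map_Ys _ _ _ _ d.+1).
Qed.

Lemma nth_map_mpoly s j : (map (map_mpoly e) s)`_j = map_mpoly e s`_j.
Proof.
have [h|h] := ltnP j (size s); first exact: (nth_map 0).
by rewrite !nth_default ?size_map // rmorph0.
Qed.

Lemma map_volmx l s : volmx l (map (map_mpoly e) s) = map_mx e (volmx l s).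
Proof.
by apply/matrixP => i j; rewrite !mxE nth_map_mpoly mcoeff_map_mpoly.
Qed.

Lemma map_vol l s : vol l (map (map_mpoly e) s) = e (vol l s).
Proof. by rewrite /vol -det_map_mx -map_volmx. Qed.

Lemma map_volN n f Q d : volN n (fun i => map_mpoly e (f i))
  (map (map_mpoly e) Q) d = e (volN n f Q d).
Proof. by rewrite /volN /NN -map_Ns map_vol. Qed.

Lemma map_ccoord l s p j :
  ccoord l (map (map_mpoly e) s) (map_mpoly e p) j = e (ccoord l s p j).
Proof.
rewrite /ccoord; case: insubP => [j' _ _|_]; last by rewrite rmorph0.
rewrite map_volmx -map_mx_adj !mxE rmorph_sum; apply: eq_bigr => i _ /=.
by rewrite [RHS]rmorphM /= !mxE mcoeff_map_mpoly.
Qed.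

Lemma homogs_map l s : homogs l s -> homogs l (map (map_mpoly e) s).
Proof.
move=> h j; rewrite nth_map_mpoly; apply/dhomogP => m.
rewrite mcoeff_msupp mcoeff_map_mpoly => hm; apply/eqP.
by apply: contraNT hm => hm; rewrite (dhomog_nemf_coeff (h j) hm) raddf0.
Qed.

Lemma map_homog l (p : {mpoly A[3]}) : p \is l.-homog ->
  map_mpoly e p \is l.-homog.
Proof.
move=> h; have hs : homogs l [:: p] by case=> [|[|j]] //=; rewrite dhomog0.
exact: (homogs_map hs 0%N).
Qed.

End Functoriality.

Section Monomials.
Variables (n : nat).
Hypothesis n_gt0 : (0 < n)%N.

Definition reduced (m : 'X_{1..3}) := [forall i, (m i < n)%N].

(** The block that suits the powers of the variables: the monomials of degree [2 * n - 1] divisible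
    by no ['X_i ^ n]. *)
Definition QQ (A : comNzRingType) : seq {mpoly A[3]} :=
  [seq 'X_[m] | m <- expos (dg n 1) & reduced m].

Definition xpn (A : comNzRingType) (i : 'I_3) : {mpoly A[3]} := 'X_i ^+ n.

Lemma map_QQ (A B : comNzRingType) (e : {rmorphism A -> B}) :
  map (map_mpoly e) (QQ A) = QQ B.
Proof.
by rewrite /QQ -map_comp; apply: eq_map => m /=; rewrite map_mpolyX.
Qed.

Lemma map_xpn (A B : comNzRingType) (e : {rmorphism A -> B}) i :
  map_mpoly e (xpn A i) = xpn B i.
Proof. by rewrite /xpn rmorphXn /= map_mpolyX. Qed.

Lemma homogs_QQ A : homogs (dg n 1) (QQ A).
Proof.
apply: homogs_all => p /mapP[m]; rewrite mem_filter mem_expos => /andP[_ hm] ->.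
by rewrite dhomogX.
Qed.

Lemma xpn_homog A i : xpn A i \is n.-homog.
Proof. by rewrite /xpn mpolyXn dhomogX; rewrite /= mdegMn mdeg1 mul1n. Qed.

Lemma fpow_xpn A (m : 'X_{1..3}) : fpow (xpn A) m = 'X_[m *+ n].
Proof.
rewrite /fpow mpolyXE_id; apply: eq_bigr => i _.
by rewrite /xpn -exprM mulmnE mulnC.
Qed.

Definition qmon (m : 'X_{1..3}) : 'X_{1..3} := [multinom (m i %/ n)%N | i < 3].
Definition rmon (m : 'X_{1..3}) : 'X_{1..3} := [multinom (m i %% n)%N | i < 3].

Lemma qrmon m : m = (qmon m *+ n + rmon m)%MM.
Proof. by apply/mnmP => i; rewrite mnmDE mulmnE !mnmE -divn_eq. Qed.

Lemma reduced_rmon m : reduced (rmon m).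
Proof. by apply/forallP => i; rewrite mnmE ltn_mod. Qed.

Lemma reduced_eq a r a' r' : reduced r -> reduced r' ->
  (a *+ n + r = a' *+ n + r')%MM -> a = a' /\ r = r'.
Proof.
move=> /forallP hr /forallP hr' /mnmP h; suff e i : a i = a' i /\ r i = r' i.
  by split; apply/mnmP => i; case: (e i).
have := h i; rewrite !mnmDE !mulmnE => E.
have := congr1 (modn^~ n) E; rewrite !modnMDl !modn_small // => er.
by split=> //; move/eqP: E; rewrite er eqn_add2r eqn_pmul2r // => /eqP.
Qed.

Lemma reduced_small m : (mdeg m < n)%N -> reduced m.
Proof.
move=> h; apply/forallP => i; apply: leq_ltn_trans h.
by rewrite mdegE (bigD1 i) //= leq_addr.
Qed.

Lemma mdeg_reduced m : reduced m -> (mdeg m <= 3 * n - 3)%N.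
Proof.
move=> /forallP h; rewrite mdeg_o; have := h o0; have := h o1; have := h o2; lia.
Qed.

Definition monos_of d : seq 'X_{1..3} :=
  [seq (a *+ n + r)%MM | a <- expos d, r <- expos n.-1] ++
  [seq (a *+ n + r)%MM | a <- expos_pred d, r <- [seq m <- expos (dg n 1) | reduced m]].

(** Division of the exponents by [n] leaves a reduced remainder of degree at most [3 * n - 3] and
    congruent to -1 modulo [n], that is, of degree [n - 1] or [2 * n - 1]. These are the two parts
    of the family. *)
Lemma mem_monos_of d : monos_of d =i expos (dg n d).
Proof.
move=> m; rewrite mem_cat mem_expos; apply/orP/idP.
  case=> /allpairsP[[a r] /= [ha hr ->]].
    move: ha hr; rewrite !mem_expos mdegD mdegMn => /eqP -> /eqP ->; rewrite /dg.
    by apply/eqP; nia.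
  move: hr; rewrite mem_filter => /andP[_]; move: ha.
  rewrite mem_expos_pred mem_expos mdegD mdegMn => /eqP ha /eqP ->.
  by rewrite -ha /dg; apply/eqP; nia.
move=> /eqP; rewrite [in mdeg m](qrmon m) mdegD mdegMn => hm.
have hr := mdeg_reduced (reduced_rmon m).
have [e|e] : mdeg (qmon m) = d /\ mdeg (rmon m) = n.-1 \/
    (mdeg (qmon m)).+1 = d /\ mdeg (rmon m) = dg n 1.
  move: hm hr; rewrite /dg; move: (mdeg (qmon m)) (mdeg (rmon m)) => q r hm hr.
  have [h|h|h] := ltngtP q d; last by subst; left; nia.
    have h2 : q.+1 = d by apply/eqP; move: h hm; nia.
    by right; split=> //; rewrite -h2 in hm; nia.
  by exfalso; nia.
- left; apply/allpairsP; exists (qmon m, rmon m); rewrite !mem_expos.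
  by case: e => -> ->; rewrite -qrmon.
right; apply/allpairsP; exists (qmon m, rmon m) => /=.
rewrite mem_filter reduced_rmon mem_expos_pred mem_expos addn1.
by case: e => -> ->; rewrite -qrmon !eqxx.
Qed.

Lemma monos_of_uniq d : uniq (monos_of d).
Proof.
have red r : r \in expos n.-1 -> reduced r.
  by rewrite mem_expos => /eqP h; apply: reduced_small; lia.
rewrite cat_uniq; apply/and3P; split.
- apply: allpairs_uniq; rewrite ?expos_uniq // => -[a r] [a' r'] /=.
  move=> /allpairsP[[b s] /= [_ hs [-> ->]]] /allpairsP[[b' s'] /= [_ hs' [-> ->]]].
  by case/(reduced_eq (red _ hs) (red _ hs')) => -> ->.
- apply/hasPn => m /allpairsP[[a r] /= [_ hr ->]].
  apply/allpairsP => -[[a' r'] /= [_ hr' e]].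
  move: hr; rewrite mem_filter => /andP[rr]; have [_ ->] := reduced_eq rr (red _ hr') e.
  by move: hr'; rewrite !mem_expos /dg => /eqP ->; nia.
apply: allpairs_uniq; rewrite ?expos_pred_uniq ?filter_uniq ?expos_uniq //.
move=> [a r] [a' r'] /=.
move=> /allpairsP[[b s] /= [_ hs [-> ->]]] /allpairsP[[b' s'] /= [_ hs' [-> ->]]].
move: hs hs'; rewrite !mem_filter => /andP[hs _] /andP[hs' _].
by case/(reduced_eq hs hs') => -> ->.
Qed.

Lemma monsE A l : mons A l = [seq 'X_[m] | m <- expos l].
Proof. by rewrite /mons /expos -map_comp. Qed.

Lemma Ns_xpn A d : perm_eq (NN n (xpn A) (QQ A) d) (mons A (dg n d)).
Proof.
apply: perm_trans (Ns_canonical _ _ _ _) _.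
have E L M : allp (xpn A) L [seq 'X_[m] | m <- M] =
    [seq 'X_[m] | m <- [seq (a *+ n + r)%MM | a <- L, r <- M]].
  rewrite /allp; elim: L => //= a L IH; rewrite IH map_cat; congr (_ ++ _).
  by rewrite -!map_comp; apply: eq_map => r /=; rewrite fpow_xpn mpolyXD.
rewrite !monsE /QQ !E -map_cat; apply: perm_map.
by apply: uniq_perm; [exact: monos_of_uniq|exact: expos_uniq|exact: mem_monos_of].
Qed.

(** Counted by difference: at level 1 the family is made of all monomials of degree [2 * n - 1], and
    the sizes of its other blocks are known. *)
Lemma size_QQ A : size (QQ A) = 'C(n, 2).
Proof.
have := perm_size (Ns_xpn A 1); rewrite /NN /= /Zs !size_cat !size_mulseq.
rewrite !size_cat size_mulseq !size_mons !card_mono /dg.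
have -> : (2 * n).-1.+2 = (2 * n).+1 by lia.
rewrite prednK //; have := bin2_double n; have := bin2_double n.+1.
by have := bin2_double (2 * n).+1; rewrite /=; nia.
Qed.

Lemma size_NN (A : comNzRingType) (f : 'I_3 -> {mpoly A[3]}) Q d : size Q = 'C(n, 2) ->
  size (NN n f Q d) = #|mono (dg n d)|.
Proof. by move=> h; apply: size_Ns. Qed.

Lemma volN_xpn A d : volN n (xpn A) (QQ A) d ^+ 2 = 1.
Proof.
rewrite /volN (vol_perm (Ns_xpn A d)) ?vol_mons ?expr1n //.
by rewrite size_NN // size_QQ.
Qed.

Lemma volN_perm (A : comNzRingType) f (s : 'S_3) (Q : seq {mpoly A[3]}) d : size Q = 'C(n, 2) ->
  volN n (fun i => f (s i)) Q d ^+ 2 = volN n f Q d ^+ 2.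
Proof. by move=> hQ; apply: vol_perm (Ns_perm _ _ _ _ _) _; rewrite size_NN. Qed.

Section Rotation.
Variables (A : comNzRingType) (s : 'S_3).
Local Notation P := {mpoly A[3]}.
Local Notation phi := (@msym 3 A s).

Lemma msymX3 m : phi 'X_[m] = 'X_[mperm3 s^-1 m].
Proof. by rewrite msymX; congr 'X_[_]; apply/mnmP => i; rewrite !mnmE. Qed.

Lemma map_msym_mons l : perm_eq (map phi (mons A l)) (mons A l).
Proof.
rewrite !monsE -map_comp (eq_map (g := (fun m => 'X_[m]) \o mperm3 s^-1)).
  by rewrite map_comp; apply/perm_map/perm_expos.
exact: msymX3.
Qed.

Lemma map_msym_QQ : perm_eq (map phi (QQ A)) (QQ A).
Proof.
rewrite /QQ -map_comp (eq_map (g := (fun m => 'X_[m]) \o mperm3 s^-1)); last exact: msymX3.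
rewrite map_comp; apply: perm_map.
have E : [seq m <- expos (dg n 1) | reduced m] =
         [seq m <- expos (dg n 1) | reduced (mperm3 s^-1 m)].
  apply: eq_filter => m; apply/forallP/forallP => h i; first by rewrite mnmE.
  by have := h (s i); rewrite mnmE permK.
by rewrite [X in perm_eq (map _ X)]E -filter_map; apply: perm_filter; apply: perm_expos.
Qed.

Lemma map_msym_NN f Q d :
  perm_eq (map phi (NN n f Q d)) (NN n (fun i => phi (f i)) (map phi Q) d).
Proof.
have E L t : map phi (allp f L t) = allp (fun i => phi (f i)) L (map phi t).
  rewrite /allp; elim: L => //= a L IH; rewrite map_cat IH; congr (_ ++ _).
  rewrite -!map_comp; apply: eq_map => p /=; rewrite rmorphM; congr (_ * _).
  by rewrite /fpow rmorph_prod; apply: eq_bigr => i _; rewrite rmorphXn.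
apply: perm_trans (perm_map phi (Ns_canonical n f Q d)) _; rewrite perm_sym.
apply: perm_trans (Ns_canonical n _ _ d) _; rewrite perm_sym map_cat !E.
by apply: perm_cat => //; apply: perm_allpairs => //; apply: map_msym_mons.
Qed.

(** [msym] permutes the monomial basis, so as a linear map it has determinant 1 or -1. *)
Lemma vol_msym l t : size t = #|mono l| -> homogs l t ->
  vol l (map phi t) ^+ 2 = vol l t ^+ 2.
Proof.
move=> et ht.
(* A linear map preserves coordinates when the basis is replaced by its image; the image of the
   monomials is then only a reordering of them. *)
have T (psi : {linear P -> P}) : trans (@zeroP A) (map psi t) (map psi (mons A l)) (vol l t).
  exists (fun i j => ccoord l (mons A l) t`_i j).
    rewrite 2!size_map et size_mons; split=> // j hj; rewrite (nth_map 0) ?et //.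
    have := comb_ccoord (size_mons A l) (@homogs_mons A l) (ht j).
    rewrite vol_mons scale1r => {1}<-.
    have e2 : size (map psi (mons A l)) = size (mons A l) by exact: size_map.
    rewrite /comb e2 raddf_sum -sumrB big1 // => i _.
    by rewrite (nth_map 0) //; apply/eqP; rewrite subr_eq0; apply/eqP/linearZ.
  rewrite size_map size_mons /vol -det_tr; congr (\det _); apply/matrixP => i j.
  rewrite !mxE.
  have := comb_ccoord (size_mons A l) (@homogs_mons A l) (ht i).
  rewrite vol_mons scale1r => /(congr1 (mcoeff (expo (enum_val j)))) <-.
  rewrite mcoeff_comb (bigD1 (cast_ord (esym (size_mons A l)) j)) //= big1.
    rewrite addr0 (nth_map (enum_val j)) -?cardE // -[nth (enum_val j) _ _](enum_val_nth _ j).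
    by rewrite mcoeffX eqxx mulr1.
  move=> i'; rewrite -val_eqE /= => ne.
  have h' : (i' < #|mono l|)%N by rewrite -(size_mons A l).
  rewrite (nth_map (enum_val j)) -?cardE // -[nth (enum_val j) _ _](enum_val_nth _ (Ordinal h')).
  rewrite mcoeffX (inj_eq (f := @expo l)); last by move=> ? ? /val_inj/val_inj.
  by rewrite (inj_eq enum_val_inj) -val_eqE (negPf ne) mulr0.
have sm : size (map phi (mons A l)) = #|mono l| by rewrite size_map size_mons.
rewrite (vol_trans sm (T phi)) exprMn (vol_perm (map_msym_mons l) sm).
by rewrite vol_mons expr1n mulr1.
Qed.

Lemma volN_msym f d : (forall i, f i \is n.-homog) ->
  volN n (fun i => phi (f i)) (QQ A) d ^+ 2 = volN n f (QQ A) d ^+ 2.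
Proof.
move=> hf; rewrite /volN.
have h := perm_trans (map_msym_NN f (QQ A) d) (Ns_perm_Q n _ d map_msym_QQ).
rewrite -(vol_perm h) ?size_map ?size_NN ?size_QQ //.
apply: vol_msym; first by rewrite size_NN ?size_QQ.
by apply: homogs_Ns => //; apply: homogs_QQ.
Qed.

End Rotation.
End Monomials.

Definition rot3 : 'S_3 := perm (@ordS_inj 3).

Lemma rot3E : (rot3 o0 = o1) * (rot3 o1 = o2) * (rot3 o2 = o0).
Proof. by rewrite /rot3 !permE; do !split; apply/val_inj. Qed.

Definition tri (T : Type) (a b c : T) (i : 'I_3) : T :=
  if i == o0 then a else if i == o1 then b else c.

Lemma triE (T : Type) (a b c : T) :
  (tri a b c o0 = a) * (tri a b c o1 = b) * (tri a b c o2 = c).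
Proof. by []. Qed.

(** * The universal triple of forms and its specializations *)

Section Evaluation.
Variable n : nat.

(** By [map_ev_gen] every triple of forms of degree [n], over any commutative ring, is an image of
    this one; identities between polynomials in the coefficients are proved here once. *)
Definition gen (i : 'I_3) : {mpoly (res_poly n)[3]} :=
  \sum_(m : mono n) 'X_(enum_rank (i, m)) *: 'X_[expo m].

Definition ev (A : comNzRingType) (f : 'I_3 -> {mpoly A[3]}) : res_poly n -> A :=
  mmap intr (fun v => let im := enum_val v in (f im.1)@_(expo im.2)).

HB.instance Definition _ A f := GRing.RMorphism.copy (@ev A f)
  (mmap intr (fun v => let im := enum_val v in (f im.1)@_(expo im.2))).

Lemma res_evalE (A : comNzRingType) (f : 'I_3 -> {mpoly A[3]}) R :
  res_eval R f = ev f R.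
Proof. by []. Qed.

Lemma mcoeff_sum_mono (A : comNzRingType) (F : mono n -> A) m :
  (\sum_(m' : mono n) F m' *: 'X_[expo m'] : {mpoly A[3]})@_(expo m) = F m.
Proof.
rewrite raddf_sum /= (bigD1 m) //= big1 ?addr0 => [|m' hm].
  by rewrite mcoeffZ mcoeffX eqxx mulr1.
rewrite mcoeffZ mcoeffX (inj_eq (f := @expo n)) ?(negPf hm) ?mulr0 //.
by move=> ? ? /val_inj/val_inj.
Qed.

Lemma mcoeff_gen i m : (gen i)@_(expo m) = 'X_(enum_rank (i, m)).
Proof. exact: mcoeff_sum_mono. Qed.

Lemma homog_sum_mono (A : comNzRingType) (F : mono n -> A) :
  \sum_(m : mono n) F m *: 'X_[expo m] \is [in A[3], n.-homog].
Proof.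
by apply: rpred_sum => m _; apply: dhomogZ; rewrite dhomogX; apply: (valP m).
Qed.

Lemma gen_homog i : gen i \is n.-homog.
Proof. exact: homog_sum_mono. Qed.

Lemma evX (A : comNzRingType) (f : 'I_3 -> {mpoly A[3]}) i m :
  ev f 'X_(enum_rank (i, m)) = (f i)@_(expo m).
Proof. by rewrite /ev mmapX mmap1U enum_rankK. Qed.

Lemma map_ev_gen (A : comNzRingType) (f : 'I_3 -> {mpoly A[3]}) i :
  f i \is n.-homog -> map_mpoly (ev f) (gen i) = f i.
Proof.
move=> hf; apply: (@homog_eq _ n) => //; first exact/map_homog/gen_homog.
by move=> m; rewrite mcoeff_map_mpoly mcoeff_gen /= evX.
Qed.

Lemma ev_comp (A B : comNzRingType) (e : {rmorphism A -> B}) f R :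
  e (ev f R) = ev (fun i => map_mpoly e (f i)) R.
Proof.
rewrite /ev /mmap rmorph_sum; apply: eq_bigr => m _ /=.
rewrite rmorphM rmorph_int; congr (_ * _).
rewrite /mmap1 rmorph_prod; apply: eq_bigr => i _.
by rewrite rmorphXn /= mcoeff_map_mpoly.
Qed.

Lemma ev_gen_id R : ev gen R = R.
Proof.
rewrite {2}[R]mpolyE /ev /mmap; apply: eq_bigr => m _.
rewrite -[X in _ = X *: _]intz scaler_int mulrzl; congr (_ *~ _).
rewrite /mmap1 mpolyXE_id; apply: eq_bigr => i _; rewrite mcoeff_gen.
by rewrite -surjective_pairing enum_valK.
Qed.

Lemma eq_ev (A : comNzRingType) (f f' : 'I_3 -> {mpoly A[3]}) R :
  f =1 f' -> ev f R = ev f' R.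
Proof.
move=> h; apply: eq_bigr => m _; congr (_ * _).
by apply: eq_bigr => i _; rewrite /= h.
Qed.

Lemma ev_volN (A : comNzRingType) (f : 'I_3 -> {mpoly A[3]}) d :
  (forall i, f i \is n.-homog) ->
  ev f (volN n gen (QQ n _) d) = volN n f (QQ n _) d.
Proof.
by move=> hf; rewrite -map_volN map_QQ /volN /NN !map_ev_gen.
Qed.

End Evaluation.

Section Ratio.
Variables (k : fieldType) (n : nat).
Hypothesis n_gt0 : (0 < n)%N.
Local Notation P := {mpoly k[3]}.
Local Notation x := (xpn n k).
Local Notation Q0 := (QQ n k).

Lemma volN_swap (a b c : P) Q d : size Q = 'C(n, 2) ->
  volN n (tri a c b) Q d ^+ 2 = volN n (tri a b c) Q d ^+ 2.
Proof.
move=> hQ; rewrite -(volN_perm n_gt0 (tri a b c) (tperm o1 o2) d hQ).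
by rewrite /volN /NN !permE.
Qed.

Lemma volN_rot (a b c : P) Q d : size Q = 'C(n, 2) ->
  volN n (tri b c a) Q d ^+ 2 = volN n (tri a b c) Q d ^+ 2.
Proof.
move=> hQ; rewrite -(volN_perm n_gt0 (tri a b c) rot3 d hQ).
by rewrite /volN /NN !rot3E.
Qed.

(* Only the last form and [Q] vary: the ratio is [w ^ 'C(d + 1, 2) *
   phi ^ 'C(d + 1, 3)], where [phi] does not see the new [Q]. *)
Lemma volN_last (f0 f1 g f2 : P) Q : f0 \is n.-homog -> f1 \is n.-homog ->
    g \is n.-homog -> f2 \is n.-homog -> homogs (dg n 1) Q -> size Q = 'C(n, 2) ->
    (forall d, volN n (tri f0 f1 g) Q d != 0) ->
  exists phi, forall Q', homogs (dg n 1) Q' -> size Q' = 'C(n, 2) ->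
  exists w, forall d, volN n (tri f0 f1 f2) Q' d =
    w ^+ 'C(d.+1, 2) * phi ^+ 'C(d.+1, 3) * volN n (tri f0 f1 g) Q d.
Proof.
move=> h0 h1 hg h2 hQ sQ nz.
have [phi hphi] : exists phi,
    trans (ideal2 n f0 f1 1) (mulseq f2 (Zs n g Q 1)) (Zs n g Q 2) phi.
  apply: trans_Zs_ex => //; first by rewrite size_mulseq size_Zs.
  by rewrite dgS //; apply: homogs_mul => //; apply: homogs_Zs.
exists phi => Q' hQ' sQ'.
have [w hw] : exists w, trans (ideal2 n f0 f1 0) (Zs n f2 Q' 1) (Zs n g Q 1) w.
  by apply: trans_Zs_ex => //; [rewrite size_Zs|apply: homogs_Zs].
by exists w => d; apply: vol_Ns.
Qed.

Theorem volN_ratio (f : 'I_3 -> P) : (forall i, f i \is n.-homog) ->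
    (forall d, volN n (tri (f o0) (f o1) (x o2)) Q0 d != 0) ->
    (forall d, volN n (tri (f o0) (x o2) (x o1)) Q0 d != 0) ->
  exists phi, forall Q, homogs (dg n 1) Q -> size Q = 'C(n, 2) ->
  forall d, volN n f Q d ^+ 2 =
    (volN n f Q 1 ^+ 'C(d.+1, 2) * phi ^+ 'C(d.+1, 3)) ^+ 2.
Proof.
move=> hf nz1 nz2.
have hx := @xpn_homog n k; have hQ0 := @homogs_QQ n k; have sQ0 := size_QQ n_gt0 k.
have nz3 d : volN n (tri (x o1) (x o2) (x o0)) Q0 d != 0.
  rewrite -sqrf_eq0 volN_rot //.
  by have := volN_xpn n_gt0 k d; rewrite /volN /NN !triE => ->; apply: oner_neq0.
(* [volN_last] only replaces the form in last position, so a swap or a rotation brings each form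
   there in turn. The block changes in the first replacement only; hence [phi1], [phi2] and [phi3]
   are all chosen before [Q]. *)
have [phi1 h1] := volN_last (hf o0) (hf o1) (hx o2) (hf o2) hQ0 sQ0 nz1.
have [phi2 h2] := volN_last (hf o0) (hx o2) (hx o1) (hf o1) hQ0 sQ0 nz2.
have [phi3 h3] := volN_last (hx o1) (hx o2) (hx o0) (hf o0) hQ0 sQ0 nz3.
have {h2}[w2 h2] := h2 _ hQ0 sQ0; have {h3}[w3 h3] := h3 _ hQ0 sQ0.
exists (phi1 * phi2 * phi3) => Q hQ sQ; have {h1}[w1 h1] := h1 _ hQ sQ.
have E d : volN n f Q d ^+ 2 = ((w1 * w2 * w3) ^+ 'C(d.+1, 2) *
    (phi1 * phi2 * phi3) ^+ 'C(d.+1, 3)) ^+ 2.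
  transitivity ((w1 ^+ 'C(d.+1, 2) * phi1 ^+ 'C(d.+1, 3)) ^+ 2 *
      volN n (tri (f o0) (x o2) (f o1)) Q0 d ^+ 2).
    by rewrite volN_swap // -exprMn -h1.
  rewrite h2 [(_ * volN _ _ _ _) ^+ 2]exprMn volN_swap //.
  rewrite -(volN_rot (f o0) (x o1) (x o2) _ sQ0) h3.
  rewrite [(_ * volN _ _ _ _) ^+ 2]exprMn volN_rot //.
  have -> : volN n (tri (x o0) (x o1) (x o2)) Q0 d ^+ 2 = 1 := volN_xpn n_gt0 k d.
  by rewrite !exprMn mulr1; ring.
(* At [d = 1] the exponents are 1 and 0, which identifies the product of the [w], the only part
   depending on [Q]. *)
have e1 : volN n f Q 1 ^+ 2 = (w1 * w2 * w3) ^+ 2.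
  by rewrite E binn expr1 mulr1.
move=> d; rewrite E exprMn [RHS]exprMn; congr (_ * _).
by rewrite exprAC -e1 exprAC.
Qed.

End Ratio.

(** * Link with the matrices of the statement *)

Lemma det_remove_cols (A : comNzRingType) (I : finType) (y : I -> {mpoly A[3]})
    l L (D : {set I * mono l}) (h : #|~: D| = #|mono L|) :
  \det (castmx (erefl, h) (remove_cols (mulmap_mx y l L) D)) =
  vol L [seq y c.1 * 'X_[expo c.2] | c <- enum (~: D)].
Proof.
congr (\det _); apply/matrixP => i j; rewrite castmxE !mxE enum_rankK.
rewrite cast_ord_id /mulmap; set c := (X in bvec A X).
have -> : (\sum_i bvec A c i * y i) = y c.1 * 'X_[expo c.2].
  rewrite (bigD1 c.1) //= ffunE eqxx big1 ?addr0 1?mulrC // => i' /negPf hi.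
  by rewrite ffunE hi mul0r.
by rewrite (nth_map c) -?cardE ?h // {1 2}/c (enum_val_nth c).
Qed.

Section Link.
Variables (n d : nat) (J : {fset nat * nat}).
Hypothesis n_gt0 : (0 < n)%N.
Hypothesis J_le : forall p, p \in J -> (p.1 + p.2 <= n.-1)%N.
Hypothesis J_card : #|` J| = n.

Definition inJ (m : 'X_{1..3}) := (m ord0, m (inord 1)) \in J.

Definition QJ : seq {mpoly (KK n)[3]} :=
  [seq xx n ord_max * 'X_[m] | m <- expos n.-1 & ~~ inJ m].

Lemma size_QJ : size QJ = 'C(n, 2).
Proof.
have hJ := card_mono_in J_le; rewrite J_card in hJ.
rewrite size_map size_filter.
have c1 : count inJ (expos n.-1) = n.
  rewrite /expos count_map enumT -[RHS]hJ cardsE cardE /enum_mem size_filter.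
  exact: eq_count.
have := count_predC inJ (expos n.-1).
have -> : size (expos n.-1) = 'C(n.+1, 2).
  by rewrite size_map -cardE card_mono prednK.
rewrite c1; have := bin2_double n.+1; have := bin2_double n; rewrite /=.
have -> : count (predC inJ) (expos n.-1) = count (fun m => ~~ inJ m) (expos n.-1) by [].
move: (count _ _) => c; nia.
Qed.

Lemma homogs_QJ : homogs (dg n 1) QJ.
Proof.
apply: homogs_all => p /mapP[m]; rewrite mem_filter mem_expos => /andP[_ hm] ->.
by rewrite dgS // dg0 dhomogM ?xx_homog // dhomogX.
Qed.

Definition idxs : seq ('X_{1..4} * 'X_{1..3}) :=
  [seq (ext4 0 a, m) | a <- expos d, m <- expos n.-1] ++
  [seq (ext4 1 a, m) | a <- expos_pred d, m <- [seq m <- expos n.-1 | ~~ inJ m]].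

Lemma ext4_max e a : ext4 e a ord_max = e.
Proof. by rewrite mnmE unlift_none. Qed.

Lemma ext4_inj e e' a a' : ext4 e a = ext4 e' a' -> e = e' /\ a = a'.
Proof.
move=> /mnmP h; split; first by have := h ord_max; rewrite !ext4_max.
by apply/mnmP => i; have := h (lift ord_max i); rewrite !mnmE liftK.
Qed.

Lemma ext4P (b : 'X_{1..4}) : exists a, b = ext4 (b ord_max) a.
Proof.
exists [multinom b (lift ord_max i) | i < 3]; apply/mnmP => i; rewrite mnmE.
by case: unliftP => [j ->|->] //; rewrite mnmE.
Qed.

Lemma idxs_uniq : uniq idxs.
Proof.
rewrite cat_uniq; apply/and3P; split.
- apply: allpairs_uniq; rewrite ?expos_uniq // => -[a m] [a' m'] /= _ _ /eqP.
  by rewrite xpair_eqE => /andP[/eqP/ext4_inj[_ ->] /eqP ->].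
- apply/hasPn => p /allpairsP[[a m] /= [_ _ ->]].
  apply/allpairsP => -[[a' m'] /= [_ _ /eqP]].
  by rewrite xpair_eqE => /andP[/eqP/ext4_inj[]].
apply: allpairs_uniq; rewrite ?expos_pred_uniq ?filter_uniq ?expos_uniq //.
move=> [a m] [a' m'] /= _ _ /eqP.
by rewrite xpair_eqE => /andP[/eqP/ext4_inj[_ ->] /eqP ->].
Qed.

Lemma mem_idxs b m : ((b, m) \in idxs) =
  [&& mdeg m == n.-1, mdeg b == d, (b ord_max <= 1)%N &
      ~~ ((b ord_max == 1%N) && inJ m)].
Proof.
rewrite mem_cat; apply/orP/and4P.
  case=> /allpairsP[[a m'] /= [ha hm /eqP]]; rewrite xpair_eqE;
      move=> /andP[/eqP -> /eqP ->]; move: ha hm; rewrite ?mem_filter.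
    by rewrite !mem_expos ext4_max mdeg_ext4 addn0 => -> ->.
  by rewrite mem_expos mem_expos_pred ext4_max mdeg_ext4 => -> /andP[-> ->].
case=> hm hb; have [a e] := ext4P b; rewrite e ext4_max in hb *.
case: (b ord_max) hb => [|[|//]]; rewrite mdeg_ext4 => hb _ hJ; [left|right].
  by apply/allpairsP; exists (a, m); rewrite !mem_expos -[mdeg a]addn0 hb hm.
by apply/allpairsP; exists (a, m); rewrite mem_filter mem_expos mem_expos_pred hb hm hJ.
Qed.

Lemma prod_ext4 e a :
  \prod_i xx n i ^+ ext4 e a i = fpow (@x123 n) a * xx n ord_max ^+ e.
Proof.
rewrite big_ord_recr /= ext4_max; congr (_ * _); apply: eq_bigr => i _.
rewrite mnmE; congr (_ ^+ _).
have -> : widen_ord (leqnSn 3) i = lift ord_max i.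
  by apply/val_inj; rewrite /= /bump leqNgt ltn_ord.
by rewrite liftK.
Qed.

Variables (I : finType) (key : I -> 'X_{1..4}).
Hypothesis key_inj : injective key.
Hypothesis key_mdeg : forall i, mdeg (key i) = d.
Hypothesis key_max : forall i, (key i ord_max <= 1)%N.
Hypothesis key_onto : forall b, mdeg b = d -> (b ord_max <= 1)%N ->
  exists i, b = key i.

(** Any index type whose keys run over the exponents with last coordinate at most 1 will do:
    [Gamma0 d] for [MS], and ['I_4] with unit vectors for [MP], which thus becomes the case
    [d = 1]. *)
Lemma vol_MSI (y : I -> {mpoly (KK n)[3]}) (P : pred I) L :
    (forall i, y i = \prod_j xx n j ^+ key i j) ->
    (forall i, P i = (key i ord_max == 1%N)) -> L = dg n d ->
  vol L [seq y c.1 * 'X_[expo c.2] | c <- enum (~: @cols_in I n.-1 P J)] ^+ 2 =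
  volN n (@x123 n) QJ d ^+ 2.
Proof.
move=> yE PE ->; apply: esym; apply: vol_perm; last first.
  by rewrite size_NN // size_QJ.
apply: perm_trans (Ns_canonical _ _ _ _) _.
pose G (c : 'X_{1..4} * 'X_{1..3}) : {mpoly (KK n)[3]} :=
  (\prod_j xx n j ^+ c.1 j) * 'X_[c.2].
pose h (c : I * mono n.-1) := (key c.1, expo c.2).
have -> : [seq y c.1 * 'X_[expo c.2] | c <- enum (~: @cols_in I n.-1 P J)] =
    [seq G c | c <- [seq h c | c <- enum (~: @cols_in I n.-1 P J)]].
  by rewrite -map_comp; apply: eq_map => c; rewrite /G /= yE.
have -> : allp (@x123 n) (expos d) (mons (KK n) n.-1) ++
    allp (@x123 n) (expos_pred d) QJ = [seq G c | c <- idxs].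
  rewrite map_cat /allp; congr (_ ++ _).
    elim: (expos d) => //= a s ->; rewrite map_cat; congr (_ ++ _).
    rewrite monsE -[LHS]map_comp -[RHS]map_comp; apply: eq_map => m.
    by rewrite /G /= prod_ext4 expr0 mulr1.
  elim: (expos_pred d) => //= a s ->; rewrite map_cat; congr (_ ++ _).
  rewrite -!map_comp; apply: eq_map => m.
  by rewrite /G /= prod_ext4 expr1 mulrA.
apply: perm_map; apply: uniq_perm; first exact: idxs_uniq.
  rewrite map_inj_uniq ?enum_uniq // => -[i m] [i' m'] [/key_inj -> e].
  by congr (_, _); apply/val_inj/val_inj.
move=> [b m]; rewrite mem_idxs; apply/and4P/mapP.
  case=> hm /eqP hb b1 hJ; have [i e] := key_onto hb b1.
  have lm : (mdeg m < n.-1.+1)%N by rewrite (eqP hm).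
  exists (i, Sub (BMultinom lm) hm : mono n.-1); last by rewrite /h /= -e.
  by rewrite mem_enum !inE /= PE -e.
case=> [[i m']]; rewrite mem_enum !inE /= PE => hJ [-> ->].
by rewrite key_mdeg key_max eqxx; split=> //; apply: (valP m').
Qed.

End Link.

Section MatrixLink.
Variables (n d : nat) (J : {fset nat * nat}) (n_gt0 : (0 < n)%N)
  (J_le : forall p, p \in J -> (p.1 + p.2 <= n.-1)%N) (J_card : #|` J| = n).

Lemma det_MSI :
  \det (MSI d n_gt0 J_le J_card) ^+ 2 = volN n (@x123 n) (QJ n J) d ^+ 2.
Proof.
rewrite /MSI det_remove_cols; apply: (@vol_MSI n d J n_gt0 J_le J_card _ (@gexp d)) => //.
- by move=> i j /val_inj/val_inj.
- exact: mdeg_gexp.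
- by move=> i; have /andP[_] := valP i.
move=> b hb b1; have lb : (mdeg b < d.+1)%N by rewrite hb.
have hb' : (mdeg (BMultinom lb) == d) && ((BMultinom lb) ord_max <= 1)%N.
  by rewrite /= hb eqxx.
by exists (Sub (BMultinom lb) hb' : Gamma0 d).
Qed.

Lemma det_MPI :
  \det (MPI n_gt0 J_le J_card) ^+ 2 = volN n (@x123 n) (QJ n J) 1 ^+ 2.
Proof.
rewrite /MPI det_remove_cols.
apply: (@vol_MSI n 1 J n_gt0 J_le J_card _ (fun i : 'I_4 => U_(i)%MM)) => //.
- by move=> i j /mnmP/(_ j); rewrite !mnm1E eqxx; case: eqP.
- by move=> i; rewrite mdeg1.
- by move=> i; rewrite mnm1E; case: (_ == _).
- move=> b /eqP; rewrite mdeg_eq1 => /existsP[i /eqP ->] _; by exists i.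
- move=> i; rewrite (bigD1 i) //= mnm1E eqxx expr1 big1 ?mulr1 // => j hj.
  by rewrite mnm1E eq_sym (negPf hj) expr0.
by move=> i; rewrite /= mnm1E; case: (_ == _).
Qed.

End MatrixLink.

Section GenericPoint.
Variable n : nat.
Hypothesis n_gt0 : (0 < n)%N.
Local Notation B := {mpoly rat[#|{: 'I_4 * mono n}|]}.
Local Notation fr := (@FracField.tofrac B).

Definition xB (i : 'I_4) : {mpoly B[3]} :=
  \sum_(m : mono n) 'X_(enum_rank (i, m)) *: 'X_[expo m].

Lemma map_xB i : map_mpoly fr (xB i) = xx n i.
Proof.
rewrite /xB /xx rmorph_sum; apply: eq_bigr => m _ /=.
by rewrite map_mpolyZ map_mpolyX.
Qed.

(** Specializing each generic form to the corresponding power of a variable gives a determinant of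
    square 1. The map [t] says which positions are still generic, and [s] which variable each
    position ends on. *)
Lemma volN_generic_neq0 (t : 'I_3 -> 'I_3 + 'I_3) d (s : 'S_3) :
  (forall i, t i = inl (s i) \/ t i = inr (s i)) ->
  volN n (fun i => match t i with inl j => @x123 n j | inr j => xpn n (KK n) j end)
    (QQ n (KK n)) d != 0.
Proof.
move=> ht.
pose f i : {mpoly B[3]} := match t i with
  inl j => xB (widen_ord (leqnSn 3) j) | inr j => xpn n B j end.
set F := (F in volN n F); have hE i : F i = map_mpoly fr (f i).
  by rewrite /F /f; case: (t i) => j; rewrite ?map_xB ?map_xpn.
have -> : volN n F (QQ n (KK n)) d = fr (volN n f (QQ n B) d).
  by rewrite -map_volN map_QQ /volN /NN !hE.
clearbody F; clear F hE.
rewrite tofrac_eq0.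
(* [insub] recognizes the first three forms; the coefficients of the fourth one are sent to 0. *)
pose v (u : 'I_#|{: 'I_4 * mono n}|) : rat := let im := enum_val u in
  if insub (val im.1) is Some j then (xpn n rat j)@_(expo im.2) else 0.
suff h : meval v (volN n f (QQ n B) d) ^+ 2 = 1.
  by apply/eqP => e; move: h; rewrite e rmorph0 expr0n => /esym/eqP; rewrite oner_eq0.
have fE i : map_mpoly (meval v) (f i) = xpn n rat (s i).
  rewrite /f; case: (ht i) => ->; last exact: map_xpn.
  rewrite /xB rmorph_sum /=.
  rewrite (eq_bigr (fun m : mono n => (xpn n rat (s i))@_(expo m) *: 'X_[expo m])).
    apply: (@homog_eq _ n); [exact: homog_sum_mono|exact: xpn_homog|].
    by move=> m; rewrite mcoeff_sum_mono.
  move=> m _; rewrite map_mpolyZ map_mpolyX; congr (_ *: _).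
  rewrite /= mevalXU /v enum_rankK.
  suff -> : insub (val (widen_ord (leqnSn 3) (s i))) = Some (s i) by [].
  exact: valK.
rewrite -map_volN map_QQ.
have -> : volN n (fun i => map_mpoly (meval v) (f i)) (QQ n rat) d =
    volN n (fun i => xpn n rat (s i)) (QQ n rat) d.
  by rewrite /volN /NN !fE.
by rewrite volN_perm ?volN_xpn ?size_QQ.
Qed.

Lemma x123_homog i : @x123 n i \is n.-homog.
Proof. exact: xx_homog. Qed.

Theorem volN_x123 : exists phi, forall Q, homogs (dg n 1) Q ->
    size Q = 'C(n, 2) -> forall d, volN n (@x123 n) Q d ^+ 2 =
  (volN n (@x123 n) Q 1 ^+ 'C(d.+1, 2) * phi ^+ 'C(d.+1, 3)) ^+ 2.
Proof.
apply: volN_ratio => // [i|d|d]; first exact: x123_homog.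
  apply: (@volN_generic_neq0 (tri (inl o0) (inl o1) (inr o2)) d 1%g).
  by apply: ord3P; rewrite perm1; [left|left|right].
apply: (@volN_generic_neq0 (tri (inl o0) (inr o2) (inr o1)) d (tperm o1 o2)).
by apply: ord3P; rewrite permE; [left|right|right].
Qed.

End GenericPoint.

(** * Eigenvalues and common zeros *)

(** Over a closed field the first matrix has an eigenvector inside the stable space [V], and its
    eigenspace is stable under the others by commutation; so [V] can be cut down one matrix at a
    time. *)
Lemma common_eigen (k : closedFieldType) m (As : seq 'M[k]_m) :
    (forall A B, A \in As -> B \in As -> A *m B = B *m A) ->
    forall V : 'M[k]_m, V != 0 -> (forall A, A \in As -> stablemx V A) ->
  exists2 v : 'rV[k]_m, v != 0 & (v <= V)%MS /\
    forall A, A \in As -> exists mu, v *m A = mu *: v.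
Proof.
elim: As => [_|A As IH cAs] V nzV stV.
  by have /rowV0Pn[v vV nzv] := nzV; exists v.
have stA : stablemx V A by apply: stV; rewrite inE eqxx.
have [v [a [nzv vV vA]]] : exists v : 'rV_m, exists a,
    [/\ v != 0, (v <= V)%MS & v *m A = a *: v].
  pose W := row_base V; have rk : (0 < \rank V)%N by rewrite lt0n mxrank_eq0.
  have : (W *m A <= W)%MS by rewrite stablemx_row_base.
  case/submxP => M hM.
  have /closed_rootP[a] : size (char_poly M) != 1%N.
    by rewrite size_char_poly eqSS -lt0n.
  rewrite -eigenvalue_root_char => /eigenvalueP[w hw nzw].
  exists (w *m W), a; split.
  - by rewrite mulmx_free_eq0 ?row_base_free.
  - by rewrite mulmx_sub // eq_row_base.
  by rewrite -mulmxA hM mulmxA hw scalemxAl.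
have [] := IH _ (V :&: eigenspace A a)%MS.
- by move=> B C hB hC; apply: cAs; rewrite inE ?hB ?hC orbT.
- apply: contraNneq nzv => e; rewrite -submx0 -e sub_capmx vV /=.
  exact/eigenspaceP.
- move=> B hB; rewrite sub_capmx; apply/andP; split.
    apply: submx_trans (submxMr B (capmxSl _ _)) _.
    by apply: stV; rewrite inE hB orbT.
  apply: submx_trans (submxMr B (capmxSr _ _)) _.
  by apply: comm_mx_stable_eigenspace; apply: cAs; rewrite inE ?eqxx ?hB ?orbT.
move=> u nzu [uV hu]; exists u => //; move: uV; rewrite sub_capmx.
case/andP=> uV /eigenspaceP uA; split=> // B; rewrite inE => /predU1P[->|/hu//].
by exists a.
Qed.

Section EigenTheory.
Variables (k : fieldType) (n : nat).
Hypothesis n_gt0 : (0 < n)%N.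
Local Notation P := {mpoly k[3]}.
Local Notation x := (xpn n k).
Local Notation Q0 := (QQ n k).
Variables (f0 f1 : P).
Hypotheses (f0h : f0 \is n.-homog) (f1h : f1 \is n.-homog).
Hypothesis nz : forall d, volN n (tri f0 f1 (x o2)) Q0 d != 0.
Local Notation Z := (Zs n (x o2) Q0).
Local Notation ideal := (ideal2 n f0 f1).

(* [M] is the matrix of the multiplication by the form [H] of degree [r * n]
   modulo [f0] and [f1]; it does not depend on the degree of the source. *)
Definition ismuls r (H : P) (M : 'M[k]_(n * n)) : Prop :=
  H \is (r * n).-homog /\ forall d (j : 'I_(n * n)),
    ideal (d + r) (H * (Z d.+1)`_j - \sum_i M j i *: (Z (d + r).+1)`_i).

Lemma size_Z d : size (Z d.+1) = (n * n)%N.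
Proof. by rewrite size_Zs ?size_QQ. Qed.

Lemma x2_homog : x o2 \is n.-homog. Proof. exact: xpn_homog. Qed.

Lemma ideal_mul r H d p : H \is (r * n).-homog -> ideal d p ->
  ideal (d + r) (H * p).
Proof.
move=> hH [q0 [q1 [h0 h1 ->]]].
have e : dg n (d + r) = (r * n + dg n d)%N by rewrite /dg; nia.
exists (H * q0), (H * q1); rewrite e; split; try exact: dhomogM.
by ring.
Qed.

Lemma Z_shift r d j : (x o2) ^+ r * (Z d.+1)`_j = (Z (d + r).+1)`_j.
Proof.
rewrite /Zs !nth_mulseq mulrA -exprD; congr (_ ^+ _ * _); exact: addnC.
Qed.

(** Expanding the cofactors turns a relation modulo [f0] and [f1] into a relation between the
    members of the basis [NN], where the coefficients of the [Z] can be read off. *)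
Lemma Z_free d (y : nat -> k) : ideal d (comb (Z d.+1) y) ->
  forall j, (j < n * n)%N -> y j = 0.
Proof.
have hQ := @homogs_QQ n k; have sQ := size_QQ n_gt0 k.
case=> q0 [q1 [h0 h1 e]] j hj.
have [z0 /eqP] := spanned_Ns n_gt0 f0h f1h x2_homog hQ sQ nz h0.
rewrite subr_eq0 => /eqP e0.
have [z1 [q hq /eqP]] := spanned_Ys n_gt0 f0h f1h x2_homog hQ sQ nz h1.
rewrite subr_eq => /eqP e1.
have [z2 /eqP] := spanned_Ns n_gt0 f0h f1h x2_homog hQ sQ nz hq.
rewrite subr_eq0 => /eqP e2.
pose N := NN n (tri f0 f1 (x o2)) Q0 d.+1.
pose a := mulseq f0 (Ns n f0 f1 (x o2) Q0 d) ++ mulseq f1 (Ys n f1 (x o2) Q0 d).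
have eN : N = a ++ Z d.+1 by rewrite /N /NN /= !triE catA.
have sN : size N = #|mono (dg n d.+1)| by rewrite size_NN.
pose sa := size (mulseq f0 (Ns n f0 f1 (x o2) Q0 d)).
(* Coefficients of that relation: [z0] from the cofactor of [f0] and [z2] from the multiple of [f0]
   left by [spanned_Ys], then [z1] on the block of [f1], then [- y]. *)
pose t1 i := if (i < size a)%N then
  (if (i < sa)%N then z0 i + z2 i else z1 (i - sa)%N) else - y (i - size a)%N.
have t0 : comb N t1 = comb N (fun=> 0).
  rewrite comb0 eN comb_cat comb_cat.
  rewrite [comb (mulseq f0 _) _]comb_mul [comb (mulseq f1 _) _]comb_mul.
  rewrite (eq_comb (y := fun i => 1 * z0 i + z2 i)); last first.
    move=> i hi; rewrite /t1 size_cat -/sa.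
    by rewrite /sa !size_mulseq ltn_addr // hi mul1r.
  rewrite comb_lin scale1r.
  rewrite [comb (Ys _ _ _ _ _) _](eq_comb (y := z1)); last first.
    move=> i hi; rewrite /t1 size_cat -/sa ltn_add2l size_mulseq hi.
    by rewrite ltnNge leq_addr addKn.
  rewrite [comb (Zs _ _ _ _) _](eq_comb (y := fun i => -1 * y i + 0)); last first.
    by move=> i hi; rewrite /t1 ltnNge leq_addr addKn addr0 mulN1r.
  rewrite comb_lin comb0 addr0 scaleN1r e e1 comb_mul {1}e0 {1}e2.
  by ring.
have hN : (size a + j < size N)%N.
  by rewrite eN size_cat ltn_add2l size_Z.
have := ccoord_comb t1 sN hN; rewrite t0 ccoord_comb //.
rewrite /t1 ltnNge leq_addr addKn mulr0 => /esym/eqP.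
by rewrite mulf_eq0 (negPf (nz _)) oppr_eq0 => /eqP.
Qed.

Lemma comb_ord d (y : 'I_(n * n) -> k) :
  exists2 y', comb (Z d.+1) y' = \sum_i y i *: (Z d.+1)`_i
   & forall i : 'I_(n * n), y' i = y i.
Proof.
exists (fun j => if insub j is Some i then y i else 0); last by move=> i; rewrite valK.
by rewrite /comb size_Z; apply: eq_bigr => i _; rewrite valK.
Qed.

Lemma ismuls_uniq r H M M' : ismuls r H M -> ismuls r H M' -> M = M'.
Proof.
move=> [_ h] [_ h']; apply/matrixP => j i.
have := submodB (submodule_ideal2 _ _ _ _) (h 0%N j) (h' 0%N j).
rewrite opprB addrC addrA subrK -sumrB.
rewrite (eq_bigr (fun i => (M' j i - M j i) *: (Z (0 + r).+1)`_i)); last first.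
  by move=> i' _; rewrite scalerBl.
have [y' <- hy'] := comb_ord (0 + r)%N (fun i => M' j i - M j i).
move/Z_free => /(_ i (ltn_ord i)); rewrite hy' => /eqP.
by rewrite subr_eq0 => /eqP.
Qed.

(** The levels of [Z] are identified through multiplication by ['X_2 ^ n], which amounts to setting
    the last variable to 1. *)
Lemma ismuls1 r : ismuls r (x o2 ^+ r) 1%:M.
Proof.
split; first by rewrite mulnC dhomogMn ?x2_homog.
move=> d j; rewrite Z_shift (bigD1 j) //= mxE eqxx scale1r big1.
  by rewrite addr0 subrr; apply: (submod0 (submodule_ideal2 _ _ _ _)).
by move=> i /negPf h; rewrite mxE eq_sym h scale0r.
Qed.

Lemma ismuls_comp r H M r' H' M' : ismuls r H M -> ismuls r' H' M' ->
  ismuls (r + r') (H' * H) (M *m M').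
Proof.
move=> [hH h] [hH' h']; split; first by rewrite mulnDl addnC dhomogM.
move=> d j; have := ideal_mul hH' (h d j); rewrite mulrBr mulrA.
set p := H' * H * _; rewrite addnA => h1.
have h2 : ideal (d + r + r') (\sum_i M j i *: (H' * (Z (d + r).+1)`_i -
    \sum_l M' i l *: (Z (d + r + r').+1)`_l)).
  by apply: submod_sum => [|i _]; [exact: submodule_ideal2|];
     apply: submodZ; [exact: submodule_ideal2|exact: h'].
have := submodD (submodule_ideal2 _ _ _ _) h1 h2; congr ideal.
rewrite -addrA; congr (_ + _).
rewrite mulr_sumr -sumrN -big_split /= -sumrN.
rewrite (eq_bigr (fun i => - \sum_l (M j i * M' i l) *: (Z (d + r + r').+1)`_l)).
  rewrite !sumrN exchange_big; congr (- _); apply: eq_bigr => l _.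
  by rewrite mxE scaler_suml.
move=> i _; rewrite scalerBr scalerAr addrA addNr add0r; congr (- _).
by rewrite scaler_sumr; apply: eq_bigr => l _; rewrite scalerA.
Qed.

Lemma ismulsP h (M : 'M[k]_(n * n)) : h \is n.-homog ->
    (forall j : 'I_(n * n), ideal 1 (h * (Z 1)`_j - \sum_i M j i *: (Z 2)`_i)) ->
  ismuls 1 h M.
Proof.
move=> hh H; split; first by rewrite mul1n.
move=> d j; have hx : x o2 ^+ d \is (d * n).-homog.
  by rewrite mulnC dhomogMn ?x2_homog.
have := ideal_mul hx (H j); rewrite mulrBr mulrCA Z_shift add0n addnC.
rewrite mulr_sumr (eq_bigr (fun i => M j i *: (Z (d + 1).+1)`_i)) // => i _.
by rewrite -scalerAr Z_shift addnC.
Qed.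

Lemma ismul_ex h : h \is n.-homog -> exists M, ismuls 1 h M.
Proof.
move=> hh; have hQ := @homogs_QQ n k; have sQ := size_QQ n_gt0 k.
have [_ [X [_ hX] _]] : exists y, trans (ideal 1) (mulseq h (Z 1)) (Z 2) y.
  apply: trans_Zs_ex => //; first exact: x2_homog.
    by rewrite size_mulseq size_Z.
  by rewrite dgS //; apply: homogs_mul => //; apply: homogs_Zs; rewrite ?x2_homog.
exists (\matrix_(j, i) X j i); apply: ismulsP => // j.
have := hX j; rewrite size_Z ltn_ord => /(_ isT); rewrite nth_mulseq.
by rewrite /comb size_Z; congr (ideal _ (_ - _)); apply: eq_bigr => i _; rewrite mxE.
Qed.

Lemma ismul_f0 : ismuls 1 f0 0.
Proof.
apply: ismulsP => // j; rewrite big1 ?subr0; last by move=> i _; rewrite mxE scale0r.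
exists (Z 1)`_j, 0; rewrite mulr0 addr0 dhomog0; split=> //.
by apply: homogs_Zs; rewrite ?x2_homog //; apply: homogs_QQ.
Qed.

Lemma ismul_f1 : ismuls 1 f1 0.
Proof.
apply: ismulsP => // j; rewrite big1 ?subr0; last by move=> i _; rewrite mxE scale0r.
exists 0, (Z 1)`_j; rewrite mulr0 add0r dhomog0; split=> //.
by apply: homogs_Zs; rewrite ?x2_homog //; apply: homogs_QQ.
Qed.

Lemma ismul_sum (I : finType) (a : I -> k) (h : I -> P) (M : I -> 'M[k]_(n * n)) :
  (forall i, ismuls 1 (h i) (M i)) ->
  ismuls 1 (\sum_i a i *: h i) (\sum_i a i *: M i).
Proof.
move=> hM; split; first by apply: rpred_sum => i _; apply: dhomogZ; case: (hM i).
move=> d j.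
have : ideal (d + 1) (\sum_i a i *: (h i * (Z d.+1)`_j -
    \sum_l M i j l *: (Z (d + 1).+1)`_l)).
  by apply: submod_sum => [|i _]; [exact: submodule_ideal2|];
     apply: submodZ; [exact: submodule_ideal2|case: (hM i)].
congr (ideal _ _); rewrite (eq_bigr _ (fun i _ => scalerBr _ _ _)) sumrB.
congr (_ - _).
  by rewrite mulr_suml; apply: eq_bigr => i _; rewrite scalerAl.
rewrite (eq_bigr (fun i => \sum_l (a i * M i j l) *: (Z (d + 1).+1)`_l)); last first.
  by move=> i _; rewrite scaler_sumr; apply: eq_bigr => l _; rewrite scalerA.
rewrite exchange_big; apply: eq_bigr => l _; rewrite summxE scaler_suml.
by apply: eq_bigr => i _; rewrite !mxE.
Qed.

Lemma ismul_comm h M h' M' : ismuls 1 h M -> ismuls 1 h' M' ->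
  M *m M' = M' *m M.
Proof.
move=> H H'; apply: ismuls_uniq (ismuls_comp H H') _.
by rewrite mulrC; apply: ismuls_comp.
Qed.

Definition point (a b : k) : 'I_3 -> k := tri a b 1.

(* Evaluation at a common zero gives an eigenvector. *)
Lemma root_of_zero a b f2 M : f0.@[point a b] = 0 -> f1.@[point a b] = 0 ->
  ismuls 1 f2 M -> root (char_poly M) f2.@[point a b].
Proof.
move=> e0 e1 [hf2 hM]; rewrite -eigenvalue_root_char.
have hQ := @homogs_QQ n k; have sQ := size_QQ n_gt0 k.
pose z : 'cV[k]_(n * n) := \col_i ((Z 1)`_i).@[point a b].
have ideal0 d p : ideal d p -> p.@[point a b] = 0.
  by case=> q0 [q1 [_ _ ->]]; rewrite mevalD !mevalM e0 e1 !mul0r addr0.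
(* The power of ['X_2] of degree [2 * n - 1] has value 1 at the point, yet it is a combination of
   the [Z] modulo forms that vanish there. *)
have nzz : z != 0.
  pose p : P := 'X_o2 ^+ dg n 1.
  have hp : p \is (dg n 1).-homog.
    by rewrite /p mpolyXn dhomogX /= mdegMn mdeg1 mul1n.
  have [y hy] := spanned_Zs n_gt0 f0h f1h x2_homog hQ sQ nz hp.
  apply/eqP => z0; have := ideal0 _ _ hy; rewrite mevalB.
  have -> : (comb (Z 1) y).@[point a b] = 0.
    rewrite /comb (raddf_sum (meval (point a b))) big1 // => i _ /=.
    rewrite mevalZ; move/matrixP/(_ (cast_ord (size_Z 0) i) 0): z0.
    by rewrite !mxE /= => ->; rewrite mulr0.
  rewrite rmorphXn /= mevalXU /point triE expr1n subr0 => /eqP.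
  by rewrite oner_eq0.
have Mz : M *m z = f2.@[point a b] *: z.
  apply/matrixP => j l; rewrite !mxE; have := ideal0 _ _ (hM 0%N j).
  rewrite mevalB mevalM => /eqP; rewrite subr_eq0 => /eqP ->.
  rewrite raddf_sum /=; apply: eq_bigr => i _; rewrite mevalZ mxE; congr (_ * _).
  by rewrite -(Z_shift 1) expr1 mevalM /xpn rmorphXn /= mevalXU expr1n mul1r.
rewrite -[M]trmxK.
have : eigenvalue M^T f2.@[point a b].
  apply/eigenvalueP; exists z^T; first by rewrite -trmx_mul Mz linearZ.
  by rewrite trmx_eq0.
rewrite !eigenvalue_root_char trmxK.
by rewrite /char_poly -det_tr /char_poly_mx linearB /= tr_scalar_mx map_trmx trmxK.
Qed.

End EigenTheory.

Section Zeros.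
Variables (k : closedFieldType) (n : nat).
Hypothesis n_gt0 : (0 < n)%N.
Local Notation P := {mpoly k[3]}.
Local Notation x := (xpn n k).
Variables (f0 f1 f2 : P).
Local Notation isM := (@ismuls k n f0 f1).
Hypotheses (f0h : f0 \is n.-homog) (f1h : f1 \is n.-homog).
Hypothesis f2h : f2 \is n.-homog.
Hypothesis nz : forall d, volN n (tri f0 f1 (x o2)) (QQ n k) d != 0.

(** Multiplications commute, so the eigenspace of [a] contains a common eigenvector for the two
    affine coordinates, whose eigenvalues [s] and [t] are the point sought. A form of degree [n]
    then acts on this vector by its value at the point, and [f0], [f1] act by 0. *)
Lemma zero_of_root M a : isM 1 f2 M -> root (char_poly M) a ->
  exists s t, [/\ f0.@[point s t] = 0, f1.@[point s t] = 0
    & f2.@[point s t] = a].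
Proof.
(* The affine coordinates, raised to degree [n] by a power of the last variable. *)
pose hs : P := 'X_o0 * 'X_o2 ^+ n.-1; pose ht : P := 'X_o1 * 'X_o2 ^+ n.-1.
have hX i : 'X_i * 'X_o2 ^+ n.-1 \is [in k[3], (1 + n.-1).-homog].
  by rewrite dhomogM ?mpolyXn ?dhomogX /= ?mdegMn ?mdeg1 ?mul1n.
rewrite add1n prednK // in hX; have hsh : hs \is n.-homog := hX o0.
have hth : ht \is n.-homog := hX o1.
have [Ms hMs] := ismul_ex n_gt0 f0h f1h nz hsh.
have [Mt hMt] := ismul_ex n_gt0 f0h f1h nz hth.
move=> hM ra.
have cm := ismul_comm n_gt0 f0h f1h nz.
have ra' : eigenvalue M^T a.
  rewrite eigenvalue_root_char; move: ra; rewrite /char_poly -det_tr /char_poly_mx.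
  by rewrite linearB /= tr_scalar_mx map_trmx.
(* The vector sought is a column, like the evaluation vector of [root_of_zero], while [common_eigen]
   gives rows; hence the transposes. *)
have [] := @common_eigen k _ [:: M^T; Ms^T; Mt^T] _ (eigenspace M^T a) ra'.
- move=> A B; rewrite !inE => hA hB.
  by case/or3P: hA => /eqP ->; case/or3P: hB => /eqP ->;
     rewrite -!trmx_mul; congr (_^T); apply: cm; eassumption.
- move=> A hA; apply: comm_mx_stable_eigenspace; move: hA; rewrite !inE.
  by case/or3P=> /eqP ->; rewrite /comm_mx -!trmx_mul; congr (_^T);
     apply: cm; eassumption.
move=> w nzw [/eigenspaceP wa hw].
pose v := w^T; have nzv : v != 0 by rewrite trmx_eq0.
have Mv : M *m v = a *: v by rewrite -[M]trmxK -trmx_mul wa linearZ.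
have [s ws] := hw Ms^T (ltac:(by rewrite !inE eqxx orbT)).
have [t wt] := hw Mt^T (ltac:(by rewrite !inE eqxx !orbT)).
have sv : Ms *m v = s *: v by rewrite -[Ms]trmxK -trmx_mul ws linearZ.
have tv : Mt *m v = t *: v by rewrite -[Mt]trmxK -trmx_mul wt linearZ.
pose weig r H mu := exists2 N, isM r H N & N *m v = mu *: v.
have wM r H mu r' H' mu' : weig r H mu -> weig r' H' mu' ->
    weig (r + r')%N (H' * H) (mu' * mu).
  move=> [N hN Nv] [N' hN' Nv']; exists (N *m N'); first exact: ismuls_comp.
  by rewrite -mulmxA Nv' -scalemxAr Nv scalerA.
have w1 : weig 0%N 1 1.
  by exists 1%:M; [exact: (ismuls1 n f0 f1 0)|rewrite mul1mx scale1r].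
have wX H mu i : weig 1%N H mu -> weig i (H ^+ i) (mu ^+ i).
  by move=> h; elim: i => [|i IH] //; rewrite !exprS -addn1; apply: wM.
have ws' : weig 1%N hs s by exists Ms.
have wt' : weig 1%N ht t by exists Mt.
have wx : weig 1%N (x o2) 1.
  by exists 1%:M; [exact: (ismuls1 n f0 f1 1)|rewrite mul1mx scale1r].
have wm (m : mono n) N : isM 1 'X_[expo m] N ->
    N *m v = 'X_[expo m].@[point s t] *: v.
  move=> hN; have dm : mdeg (expo m) = n := eqP (valP m).
  rewrite mdeg_o in dm; set p0 := expo m o0; set p1 := expo m o1.
  have [N' hN' N'v] := wM _ _ _ _ _ _ (wM _ _ _ _ _ _ wx (wX _ _ p1 wt')) (wX _ _ p0 ws').
  (* A power of ['X_2 ^ n] acts as the identity, so multiplying the monomial by it keeps the matrix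
     [N] and makes the monomial a product of [hs], [ht] and ['X_2 ^ n]. *)
  have : isM (1 + p1 + p0)%N (hs ^+ p0 * (ht ^+ p1 * x o2)) N.
    have h := ismuls_comp n_gt0 f0h f1h hN (ismuls1 n f0 f1 (p1 + p0)).
    rewrite mulmx1 addnA in h; congr (isM _ _ _): h.
    rewrite mpolyXE_id big_ord3 /= -/p0 -/p1 /hs /ht /xpn !exprMn -!exprM.
    have e : 'X_o2 ^+ (n * (p1 + p0)) * 'X_o2 ^+ expo m o2 =
        'X_o2 ^+ (n.-1 * p0) * 'X_o2 ^+ (n.-1 * p1) * 'X_o2 ^+ n :> P.
      by rewrite -!exprD; congr (_ ^+ _); move: dm; rewrite -/p0 -/p1; nia.
    transitivity ('X_o0 ^+ p0 * 'X_o1 ^+ p1 *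
      ('X_o2 ^+ (n * (p1 + p0)) * 'X_o2 ^+ expo m o2) : P); first by ring.
    by rewrite e; ring.
  move=> h; rewrite (ismuls_uniq n_gt0 f0h f1h nz h hN') N'v; congr (_ *: _).
  rewrite mpolyXE_id big_ord3 /= !rmorphM !rmorphXn /= !mevalXU /point !triE.
  by rewrite expr1n !mulr1.
have wh h N : h \is n.-homog -> isM 1 h N -> N *m v = h.@[point s t] *: v.
  move=> hh hN; have [F hF] : exists F : mono n -> 'M_(n * n),
      forall m, isM 1%N 'X_[expo m] (F m).
    apply: (@fin_all_exists _ (fun=> 'M[k]_(n * n))
      (fun (m : mono n) N => isM 1%N 'X_[expo m] N)) => m; apply: ismul_ex => //.
    by rewrite dhomogX; apply: (valP m).
  have eh : h = \sum_(m : mono n) h@_(expo m) *: 'X_[expo m].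
    by apply: (@homog_eq _ n) => // [|m]; rewrite ?mcoeff_sum_mono ?homog_sum_mono.
  have hN' := ismul_sum (fun m : mono n => h@_(expo m)) hF; rewrite -eh in hN'.
  rewrite (ismuls_uniq n_gt0 f0h f1h nz hN hN') {2}eh rmorph_sum mulmx_suml.
  rewrite scaler_suml; apply: eq_bigr => m _.
  by rewrite -scalemxAl (wm _ _ (hF m)) /= mevalZ scalerA.
have ev0 h : h \is n.-homog -> isM 1 h 0 -> h.@[point s t] = 0.
  move=> hh h0; have := wh _ _ hh h0; rewrite mul0mx => /esym/eqP.
  by rewrite scaler_eq0 (negPf nzv) orbF => /eqP.
exists s, t; split; [exact/ev0/ismul_f0|exact/ev0/ismul_f1|].
have := wh _ _ f2h hM; rewrite Mv => /eqP.
by rewrite -subr_eq0 -scalerBl scaler_eq0 (negPf nzv) orbF subr_eq0 => /eqP.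
Qed.

End Zeros.

(** * The multiplication matrix with its denominators cleared *)

Section Phi.
Variable n : nat.

Definition lam (A : comNzRingType) (f : 'I_3 -> {mpoly A[3]}) d : A :=
  volN n (tri (f o0) (f o1) (xpn n A o2)) (QQ n A) d.

(* [lam f 2] times the matrix of the multiplication by [f o2] modulo [f o0] and
   [f o1]: its entries are polynomials in the coefficients of [f]. *)
Definition phimx (A : comNzRingType) (f : 'I_3 -> {mpoly A[3]}) : 'M[A]_(n * n) :=
  \matrix_(j, i) ccoord (dg n 2) (NN n (tri (f o0) (f o1) (xpn n A o2)) (QQ n A) 2)
    (f o2 * (Zs n (xpn n A o2) (QQ n A) 1)`_j) (#|mono (dg n 2)| - n * n + i).

(** The characteristic polynomial of the multiplication by [f o2], times a power of [lam f 2]: in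
    this form it exists over any commutative ring and commutes with ring morphisms. *)
Definition chi (A : comNzRingType) (f : 'I_3 -> {mpoly A[3]}) : {poly A} :=
  \det (\matrix_(i, j) ('X * (lam f 2)%:P *+ (i == j) - (phimx f i j)%:P)).

Section Maps.
Variables (A B : comNzRingType) (e : {rmorphism A -> B}).
Variables (f : 'I_3 -> {mpoly A[3]}) (g : 'I_3 -> {mpoly B[3]}).
Hypothesis fg : forall i, map_mpoly e (f i) = g i.

Lemma map_lam d : e (lam f d) = lam g d.
Proof. by rewrite /lam -map_volN map_QQ /volN /NN !triE map_xpn !fg. Qed.

Lemma map_phimx : map_mx e (phimx f) = phimx g.
Proof.
apply/matrixP => j i; rewrite !mxE -map_ccoord rmorphM /= fg; congr ccoord.
  by rewrite /NN map_Ns !triE map_QQ map_xpn !fg.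
by congr (_ * _); rewrite -nth_map_mpoly map_Zs map_xpn map_QQ.
Qed.

Lemma map_chi : map_poly e (chi f) = chi g.
Proof.
rewrite /chi -det_map_mx; congr (\det _); apply/matrixP => i j.
rewrite !mxE rmorphB rmorphMn rmorphM /= map_polyX !map_polyC /= map_lam.
by have /matrixP/(_ i j) := map_phimx; rewrite !mxE => ->.
Qed.

End Maps.

Lemma chi0 (A : comNzRingType) (f : 'I_3 -> {mpoly A[3]}) :
  (chi f).[0] = (-1) ^+ (n * n) * \det (phimx f).
Proof.
rewrite -detZ -[LHS]/(horner_eval 0 _) -det_map_mx; congr (\det _).
apply/matrixP => i j; rewrite !mxE /= /horner_eval hornerD hornerN hornerC.
by rewrite hornerMn hornerM hornerX mul0r mul0rn sub0r mulN1r.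
Qed.

Hypothesis n_gt0 : (0 < n)%N.

Section OverField.
Variables (k : fieldType) (f : 'I_3 -> {mpoly k[3]}).
Hypothesis fh : forall i, f i \is n.-homog.
Hypothesis nz : forall d, lam f d != 0.
Local Notation x2 := (xpn n k o2).
Local Notation Q0 := (QQ n k).
Local Notation Z := (Zs n x2 Q0).

Definition Phi : 'M[k]_(n * n) := (lam f 2)^-1 *: phimx f.

Lemma ismuls_Phi : ismuls (f o0) (f o1) 1 (f o2) Phi.
Proof.
have hQ := @homogs_QQ n k; have sQ := size_QQ n_gt0 k.
have hx := @xpn_homog n k o2.
apply: ismulsP => // j; set p := f o2 * _.
pose N := NN n (tri (f o0) (f o1) x2) Q0 2.
have sN : size N = #|mono (dg n 2)| by rewrite size_NN.
have hN : homogs (dg n 2) N by apply: homogs_Ns; rewrite ?triE //.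
have hp : p \is (dg n 2).-homog.
  by rewrite /p dgS // dhomogM //; apply: homogs_Zs.
have := spanned_vol sN hN (nz 2) hp; set y := fun j => _ => ep.
pose a := mulseq (f o0) (Ns n (f o0) (f o1) x2 Q0 1) ++
          mulseq (f o1) (Ys n (f o1) x2 Q0 1).
have eN : N = a ++ Z 2 by rewrite /N /NN /= !triE catA.
have sa : size a = (#|mono (dg n 2)| - n * n)%N.
  by rewrite -sN eN size_cat size_Z // addnK.
rewrite ep eN comb_cat.
have -> : comb (Z 2) (fun j => y (size a + j)%N) = \sum_i Phi j i *: (Z 2)`_i.
  rewrite /comb size_Z //; apply: eq_bigr => i _; congr (_ *: _).
  by rewrite /Phi !mxE /y sa.
rewrite addrK comb_cat !comb_mul.
set q0 := comb _ _; set q1 := comb _ _; exists q0, q1; split=> //.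
  by apply: homogs_comb; apply: homogs_Ns.
by apply: homogs_comb; apply: homogs_Ys.
Qed.

Lemma trans_Phi :
  trans (ideal2 n (f o0) (f o1) 1) (mulseq (f o2) (Z 1)) (Z 2) (\det Phi).
Proof.
have [_ h] := ismuls_Phi.
pose X (i j : nat) : k := if insub i is Some i' then
  if insub j is Some j' then Phi i' j' else 0 else 0.
have s1 : size (Z 1) = (n * n)%N by apply: size_Z.
have s2 : size (Z 2) = (n * n)%N by apply: size_Z.
exists X; rewrite s2; last first.
  by congr (\det _); apply/matrixP => i j; rewrite [RHS]mxE /X !valK.
split=> [|j hj]; first by rewrite size_mulseq.
rewrite nth_mulseq.
have := h 0%N (Ordinal hj); congr (ideal2 _ _ _ _ (_ - _)).
rewrite /comb s2; apply: eq_bigr => i _.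
by rewrite /X insubT /= valK.
Qed.

(** [vol_Ns] reads [w * lam f 1] at level 1 and [w ^ 3 * phi * lam f 2] at level 2; [w] is
    eliminated, and [phi] is the determinant of [phimx f] divided by [lam f 2 ^ (n * n)]. *)
Lemma volN_identity : volN n f Q0 2 * lam f 1 ^+ 3 * lam f 2 ^+ (n * n) =
  volN n f Q0 1 ^+ 3 * \det (phimx f) * lam f 2.
Proof.
have hQ := @homogs_QQ n k; have sQ := size_QQ n_gt0 k.
have hx := @xpn_homog n k o2.
have [w hw] : exists w, trans (ideal2 n (f o0) (f o1) 0) (Zs n (f o2) Q0 1) (Z 1) w.
  by apply: trans_Zs_ex => //; [rewrite size_Zs|apply: homogs_Zs].
have E d : volN n f Q0 d = _ :=
  vol_Ns n_gt0 (fh o0) (fh o1) hx hQ sQ nz (fh o2) hw trans_Phi d.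
rewrite !E binn expr1 mulr1 -[vol (dg n 1) _]/(lam f 1) -[vol (dg n 2) _]/(lam f 2).
have -> : \det (phimx f) = lam f 2 ^+ (n * n) * \det Phi.
  by rewrite /Phi detZ mulrA -exprMn divff ?nz // expr1n mul1r.
by rewrite !(mulr1, expr1); ring.
Qed.

Lemma chi_char_poly : chi f = lam f 2 ^+ (n * n) *: char_poly Phi.
Proof.
rewrite /char_poly -mul_polyC rmorphXn -detZ; congr (\det _).
apply/matrixP => i j; rewrite !mxE mulrBr; congr (_ - _); first by rewrite mulrnAr mulrC.
by rewrite -polyCM mulrA divff ?nz // mul1r.
Qed.

End OverField.
End Phi.

(** * Polynomials vanishing on forms with a common zero *)

Section FractionClosure.
Variable N : nat.
Definition fracfield : Type := {fraction {mpoly int[N]}}.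
HB.instance Definition _ := GRing.Field.on fracfield.

(** Codes making the fraction field countable, as [countable_algebraic_closure] requires. *)
Definition mpoly_code (p : {mpoly int[N]}) : seq ('X_{1..N} * int) :=
  [seq (m, p@_m) | m <- msupp p].
Definition mpoly_decode (s : seq ('X_{1..N} * int)) : {mpoly int[N]} :=
  \sum_(x <- s) x.2 *: 'X_[x.1].

Lemma mpoly_codeK : cancel mpoly_code mpoly_decode.
Proof. by move=> p; rewrite [RHS]mpolyE /mpoly_decode big_map. Qed.

Definition frac_decode (c : seq ('X_{1..N} * int) * seq ('X_{1..N} * int)) :
  fracfield := tofrac (mpoly_decode c.1) / tofrac (mpoly_decode c.2).

Lemma frac_decode_onto (x : fracfield) : exists c, frac_decode c == x.
Proof.
elim/quotW: x => r; have d0 : \d_r != 0 := denom_ratioP r.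
exists (mpoly_code \n_r, mpoly_code \d_r).
rewrite /frac_decode /= !mpoly_codeK; apply/eqP; unlock FracField.tofrac.
rewrite -[X in _ * X]FracField.pi_inv -[LHS]FracField.pi_mul; apply/eqmodP => /=.
rewrite FracField.equivfE /FracField.mulf /FracField.invf /=.
by rewrite !numden_Ratio ?mulf_neq0 ?oner_neq0 // mulr1 mul1r mulrC.
Qed.

Lemma frac_codeK : cancel (fun x => xchoose (frac_decode_onto x)) frac_decode.
Proof. by move=> x; apply/eqP; apply: (xchooseP (frac_decode_onto x)). Qed.

HB.instance Definition _ := CanIsCountable frac_codeK.

Lemma mpoly_int_closure :
  exists (K : closedFieldType) (e : {rmorphism {mpoly int[N]} -> K}), injective e.
Proof.
have [K [e _]] := countable_algebraic_closure fracfield.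
exists K, (e \o (@FracField.tofrac {mpoly int[N]} : {rmorphism _ -> fracfield})).
by move=> p q /= /fmorph_inj/eqP; rewrite tofrac_eq => /eqP.
Qed.

End FractionClosure.

Lemma map_resultant_gen (aR rR : nzRingType) (f : {rmorphism aR -> rR}) p q :
    f (lead_coef p) != 0 -> f (lead_coef q) != 0 ->
  f (resultant p q) = resultant (map_poly f p) (map_poly f q).
Proof.
move=> nz_fp nz_fq; rewrite /resultant /Sylvester_mx !size_map_poly_id0 //.
rewrite -det_map_mx /= map_col_mx; congr (\det (col_mx _ _));
  by apply: map_lin1_mx => v; rewrite map_poly_rV rmorphM /= map_rVpoly.
Qed.

(** The constant is the resultant: it lies in the ideal of [p] and [q], and it is nonzero because
    its image under [e] is the resultant of two coprime polynomials. *)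
Lemma bezout_spec (A : idomainType) (K : fieldType) (e : {rmorphism A -> K})
    (p q : {poly A}) : e (lead_coef p) != 0 -> e (lead_coef q) != 0 ->
    coprimep (map_poly e p) (map_poly e q) ->
  exists r u v, r != 0 /\ r%:P = u * p + v * q.
Proof.
move=> ep eq cpq.
have nzl (s : {poly A}) : e (lead_coef s) != 0 -> s != 0.
  by apply: contraNneq => ->; rewrite lead_coef0 rmorph0.
(* The resultant is known to lie in the ideal for nonconstant polynomials only; a nonzero constant
   is its own witness. *)
have [sp|sp] := leqP (size p) 1.
  exists (lead_coef p), 1, 0; rewrite lead_coef_eq0 nzl // mul0r addr0 mul1r.
  by rewrite [in RHS](size1_polyC sp) lead_coefE (eqP (_ : size p == 1%N)) //
    eqn_leq sp lt0n size_poly_eq0 nzl.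
have [sq|sq] := leqP (size q) 1.
  exists (lead_coef q), 0, 1; rewrite lead_coef_eq0 nzl // mul0r add0r mul1r.
  by rewrite [in RHS](size1_polyC sq) lead_coefE (eqP (_ : size q == 1%N)) //
    eqn_leq sq lt0n size_poly_eq0 nzl.
have [[u v] /= _ E] := resultant_in_ideal sp sq.
exists (resultant p q), u, v; split=> //.
have : e (resultant p q) != 0.
  rewrite map_resultant_gen // resultant_eq0 -leqNgt.
  by move: cpq; rewrite coprimep_def => /eqP ->.
by apply: contraNneq => ->; rewrite rmorph0.
Qed.

(** * An example with n^2 distinct eigenvalues *)

Section Example.
Variable n : nat.
Hypothesis n_gt0 : (0 < n)%N.

(* The points [(i * eps, j * eps, 1)] with [i, j < n] are the common zeros of the
   first two forms; the values of the third one there are pairwise distinct. *)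
Definition grid (A : comNzRingType) (eps : A) : 'I_3 -> {mpoly A[3]} :=
  tri (\prod_(i < n) ('X_o0 - (i%:R * eps) *: 'X_o2))
      (\prod_(i < n) ('X_o1 - (i%:R * eps) *: 'X_o2))
      (('X_o0 + n%:R *: 'X_o1) * 'X_o2 ^+ n.-1).

Lemma map_grid (A B : comNzRingType) (e : {rmorphism A -> B}) eps i :
  map_mpoly e (grid eps i) = grid (e eps) i.
Proof.
have h j l : map_mpoly e (\prod_(i < n) ('X_j - (i%:R * eps) *: 'X_l)) =
    \prod_(i < n) ('X_j - (i%:R * e eps) *: 'X_l).
  rewrite rmorph_prod; apply: eq_bigr => i' _ /=.
  by rewrite rmorphB /= map_mpolyZ !map_mpolyX rmorphM rmorph_nat.
move: i; apply: ord3P; rewrite /grid !triE ?h //.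
by rewrite rmorphM rmorphXn rmorphD /= map_mpolyZ !map_mpolyX rmorph_nat.
Qed.

Lemma grid_homog (A : comNzRingType) (eps : A) i : grid eps i \is n.-homog.
Proof.
have hX j : 'X_j \is [in A[3], 1.-homog] by rewrite dhomogX /= mdeg1.
have hp m (F : 'I_m -> {mpoly A[3]}) : (forall i, F i \is 1.-homog) ->
    \prod_i F i \is m.-homog.
  elim: m F => [|m IH] F hF; first by rewrite big_ord0 dhomog1.
  have h := dhomogM (IH (fun i => F (widen_ord (leqnSn m) i)) (fun i => hF _)) (hF ord_max).
  by rewrite big_ord_recr /=; rewrite addn1 in h.
move: i; apply: ord3P; rewrite /grid triE.
- by apply: hp => i; apply: rpredB => //; apply: dhomogZ.
- by apply: hp => i; apply: rpredB => //; apply: dhomogZ.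
have h : ('X_o0 + n%:R *: 'X_o1) * 'X_o2 ^+ n.-1 \is [in A[3], (1 + n.-1).-homog].
  rewrite dhomogM //; first by apply: rpredD => //; apply: dhomogZ.
  by have := dhomogMn n.-1 (hX o2); rewrite mul1n.
by rewrite add1n prednK // in h.
Qed.

Local Notation k1 := {fraction {poly rat}}.
Local Notation eps := (tofrac ('X : {poly rat})).
Local Notation F := (@grid k1 eps).

(** At [eps = 0] the first two forms become ['X_0 ^ n] and ['X_1 ^ n]. Keeping [eps] indeterminate
    thus makes [lam] nonzero at every level while the grid points stay distinct. *)
Lemma grid_lam d : lam n F d != 0.
Proof.
rewrite -(@map_lam n _ _ (@FracField.tofrac {poly rat}) (grid ('X : {poly rat})) F
  (fun i => map_grid _ _ i)).
rewrite tofrac_eq0.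
suff h : horner_eval 0 (lam n (@grid {poly rat} 'X) d) ^+ 2 = 1.
  by apply/eqP => e; move: h; rewrite e rmorph0 expr0n => /esym/eqP; rewrite oner_eq0.
have hX i : map_mpoly (horner_eval (0 : rat)) (grid 'X i) = grid 0 i.
  by rewrite map_grid /= /horner_eval hornerX.
rewrite (map_lam n hX).
have := volN_xpn n_gt0 rat d; congr (_ ^+ 2 = 1).
have hp j l : \prod_(i < n) ('X_j - (i%:R * 0) *: 'X_l) = xpn n rat j.
  rewrite (eq_bigr (fun=> 'X_j)) => [|i _]; last by rewrite mulr0 scale0r subr0.
  by rewrite prodr_const card_ord.
by rewrite /lam /volN /NN !triE /grid !triE !hp.
Qed.

(** The digits of [t] in base [n] select the grid point where the third form takes the value
    [t * eps]; this is why its second coefficient is [n]. *)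
Lemma grid_root (t : nat) : (t < n * n)%N ->
  root (char_poly (Phi n F)) (t%:R * eps).
Proof.
move=> ht; pose i := (t %% n)%N; pose j := (t %/ n)%N.
have hi : (i < n)%N by rewrite ltn_mod.
have hj : (j < n)%N by rewrite ltn_divLR.
have hp (a : 'I_3) (c : k1) m P : (m < n)%N -> P a = m%:R * eps -> P o2 = 1 ->
    (\prod_(i < n) ('X_a - (i%:R * eps) *: 'X_o2)).@[P] = 0.
  move=> hm ha h2; rewrite rmorph_prod (bigD1 (Ordinal hm)) //=.
  by rewrite mevalB mevalZ !mevalXU ha h2 mulr1 subrr mul0r.
have -> : t%:R * eps = (F o2).@[point (i%:R * eps) (j%:R * eps)].
  rewrite /grid triE rmorphM rmorphXn rmorphD /= mevalZ !mevalXU /point !triE.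
  by rewrite expr1n mulr1 mulrA -natrM -mulrDl -natrD addnC mulnC -divn_eq.
have hF := grid_homog eps; have nzF := grid_lam.
apply: (@root_of_zero k1 n n_gt0 (F o0) (F o1) (hF o0) (hF o1) nzF).
- by rewrite /grid triE; apply: (hp _ 0 i).
- by rewrite /grid triE; apply: (hp _ 0 j).
exact: (ismuls_Phi n_gt0 hF nzF).
Qed.

Lemma grid_separable : separable_poly (chi n F).
Proof.
pose rs : seq k1 := [seq t%:R * eps | t <- iota 0 (n * n)].
have urs : uniq rs.
  rewrite map_inj_uniq ?iota_uniq // => t t' /mulIf.
  rewrite tofrac_eq0 polyX_eq0 => /(_ isT)/eqP.
  rewrite -!(rmorph_nat (@FracField.tofrac {poly rat})) tofrac_eq.
  by rewrite -!polyC_natr (inj_eq polyC_inj) Num.Theory.eqr_nat => /eqP.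
have hrs : all (root (char_poly (Phi n F))) rs.
  by apply/allP => r /mapP[t]; rewrite mem_iota => /andP[_ ht] ->; apply: grid_root.
rewrite chi_char_poly //; last exact: grid_lam.
have srs : size (char_poly (Phi n F)) = (size rs).+1.
  by rewrite size_char_poly size_map size_iota.
rewrite (all_roots_prod_XsubC srs hrs) ?uniq_rootsE //.
rewrite (monicP (char_poly_monic _)) scale1r.
have c0 : lam n F 2 ^+ (n * n) != 0 by rewrite expf_neq0 ?grid_lam.
have := separable_prod_XsubC rs; rewrite urs !separable_poly.unlock derivZ.
by rewrite coprimepZl // coprimepZr.
Qed.

Lemma grid_det_phimx : \det (phimx n F) = 0.
Proof.
have h0 : (0 < n * n)%N by rewrite muln_gt0 n_gt0.
have := grid_root h0; rewrite mul0r => /rootP r0.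
have := chi0 n F; rewrite (chi_char_poly grid_lam) hornerZ r0 mulr0.
by move=> /esym/eqP; rewrite mulf_eq0 signr_eq0 => /eqP.
Qed.

End Example.

Opaque chi phimx.

Section Vanishing.
Variable n : nat.
Hypothesis n_gt0 : (0 < n)%N.
Local Notation A := (res_poly n).
Local Notation g := (gen n).

Definition vanishing (R : A) : Prop :=
  forall (k : closedFieldType) (f : 'I_3 -> {mpoly k[3]}),
    (forall i, f i \is n.-homog) ->
    (exists p : 'I_3 -> k, (exists i, p i != 0) /\ forall i, (f i).@[p] = 0) ->
  ev f R = 0.

Lemma volN_ev_neq0 (f : 'I_3 -> {mpoly A[3]}) (v : 'I_3 -> {mpoly int[3]}) d :
    (forall i, v i \is n.-homog) ->
    (forall i, map_mpoly (ev v) (f i) = xpn n int i) ->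
  volN n f (QQ n A) d != 0.
Proof.
move=> hv hf; have h := volN_xpn n_gt0 int d.
have e : ev v (volN n f (QQ n A) d) = volN n (xpn n int) (QQ n int) d.
  by rewrite -map_volN map_QQ /volN /NN !hf.
by apply: contra_eq_neq h => e0; rewrite -e e0 rmorph0 expr0n eq_sym oner_eq0.
Qed.

Lemma lam_gen_neq0 d : lam n g d != 0.
Proof.
apply: (@volN_ev_neq0 _ (xpn n int)); first exact: xpn_homog.
by apply: ord3P; rewrite !triE ?map_xpn ?map_ev_gen //; apply: xpn_homog.
Qed.

Lemma chi_gen_lead : size (chi n g) = (n * n).+1 /\
  lead_coef (chi n g) = lam n g 2 ^+ (n * n).
Proof.
have [K [e einj]] := mpoly_int_closure #|{: 'I_3 * mono n}|.
pose f i := map_mpoly e (g i).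
have mc := @map_chi n _ _ e g f (fun=> erefl).
have ml d := @map_lam n _ _ e g f (fun=> erefl) d.
have nzf d : lam n f d != 0.
  rewrite -ml; apply: contra_neq (lam_gen_neq0 d) => h.
  by apply: einj; rewrite h rmorph0.
have c0 : lam n f 2 ^+ (n * n) != 0 by rewrite expf_neq0.
have sc : size (chi n g) = (n * n).+1.
  rewrite -(size_map_inj_poly einj) ?rmorph0 // mc chi_char_poly //.
  by rewrite size_scale // size_char_poly.
split=> //; apply: einj; rewrite lead_coefE -coef_map mc sc /= rmorphXn /= ml.
rewrite chi_char_poly // coefZ.
have /monicP := char_poly_monic (Phi n f).
by rewrite lead_coefE size_char_poly => ->; rewrite mulr1.
Qed.

(** Separability at the grid suffices: the leading coefficients of [chi] and of its derivative
    survive there, the latter because the characteristic is 0. *)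
Lemma chi_bezout : exists r u v,
  r != 0 /\ r%:P = u * chi n g + v * (chi n g)^`().
Proof.
pose k1 := {fraction {poly rat}}.
pose eps : k1 := tofrac ('X : {poly rat}); pose F := grid n eps.
have mg i : map_mpoly (ev F) (g i) = F i by rewrite map_ev_gen //; apply: grid_homog.
have nzF := grid_lam n_gt0.
have m_gt0 : (0 < n * n)%N by rewrite muln_gt0 n_gt0.
have [sc lc] := chi_gen_lead; set c := chi n g in sc lc *.
have lF : ev F (lead_coef c) != 0.
  by rewrite lc rmorphXn /= (map_lam n mg) expf_neq0 ?nzF.
have nzm : (n * n)%:R != 0 :> k1.
  rewrite -(rmorph_nat (@FracField.tofrac {poly rat})) tofrac_eq0.
  by rewrite -polyC_natr polyC_eq0 Num.Theory.pnatr_eq0 -lt0n.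
have sd : size c^`() = n * n :> nat.
  have h : c^`()`_(n * n).-1 = lead_coef c *+ (n * n).
    by rewrite coef_deriv prednK // lead_coefE sc.
  have hz : c^`()`_(n * n).-1 != 0.
    apply: contraNneq lF => e0; have := congr1 (ev F) h.
    rewrite e0 rmorph0 rmorphMn /= => /esym/eqP.
    by rewrite -mulr_natr mulf_eq0 (negPf nzm) orbF.
  apply/eqP; rewrite eqn_leq; apply/andP; split.
    by rewrite -ltnS -sc lt_size_deriv // -size_poly_eq0 sc.
  by rewrite leqNgt; apply: contra hz => hs; rewrite nth_default // -ltnS prednK.
have ld : ev F (lead_coef c^`()) != 0.
  have ldE : lead_coef c^`() = lead_coef c *+ (n * n).
    by rewrite lead_coefE sd coef_deriv (prednK m_gt0) lead_coefE sc.
  rewrite ldE rmorphMn /= -mulr_natr; exact: mulf_neq0 lF nzm.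
have cp : coprimep (map_poly (ev F) c) (map_poly (ev F) c^`()).
  have := grid_separable n_gt0; rewrite separable_poly.unlock.
  by rewrite -(map_chi n mg) deriv_map.
exact: (bezout_spec lF ld cp).
Qed.

(** In [rho] the third form is replaced by itself minus ['X * 'X_2 ^ n]. At an eigenvalue the three
    forms acquire a common zero, so [rho] vanishes at all roots of [chi], which are simple; at 0,
    [rho] is [R] and [chi] is the determinant up to sign. *)
Theorem vanishing_div (R : A) : vanishing R ->
  exists N q, lam n g 2 ^+ N * R = q * \det (phimx n g).
Proof.
move=> vR; have [K [e einj]] := mpoly_int_closure #|{: 'I_3 * mono n}|.
pose gT : 'I_3 -> {mpoly {poly A}[3]} :=
  fun i => map_mpoly polyC (g i) - (if i == o2 then 'X else 0) *: xpn n {poly A} i.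
pose rho : {poly A} := ev gT R.
have comp_mpoly (B C D : comNzRingType) (u : {rmorphism B -> C}) (v : {rmorphism C -> D})
    (w : {rmorphism B -> D}) (p : {mpoly B[3]}) : (forall b, v (u b) = w b) ->
    map_mpoly v (map_mpoly u p) = map_mpoly w p.
  by move=> h; apply/mpolyP => m; rewrite !mcoeff_map_mpoly /= h.
have rho0 : rho.[0] = R.
  rewrite -[LHS]/(horner_eval 0 rho) ev_comp -[RHS]ev_gen_id; apply: eq_ev => i.
  rewrite rmorphB /= map_mpolyZ map_xpn /=.
  have -> : horner_eval (0 : A) (if i == o2 then 'X else 0) = 0.
    by rewrite /horner_eval; case: ifP; rewrite ?horner0 // hornerX.
  rewrite scale0r subr0 (comp_mpoly _ _ _ _ _ idfun).
    by apply/mpolyP => m; rewrite mcoeff_map_mpoly.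
  by move=> b; rewrite /= /horner_eval hornerC.
pose f i := map_mpoly e (g i).
have fh i : f i \is n.-homog by apply/map_homog/gen_homog.
have nzf d : lam n f d != 0.
  rewrite -(@map_lam n _ _ e g f (fun=> erefl)).
  by apply: contra_neq (lam_gen_neq0 d) => h; apply: einj; rewrite h rmorph0.
have rho_root a : root (map_poly e (chi n g)) a -> (map_poly e rho).[a] = 0.
  rewrite (@map_chi n _ _ e g f (fun=> erefl)) chi_char_poly //.
  rewrite rootZ ?expf_neq0 ?nzf // => ra.
  have [s [t [h0 h1 h2]]] :=
    zero_of_root n_gt0 (fh o0) (fh o1) (fh o2) nzf (ismuls_Phi n_gt0 fh nzf) ra.
  pose eT : {rmorphism {poly A} -> K} := horner_eval a \o map_poly e.
  rewrite -[LHS]/(eT rho) ev_comp.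
  have E i : map_mpoly eT (gT i) = f i - (if i == o2 then a else 0) *: xpn n K i.
    rewrite rmorphB /= map_mpolyZ map_xpn /=; congr (_ - _ *: _).
      by apply: comp_mpoly => b; rewrite /= map_polyC /horner_eval hornerC.
    by case: ifP; rewrite /= ?rmorph0 // map_polyX /horner_eval hornerX.
  apply: vR => [i|]; first by rewrite E; apply: rpredB; [exact: fh|apply: rpredZ; exact: xpn_homog].
  exists (point s t); split; first by exists o2; rewrite /point triE oner_eq0.
  apply: ord3P; rewrite E mevalB mevalZ.
  - by rewrite h0 mul0r subr0.
  - by rewrite h1 mul0r subr0.
  by rewrite h2 /xpn rmorphXn /= mevalXU /point triE expr1n mulr1 subrr.
have [sc lc] := chi_gen_lead; set c := chi n g in sc lc rho_root.
have nzc : map_poly e c != 0.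
  by rewrite -size_poly_eq0 (size_map_inj_poly einj) ?rmorph0 // sc.
have sepc : separable_poly (map_poly e c).
  have [r [u [v [nzr E]]]] := chi_bezout; rewrite separable_poly.unlock.
  apply/Bezout_coprimepP; exists (map_poly e u, map_poly e v) => /=.
  rewrite deriv_map -!rmorphM -rmorphD -E /= map_polyC /=.
  rewrite -size_poly_eq1 size_polyC; suff -> : e r != 0 by [].
  by apply: contra_neq nzr => h; apply: einj; rewrite h rmorph0.
have dvd : map_poly e c %| map_poly e rho.
  have [rs Ers] := closed_field_poly_normal (map_poly e c).
  have l0 : lead_coef (map_poly e c) != 0 by rewrite lead_coef_eq0.
  rewrite Ers dvdpZl //; apply: uniq_roots_dvdp.
    apply/allP => a ha; apply/rootP/rho_root.
    by rewrite Ers rootZ // root_prod_XsubC.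
  rewrite uniq_rootsE -separable_prod_XsubC; move: sepc.
  by rewrite {1}Ers !separable_poly.unlock derivZ coprimepZl // coprimepZr.
(* Pseudo-division stays over the integer polynomials and only costs powers of the leading
   coefficient of [chi], itself a power of [lam n g 2]. The divisibility over [K] kills the
   remainder, whose degree is too small. *)
have E := Pdiv.Idomain.divp_eq rho c.
have rem0 : rho %% c = 0.
  have inj := map_inj_poly einj (rmorph0 e).
  apply: inj; rewrite rmorph0; apply: contraTeq dvd => nzrem.
  have ltr : (size (map_poly e (rho %% c)) < size (map_poly e c))%N.
    rewrite !(size_map_inj_poly einj) ?rmorph0 // ltn_modp.
    by rewrite -size_poly_eq0 sc.
  apply: contraL (ltr) => hd; rewrite -leqNgt dvdp_leq //.
  have -> : map_poly e (rho %% c) = e (lead_coef c ^+ scalp rho c) *: map_poly e rho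
      - map_poly e (rho %/ c) * map_poly e c.
    by rewrite -map_polyZ E rmorphD rmorphM /= addrAC subrr add0r.
  by rewrite dvdp_sub ?dvdp_mull // -mul_polyC dvdp_mull.
rewrite rem0 addr0 in E; have := congr1 (horner^~ 0) E.
rewrite /= hornerZ rho0 hornerM chi0 lc -exprM => {}E.
exists (n * n * Pdiv.Idomain.scalp rho c)%N, ((rho %/ c).[0] * (-1) ^+ (n * n)).
by rewrite E mulrA.
Qed.

End Vanishing.

(** * Cancelling the denominators *)

(** A relation respected by the products passes to corresponding members of two families; it serves
    for degree bounds along a path and for the scaling of forms. *)
Lemma Ns_rel (A B : comNzRingType) n (rel : {mpoly A[3]} -> {mpoly B[3]} -> Prop)
    f0 f1 g Q f0' f1' g' Q' :
    rel 0 0 -> (forall m, rel 'X_[m] 'X_[m]) ->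
    (forall j, rel Q`_j Q'`_j) -> size Q = size Q' ->
    (forall p p', rel p p' -> rel (f0 * p) (f0' * p')) ->
    (forall p p', rel p p' -> rel (f1 * p) (f1' * p')) ->
    (forall p p', rel p p' -> rel (g * p) (g' * p')) ->
  forall d j, rel (Ns n f0 f1 g Q d)`_j (Ns n f0' f1' g' Q' d)`_j.
Proof.
move=> r0 rX rQ sQ h0 h1 hg.
pose ok (s : seq {mpoly A[3]}) (s' : seq {mpoly B[3]}) :=
  size s = size s' /\ forall j, rel s`_j s'`_j.
have okV : ok (mons A n.-1) (mons B n.-1).
  split; first by rewrite !size_mons.
  move=> j; have [hj|hj] := ltnP j #|mono n.-1|; last first.
    by rewrite !nth_default ?size_mons.
  have hs : (j < size (enum (mono n.-1)))%N by rewrite -cardE.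
  by rewrite /mons !(nth_map (enum_val (Ordinal hj)) 0 _ hs); apply: rX.
have okM f f' s s' : (forall p p', rel p p' -> rel (f * p) (f' * p')) ->
    ok s s' -> ok (mulseq f s) (mulseq f' s').
  by move=> hf [e h]; split=> [|j]; rewrite ?size_mulseq // !nth_mulseq; apply: hf.
have okC s s' t t' : ok s s' -> ok t t' -> ok (s ++ t) (s' ++ t').
  by move=> [e h] [e' h']; split=> [|j]; rewrite ?size_cat ?e ?e' // !nth_cat e; case: ifP.
have okZ d : ok (Zs n g Q d) (Zs n g' Q' d).
  case: d => [|d] //; rewrite /Zs; apply: (okM); last by apply: okC; [exact: okM|].
  by elim: d => [|d IH] p p' hp; rewrite ?expr0 ?mul1r // !exprS -!mulrA; apply/hg/IH.
have okY d : ok (Ys n f1 g Q d) (Ys n f1' g' Q' d).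
  by elim: d => [|d IH] //; apply: okC (okZ d.+1); apply: okM.
suff okN d : ok (Ns n f0 f1 g Q d) (Ns n f0' f1' g' Q' d) by move=> d; case: (okN d).
by elim: d => [|d IH] //; apply: okC (okY d.+1); apply: okM.
Qed.

Section Bounded.
Variable A : comNzRingType.

(** A formal leading term: [c] may be 0, which makes the notion stable under sums and products. *)
Definition bp a (p : {poly A}) c := (size p <= a.+1)%N /\ p`_a = c.

Lemma bpD a p q c d : bp a p c -> bp a q d -> bp a (p + q) (c + d).
Proof.
move=> [sp <-] [sq <-]; split; last by rewrite coefD.
by apply: leq_trans (size_polyD _ _) _; rewrite geq_max sp.
Qed.

Lemma bpM a b p q c d : bp a p c -> bp b q d -> bp (a + b) (p * q) (c * d).
Proof.
move=> [sp <-] [sq <-]; split.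
  by apply: leq_trans (size_polyMleq _ _) _; lia.
have ha : (a < (a + b).+1)%N by lia.
rewrite coefM (bigD1 (Ordinal ha)) //= addKn big1 ?addr0 // => i.
rewrite -val_eqE /= => ne; have [h|h] := ltnP a i.
  by rewrite [p`__]nth_default ?mul0r //; apply: leq_trans sp _.
by rewrite [q`__]nth_default ?mulr0 //; apply: leq_trans sq _; lia.
Qed.

Lemma bp0 a : bp a 0 0. Proof. by rewrite /bp size_poly0 coef0. Qed.

Lemma bpC c : bp 0 c%:P c.
Proof. by rewrite /bp size_polyC coefC; split=> //; case: (_ != _). Qed.

Lemma bp_sum (I : Type) (r : seq I) (P : pred I) a F G :
  (forall i, P i -> bp a (F i) (G i)) ->
  bp a (\sum_(i <- r | P i) F i) (\sum_(i <- r | P i) G i).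
Proof.
move=> h; elim/big_rec2: _ => [|i p c Pi]; first exact: bp0.
by apply: bpD; apply: h.
Qed.

Lemma bp_prod (I : finType) (e : I -> nat) F G : (forall i, bp (e i) (F i) (G i)) ->
  bp (\sum_i e i) (\prod_i F i) (\prod_i G i).
Proof.
move=> h; elim/big_rec3: _ => [|i x y z _ IH]; first exact: bpC.
exact: bpM.
Qed.

Definition bd (p : {mpoly {poly A}[3]}) (q : {mpoly A[3]}) :=
  exists e, forall m, bp e p@_m q@_m.

Lemma bdM p p' q q' : bd p p' -> bd q q' -> bd (p * q) (p' * q').
Proof.
move=> [a ha] [b hb]; exists (a + b)%N => m; rewrite !mcoeffM.
by apply: bp_sum => i _; apply: bpM.
Qed.

Lemma bdX m : bd 'X_[m] 'X_[m].
Proof. by exists 0%N => m'; rewrite !mcoeffX -polyC_natr; apply: bpC. Qed.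

Lemma bd_vol l s s' : (forall j, bd s`_j s'`_j) ->
  exists E, bp E (vol l s) (vol l s').
Proof.
move=> h; have [e he] := @fin_all_exists _ (fun=> nat)
  (fun (j : 'I_#|mono l|) e => forall m, bp e (s`_j)@_m (s'`_j)@_m) (fun j => h j).
exists (\sum_j e j)%N; apply: bp_sum => u _; rewrite -[(\sum_j e j)%N]add0n.
apply: bpM; first by rewrite -(rmorph_sign polyC); apply: bpC.
(* The degree bounds are attached to columns, so all terms of the determinant share the same total
   bound. *)
rewrite (reindex_inj (@perm_inj _ u)) /=; apply: bp_prod => i; rewrite !mxE; exact: he.
Qed.

End Bounded.

Section Path.
Variables (n : nat) (A : comNzRingType).
Hypothesis n_gt0 : (0 < n)%N.

(* Deforms [h] into the powers ['X_i ^ n]: leading coefficients along this path are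
   the values at these powers. *)
Definition pathf (h : 'I_3 -> {mpoly A[3]}) (i : 'I_3) : {mpoly {poly A}[3]} :=
  map_mpoly polyC (h i) + 'X *: xpn n {poly A} i.

Lemma bd_pathf h i p p' : bd p p' -> bd (pathf h i * p) (xpn n A i * p').
Proof.
apply: bdM; exists 1%N => m; rewrite mcoeffD mcoeff_map_mpoly mcoeffZ /xpn.
rewrite !mpolyXn !mcoeffX -[X in bp _ _ X]add0r; apply: bpD.
  by rewrite /bp coefC /= (leq_trans (size_polyC_leq1 _)).
rewrite -polyC_natr -[X in bp X]addn0 -[X in bp _ _ X]mul1r.
by apply: bpM (bpC _); rewrite /bp size_polyX coefX.
Qed.

Lemma bd_xpn i p p' : bd p p' -> bd (xpn n {poly A} i * p) (xpn n A i * p').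
Proof. by apply: bdM; rewrite /xpn !mpolyXn; apply: bdX. Qed.

Lemma bd_QQ j : bd (QQ n {poly A})`_j (QQ n A)`_j.
Proof.
rewrite /QQ; set s := [seq _ <- _ | _]; have [hj|hj] := ltnP j (size s).
  by rewrite !(nth_map 0%MM) //; apply: bdX.
by rewrite !nth_default ?size_map //; exists 0%N => m; rewrite !mcoeff0; apply: bp0.
Qed.

Lemma bd_lam h d : exists E, bp E (lam n (pathf h) d) (volN n (xpn n A) (QQ n A) d).
Proof.
apply: bd_vol; apply: Ns_rel; try exact: bd_pathf; try exact: bd_xpn.
- by exists 0%N => m; rewrite !mcoeff0; apply: bp0.
- exact: bdX.
- exact: bd_QQ.
by rewrite !size_QQ.
Qed.

Lemma bd_volN h d : exists E, bp E (volN n (pathf h) (QQ n {poly A}) d)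
  (volN n (xpn n A) (QQ n A) d).
Proof.
apply: bd_vol; apply: Ns_rel; try exact: bd_pathf.
- by exists 0%N => m; rewrite !mcoeff0; apply: bp0.
- exact: bdX.
- exact: bd_QQ.
by rewrite !size_QQ.
Qed.

Lemma bp_lead E (p : {poly A}) c : bp E p c -> c ^+ 2 = 1 -> lead_coef p ^+ 2 = 1.
Proof.
move=> [sp <-] h; suff -> : lead_coef p = p`_E by [].
have nz : p`_E != 0.
  by apply: contra_eq_neq h => ->; rewrite expr0n eq_sym oner_eq0.
rewrite lead_coefE; suff -> : size p = E.+1 by [].
by apply/eqP; rewrite eqn_leq sp ltnNge; apply: contra nz => hs; rewrite nth_default.
Qed.

Lemma lead_lam h d : lead_coef (lam n (pathf h) d) ^+ 2 = 1.
Proof. by have [E hE] := bd_lam h d; apply: bp_lead hE (volN_xpn n_gt0 A d). Qed.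

Lemma lead_volN h d : lead_coef (volN n (pathf h) (QQ n {poly A}) d) ^+ 2 = 1.
Proof. by have [E hE] := bd_volN h d; apply: bp_lead hE (volN_xpn n_gt0 A d). Qed.

(** In [lam] the third form is replaced by ['X_2 ^ n], so [c o2] cannot appear; the coprimality of
    the three denominators rests on this. *)
Lemma lam_scale (c : 'I_3 -> A) d : exists a b v, v ^+ 2 = 1 /\
  lam n (fun i => c i *: xpn n A i) d = c o0 ^+ a * c o1 ^+ b * v.
Proof.
pose rel (p p' : {mpoly A[3]}) := exists ab : nat * nat,
  p = (c o0 ^+ ab.1 * c o1 ^+ ab.2) *: p'.
pose s := NN n (tri (c o0 *: xpn n A o0) (c o1 *: xpn n A o1) (xpn n A o2)) (QQ n A) d.
pose s' := NN n (xpn n A) (QQ n A) d.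
have h j : rel s`_j s'`_j.
  apply: Ns_rel => // [|m|i|p p' [[a b] ->]|p p' [[a b] ->]|p p' [[a b] ->]].
  - by exists (0, 0)%N; rewrite scaler0.
  - by exists (0, 0)%N; rewrite mul1r scale1r.
  - by exists (0, 0)%N; rewrite mul1r scale1r.
  - by exists (a.+1, b); rewrite triE /= -scalerAl -scalerAr scalerA exprS mulrA.
  - exists (a, b.+1); rewrite triE /= -scalerAl -scalerAr scalerA exprS.
    by rewrite mulrCA.
  by exists (a, b); rewrite triE -scalerAr.
have [ab hab] := @fin_all_exists _ (fun=> (nat * nat)%type)
  (fun (j : 'I_#|mono (dg n d)|) ab => s`_j = (c o0 ^+ ab.1 * c o1 ^+ ab.2) *: s'`_j)
  (fun j => h j).
exists (\sum_j (ab j).1)%N, (\sum_j (ab j).2)%N, (volN n (xpn n A) (QQ n A) d).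
split; first exact: volN_xpn.
have E : volmx (dg n d) s = volmx (dg n d) s' *m
    diag_mx (\row_j (c o0 ^+ (ab j).1 * c o1 ^+ (ab j).2)).
  by rewrite mul_mx_diag; apply/matrixP => i j; rewrite !mxE hab mcoeffZ mulrC.
rewrite -[LHS]/(\det (volmx (dg n d) s)) E det_mulmx det_diag mulrC; congr (_ * _).
rewrite (eq_bigr (fun j => c o0 ^+ (ab j).1 * c o1 ^+ (ab j).2)).
  by rewrite big_split /= !expr_sum.
by move=> j _; rewrite mxE.
Qed.

End Path.

(** Division by [q] is possible, and [r] times the remainder is a multiple of [q] of smaller degree,
    hence 0: a constant can be cancelled without unique factorization. *)
Lemma unit_lead_div (A : idomainType) (p q w : {poly A}) (r : A) :
  lead_coef q ^+ 2 = 1 -> r != 0 -> r *: p = w * q -> exists w', p = w' * q.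
Proof.
move=> lq nzr E; have ulq : lead_coef q \is a GRing.unit.
  by apply/unitrPr; exists (lead_coef q); rewrite -expr2.
have dq := Pdiv.IdomainUnit.divp_eq ulq p.
exists (p %/ q); rewrite [LHS]dq; apply/eqP; rewrite -subr_eq0 addrAC subrr add0r.
have nzq : q != 0.
  by apply: contraTneq ulq => ->; rewrite lead_coef0 unitr0.
have e : r *: (p %% q) = (w - r *: (p %/ q)) * q.
  by rewrite mulrBl -E {2}dq scalerDr -scalerAl addrAC subrr add0r.
have lt : (size (p %% q)%R < size q)%N by rewrite ltn_modp.
apply: contraTT lt => nz; rewrite -leqNgt.
have nzw : w - r *: (p %/ q) != 0.
  apply: contra_neq nz => w0; move/eqP: e; rewrite w0 mul0r -mul_polyC mulf_eq0.
  by rewrite polyC_eq0 (negPf nzr) => /eqP.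
have := congr1 (fun t : {poly A} => size t) e; rewrite size_scale // size_mul // => ->.
by move: nzw; rewrite -size_poly_eq0; case: (size _) => // t _; rewrite leq_addl.
Qed.

(** * Cyclic rotation of the forms and the variables *)

Section Rotations.
Variable n : nat.
Hypothesis n_gt0 : (0 < n)%N.
Local Notation A0 := (res_poly n).
Local Notation g := (gen n).

Lemma rot3VE : (rot3^-1%g o1 = o0) * (rot3^-1%g o2 = o1) * (rot3^-1%g o0 = o2).
Proof.
have h i : rot3^-1%g (rot3 i) = i := permK _ i.
have := h o0; have := h o1; have := h o2; rewrite !rot3E => h2 h1 h0.
exact: (h0, h1, h2).
Qed.

(** Forms and variables turn together, so that the triple of the ['X_i ^ n] is fixed and paths are
    sent to paths. *)
Definition rotf (A : comNzRingType) (f : 'I_3 -> {mpoly A[3]}) i : {mpoly A[3]} :=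
  msym rot3^-1%g (f (rot3 i)).

Lemma map_rotf (A B : comNzRingType) (e : {rmorphism A -> B}) f i :
  map_mpoly e (rotf f i) = rotf (fun i => map_mpoly e (f i)) i.
Proof.
by apply/mpolyP => m; rewrite !(mcoeff_map_mpoly, mcoeff_sym).
Qed.

Lemma rotf_homog (A : comNzRingType) (f : 'I_3 -> {mpoly A[3]}) :
  (forall i, f i \is n.-homog) -> forall i, rotf f i \is n.-homog.
Proof.
move=> hf i; apply/dhomogP => m; rewrite mcoeff_msupp mcoeff_sym => hm.
rewrite /= -(mdeg_mperm m rot3^-1%g); apply/eqP.
by apply: contraNT hm => hm; rewrite (dhomog_nemf_coeff (hf _) hm).
Qed.

Lemma msym_xpn (A : comNzRingType) (i : 'I_3) :
  msym rot3^-1%g (xpn n A (rot3 i)) = xpn n A i.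
Proof.
rewrite /xpn rmorphXn; congr (_ ^+ _); rewrite /= msymX; congr 'X_[_].
apply/mnmP => j; rewrite !mnmE invgK; congr (nat_of_bool _).
by rewrite (inj_eq perm_inj).
Qed.

Lemma rotf3 (A : comNzRingType) (f : 'I_3 -> {mpoly A[3]}) i :
  rotf (rotf (rotf f)) i = f i.
Proof.
rewrite /rotf -!msymMm.
have -> : (rot3^-1 * (rot3^-1 * rot3^-1) = 1 :> 'S_3)%g.
  by apply/permP; apply: ord3P; rewrite !permM !rot3VE perm1.
by rewrite msym1m; congr f; move: i; apply: ord3P; rewrite !rot3E.
Qed.

Definition theta (R : A0) : A0 := ev (rotf g) R.

HB.instance Definition _ := GRing.RMorphism.copy theta (ev (rotf g)).

Lemma ev_theta (A : comNzRingType) (f : 'I_3 -> {mpoly A[3]}) R :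
  (forall i, f i \is n.-homog) -> ev f (theta R) = ev (rotf f) R.
Proof.
move=> hf; rewrite /theta ev_comp; apply: eq_ev => i; rewrite map_rotf.
by rewrite /rotf map_ev_gen.
Qed.

Lemma theta3 R : theta (theta (theta R)) = R.
Proof.
have h0 := @gen_homog n; have h1 := rotf_homog h0; have h2 := rotf_homog h1.
rewrite -[LHS]ev_gen_id (ev_theta _ h0) (ev_theta _ h1) (ev_theta _ h2).
by rewrite -[RHS]ev_gen_id; apply: eq_ev => i; apply: rotf3.
Qed.

Lemma volN_rotf (A : comNzRingType) (f : 'I_3 -> {mpoly A[3]}) d :
  (forall i, f i \is n.-homog) ->
  volN n (rotf f) (QQ n A) d ^+ 2 = volN n f (QQ n A) d ^+ 2.
Proof.
move=> hf; rewrite /rotf (volN_msym n_gt0 rot3^-1%g (f := fun i => f (rot3 i))) //.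
by rewrite volN_perm // size_QQ.
Qed.

Definition nu d : A0 := volN n g (QQ n A0) d.

Lemma theta_nu d : theta (nu d) ^+ 2 = nu d ^+ 2.
Proof.
rewrite /theta /nu ev_volN; last exact: (rotf_homog (@gen_homog n)).
exact: (volN_rotf d (@gen_homog n)).
Qed.

Definition LL : A0 := lam n g 1 * lam n g 2.

Lemma ev_LL (A : comNzRingType) (f : 'I_3 -> {mpoly A[3]}) :
  (forall i, f i \is n.-homog) -> ev f LL = lam n f 1 * lam n f 2.
Proof.
move=> hf; have mg i : map_mpoly (ev f) (g i) = f i := map_ev_gen (hf i).
by rewrite /LL rmorphM -!(map_lam n mg).
Qed.

Lemma meval_msym (A : comNzRingType) (p : {mpoly A[3]}) (s : 'S_3) v :
  (msym s p).@[v] = p.@[fun i => v (s i)].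
Proof.
elim/mpolyind: p => [|c m p _ _ IH]; first by rewrite !rmorph0.
rewrite msymD !mevalD IH msymZ !mevalZ msymX; congr (_ * _ + _).
rewrite !mpolyXE_id !rmorph_prod [LHS](reindex_inj (@perm_inj _ s)) /=.
by apply: eq_bigr => i _; rewrite !rmorphXn /= !mevalXU mnmE permK.
Qed.

Lemma vanishing_theta R : vanishing R -> vanishing (theta R).
Proof.
move=> vR k f hf [p [[i nzp] hp]]; rewrite ev_theta //.
apply: vR; first exact: rotf_homog.
exists (fun j => p (rot3 j)); split.
  by exists (rot3^-1%g i); rewrite permKV.
move=> j; rewrite /rotf meval_msym -(hp (rot3 j)).
by apply: meval_eq => i0; rewrite permKV.
Qed.

End Rotations.

Import Order.TTheory Num.Theory.

(** The leading coefficient of the sum is 1 or 2, so nothing cancels when 2 is nonzero. *)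
Lemma lead_coef_add1 (A : nzRingType) (K : fieldType) (e : {rmorphism A -> K})
    (p q : {poly A}) : 2%:R != 0 :> K -> lead_coef p = 1 -> lead_coef q = 1 ->
  e (lead_coef (p + q)) != 0.
Proof.
move=> h2 lp lq; have [h|h|h] := ltngtP (size p) (size q).
- by rewrite lead_coefDr // lq rmorph1 oner_eq0.
- by rewrite lead_coefDl // lp rmorph1 oner_eq0.
have c2 : (p + q)`_(size p).-1 = 2%:R.
  by rewrite coefD {2}h -!lead_coefE lp lq.
have sz : size (p + q) = size p.
  apply/eqP; rewrite eqn_leq; apply/andP; split.
    by apply: leq_trans (size_polyD _ _) _; rewrite h maxnn.
  rewrite leqNgt; apply: contra h2 => hs; rewrite -(rmorph_nat e) -c2.
  by rewrite nth_default ?rmorph0 // -ltnS prednK // (leq_ltn_trans _ hs).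
by rewrite lead_coefE sz c2 rmorph_nat.
Qed.

Section Paths.
Variable n : nat.
Hypothesis n_gt0 : (0 < n)%N.
Local Notation A0 := (res_poly n).
Local Notation g := (gen n).
Local Notation gh := (@gen_homog n).

Lemma pathf_homog (A : comNzRingType) (h : 'I_3 -> {mpoly A[3]}) :
  (forall i, h i \is n.-homog) -> forall i, pathf n h i \is n.-homog.
Proof.
move=> hh i; apply: rpredD; first exact/map_homog/hh.
by apply: rpredZ; apply: xpn_homog.
Qed.

Definition res_path (R : A0) : {poly A0} := ev (pathf n g) R.

HB.instance Definition _ := GRing.RMorphism.copy res_path (ev (pathf n g)).

Lemma res_path0 R : (res_path R).[0] = R.
Proof.
rewrite -[LHS]/(horner_eval 0 (res_path R)) ev_comp -[RHS]ev_gen_id; apply: eq_ev => i.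
apply/mpolyP => m; rewrite mcoeff_map_mpoly /= mcoeffD mcoeffZ mcoeff_map_mpoly /=.
by rewrite /horner_eval hornerD hornerM hornerX mul0r addr0 hornerC.
Qed.

Lemma eq_lam (A : comNzRingType) (f f' : 'I_3 -> {mpoly A[3]}) d :
  f =1 f' -> lam n f d = lam n f' d.
Proof. by move=> h; rewrite /lam !h. Qed.

Lemma eq_rotf (A : comNzRingType) (f f' : 'I_3 -> {mpoly A[3]}) :
  f =1 f' -> rotf f =1 rotf f'.
Proof. by move=> h i; rewrite /rotf h. Qed.

Lemma rotf_pathf (A : comNzRingType) (h : 'I_3 -> {mpoly A[3]}) :
  rotf (pathf n h) =1 pathf n (rotf h).
Proof.
move=> i; apply/mpolyP => m; rewrite /rotf /pathf mcoeff_sym !mcoeffD !mcoeffZ.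
by rewrite !mcoeff_map_mpoly -(msym_xpn n {poly A} i) !mcoeff_sym.
Qed.

Lemma iter_rotf_pathf j : iter j (@rotf _) (pathf n g) =1 pathf n (iter j (@rotf _) g).
Proof.
elim: j => [//|j IH] i; rewrite !iterS (eq_rotf IH); exact: rotf_pathf.
Qed.

Definition LL_ j : A0 := iter j (@theta n) (LL n).

Lemma ev_LL_ (A : comNzRingType) (f : 'I_3 -> {mpoly A[3]}) j :
  (forall i, f i \is n.-homog) ->
  ev f (LL_ j) = lam n (iter j (@rotf _) f) 1 * lam n (iter j (@rotf _) f) 2.
Proof.
elim: j f => [|j IH] f hf; first exact: (ev_LL hf).
by rewrite /LL_ iterS (ev_theta _ hf) (IH _ (rotf_homog hf)) -iterSr.
Qed.

Lemma lead_path_LL j : lead_coef (res_path (LL_ j)) ^+ 2 = 1.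
Proof.
rewrite /res_path (ev_LL_ j (pathf_homog gh)) !(eq_lam _ (iter_rotf_pathf j)).
by rewrite lead_coefM exprMn !lead_lam // mulr1.
Qed.

Lemma lead_path_nu d : lead_coef (res_path (nu n d)) ^+ 2 = 1.
Proof. by rewrite /res_path /nu (ev_volN _ (pathf_homog gh)) lead_volN. Qed.

(* At the forms [c i *: 'X_i ^+ n] the path becomes [(c i + 'X) *: 'X_i ^+ n]. *)
Definition cst (i : 'I_3) : rat := tri 0 1 2%:R i.
Definition lin (i : 'I_3) : {poly rat} := (cst i)%:P + 'X.
Definition scl (A : comNzRingType) (C : 'I_3 -> A) i := C i *: xpn n A i.
Definition sp : {rmorphism A0 -> rat} := ev (scl cst).

Lemma scl_homog (A : comNzRingType) (C : 'I_3 -> A) i : scl C i \is n.-homog.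
Proof. by apply: rpredZ; apply: xpn_homog. Qed.

Lemma map_res_path R : map_poly sp (res_path R) = ev (scl lin) R.
Proof.
rewrite -[LHS]/((map_poly sp) (ev (pathf n g) R)) ev_comp; apply: eq_ev => i.
apply/mpolyP => m; rewrite mcoeff_map_mpoly /= mcoeffD mcoeff_map_mpoly !mcoeffZ.
rewrite rmorphD rmorphM /= map_polyC map_polyX /= -(mcoeff_map_mpoly sp).
rewrite map_ev_gen; last exact: scl_homog.
rewrite mcoeffZ /lin mulrDl polyCM; congr (_ * _ + _ * _).
  by rewrite -!mcoeff_map_mpoly !map_xpn.
by rewrite -mcoeff_map_mpoly map_xpn.
Qed.

Lemma rotf_scl (A : comNzRingType) (C : 'I_3 -> A) :
  rotf (scl C) =1 scl (fun i => C (rot3 i)).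
Proof. by move=> i; rewrite /rotf /scl msymZ msym_xpn. Qed.

Lemma iter_rotf_scl (A : comNzRingType) (C : 'I_3 -> A) j :
  iter j (@rotf _) (scl C) =1 scl (fun i => C (iter j rot3 i)).
Proof.
elim: j C => [//|j IH] C i; rewrite iterS (eq_rotf (IH C)) rotf_scl /scl.
by rewrite -iterSr.
Qed.

(** Each [LL_ j] sees two of the three forms, so one of the three linear factors is missing from
    each image. *)
Lemma map_path_LL j : exists a b v, v ^+ 2 = 1 /\ map_poly sp (res_path (LL_ j)) =
  lin (iter j rot3 o0) ^+ a * lin (iter j rot3 o1) ^+ b * v.
Proof.
rewrite map_res_path (ev_LL_ j (scl_homog lin)) !(eq_lam _ (iter_rotf_scl _ _)).
have [a [b [v [v2 ->]]]] := lam_scale n_gt0 (fun i => lin (iter j rot3 i)) 1.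
have [a' [b' [v' [v2' ->]]]] := lam_scale n_gt0 (fun i => lin (iter j rot3 i)) 2.
exists (a + a')%N, (b + b')%N, (v * v'); split; first by rewrite exprMn v2 v2' mulr1.
by rewrite !exprD; ring.
Qed.

(** The linear factors are ['X], ['X + 1] and ['X + 2]. At the roots 0 and -1 of the left side one
    term on the right is positive and the other nonnegative. Even powers of rationals thus reduce
    three polynomials to two, as a resultant needs, and they also remove the signs of
    [map_path_LL]. *)
Lemma lin_coprime a0 b0 a1 b1 a2 b2 M :
  coprimep (((lin o0 ^+ a0 * lin o1 ^+ b0) ^+ 2) ^+ M)
    (((lin o1 ^+ a1 * lin o2 ^+ b1) ^+ 2) ^+ M +
     ((lin o2 ^+ a2 * lin o0 ^+ b2) ^+ 2) ^+ M).
Proof.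
set G := (X in coprimep _ X).
have G0 x : G.[x] = (((lin o1).[x] ^+ a1 * (lin o2).[x] ^+ b1) ^+ 2) ^+ M
     + (((lin o2).[x] ^+ a2 * (lin o0).[x] ^+ b2) ^+ 2) ^+ M.
  by rewrite hornerD !(horner_exp, hornerM).
have lE : ((lin o0).[0] = 0) * ((lin o1).[0] = 1) * ((lin o2).[0] = 2%:R) *
    ((lin o0).[-1] = -1) * ((lin o2).[-1] = 1).
  have h i x : (lin i).[x] = cst i + x by rewrite hornerD hornerX hornerC.
  have c0 : cst o0 = 0 by rewrite /cst triE.
  have c1 : cst o1 = 1 by rewrite /cst triE.
  have c2 : cst o2 = 2%:R by rewrite /cst triE.
  by split; [split; [split; [split|]|]|]; rewrite h ?c0 ?c1 ?c2 ?addr0 ?add0r.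
have G_0 : ~~ root G 0.
  rewrite /root G0 !lE gt_eqF // ltr_pwDl //.
    by rewrite exprn_gt0 // exprn_even_gt0 //= expr1n mul1r expf_neq0.
  by rewrite exprn_ge0 // sqr_ge0.
have G_1 : ~~ root G (-1).
  rewrite /root G0 !lE gt_eqF // ltr_pwDr //.
    by rewrite exprn_gt0 // exprn_even_gt0 //= expr1n mul1r expf_neq0.
  by rewrite exprn_ge0 // sqr_ge0.
have l0 : lin o0 = 'X - 0%:P by rewrite /lin /cst triE subr0 add0r.
have l1 : lin o1 = 'X - (-1)%:P by rewrite /lin /cst triE polyCN opprK addrC.
rewrite l0 l1; do 2!apply: coprimep_expl; rewrite coprimepMl.
by rewrite !coprimep_expl // coprimep_sym coprimep_XsubC.
Qed.

Lemma LL_coprime M :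
  coprimep (map_poly sp (res_path (LL_ 0) ^+ (2 * M)))
    (map_poly sp (res_path (LL_ 1) ^+ (2 * M) + res_path (LL_ 2) ^+ (2 * M))).
Proof.
have E j : exists a b, map_poly sp (res_path (LL_ j) ^+ (2 * M)) =
    ((lin (iter j rot3 o0) ^+ a * lin (iter j rot3 o1) ^+ b) ^+ 2) ^+ M.
  have [a [b [v [v2 e]]]] := map_path_LL j; exists a, b.
  rewrite rmorphXn /= e exprM; congr (_ ^+ M).
  by rewrite [LHS]exprMn v2 mulr1.
have K p0 p1 p2 :
    (exists a b, p0 = ((lin (iter 0 rot3 o0) ^+ a * lin (iter 0 rot3 o1) ^+ b) ^+ 2) ^+ M) ->
    (exists a b, p1 = ((lin (iter 1 rot3 o0) ^+ a * lin (iter 1 rot3 o1) ^+ b) ^+ 2) ^+ M) ->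
    (exists a b, p2 = ((lin (iter 2 rot3 o0) ^+ a * lin (iter 2 rot3 o1) ^+ b) ^+ 2) ^+ M) ->
    coprimep p0 (p1 + p2).
  move=> [a0 [b0 ->]] [a1 [b1 ->]] [a2 [b2 ->]].
  by rewrite !iterS /= !rot3E; apply: lin_coprime.
rewrite (rmorphD (map_poly sp)).
exact: (K _ _ _ (E 0%N) (E 1%N) (E 2%N)).
Qed.

Lemma combine (R : comNzRingType) (u v L0 L1 L2 P c0 c1 c2 Q : R) :
    L0 * P = c0 * Q -> L1 * P = c1 * Q -> L2 * P = c2 * Q ->
  (u * L0 + v * (L1 + L2)) * P = (u * c0 + v * (c1 + c2)) * Q.
Proof. by move=> e0 e1 e2; rewrite !(mulrDl, mulrDr) -!mulrA e0 e1 e2. Qed.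

(* The three factors [LL_ j] have no common prime divisor, because [LL_ j] only
   involves the coefficients of two of the three forms. *)
Lemma divides_LL (p q : A0) : lead_coef (res_path q) ^+ 2 = 1 ->
    (forall j, (j < 3)%N -> exists N a, LL_ j ^+ N * p = a * q) ->
  exists w, p = w * q.
Proof.
move=> lq H.
have [N0 [a0 e0]] := H 0%N isT; have [N1 [a1 e1]] := H 1%N isT.
have [N2 [a2 e2]] := H 2%N isT; pose M := (N0 + N1 + N2)%N.
have up j N a : (N <= 2 * M)%N -> LL_ j ^+ N * p = a * q ->
    exists b, LL_ j ^+ (2 * M) * p = b * q.
  move=> hN e; exists (LL_ j ^+ (2 * M - N) * a).
  by rewrite -mulrA -e mulrA -exprD subnK.
have {e0}[b0 e0] : exists b, LL_ 0 ^+ (2 * M) * p = b * q by apply: up e0; rewrite /M; lia.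
have {e1}[b1 e1] : exists b, LL_ 1 ^+ (2 * M) * p = b * q by apply: up e1; rewrite /M; lia.
have {e2}[b2 e2] : exists b, LL_ 2 ^+ (2 * M) * p = b * q by apply: up e2; rewrite /M; lia.
have lead1 j : lead_coef (res_path (LL_ j) ^+ (2 * M)) = 1.
  by rewrite lead_coef_exp exprM lead_path_LL expr1n.
have s0 : sp (lead_coef (res_path (LL_ 0) ^+ (2 * M))) != 0.
  by rewrite lead1 rmorph1 oner_eq0.
have s12 := lead_coef_add1 sp (isT : 2%:R != 0 :> rat) (lead1 1%N) (lead1 2%N).
(* The Bezout identity lives along the path, where its constant [r] can be cancelled against a
   divisor with unit leading coefficient; value 0 of the path variable then gives back [p] and
   [q]. *)
have [r [u [v [nzr E]]]] := bezout_spec s0 s12 (LL_coprime M).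
have [w hw] : exists w, res_path p = w * res_path q.
  apply: (unit_lead_div lq nzr (w := u * res_path b0 + v * (res_path b1 + res_path b2))).
  have h c L : L ^+ (2 * M) * p = c * q ->
      res_path L ^+ (2 * M) * res_path p = res_path c * res_path q.
    by move=> e; rewrite -rmorphXn -rmorphM e rmorphM.
  rewrite -mul_polyC E; exact: (combine u v (h _ _ e0) (h _ _ e1) (h _ _ e2)).
by exists w.[0]; rewrite -[p]res_path0 hw hornerM res_path0.
Qed.

End Paths.

(** * Identification with the resultant *)

Section Cancel.
Variable R : idomainType.

Lemma sqr_eq (x y : R) : x ^+ 2 = y ^+ 2 -> x = y \/ x = - y.
Proof. by move/eqP; rewrite eqf_sqr => /orP[/eqP|/eqP]; [left|right]. Qed.

Lemma saturate_nu (l1 l2 v1 v2 D : R) (m : nat) : v2 * l1 ^+ 3 * l2 ^+ m = v1 ^+ 3 * D * l2 ->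
  exists N a, (l1 * l2) ^+ N * v2 = a * v1 ^+ 3.
Proof.
move=> E; exists (3 + m)%N, (l1 ^+ m * l2 ^+ 3 * D * l2).
transitivity (l1 ^+ m * l2 ^+ 3 * (v2 * l1 ^+ 3 * l2 ^+ m)).
  by rewrite exprMn !exprD; ring.
by rewrite E; ring.
Qed.

Lemma cancel_nu (l1 l2 v1 v2 D F : R) (m : nat) : v1 != 0 ->
    v2 * l1 ^+ 3 * l2 ^+ m = v1 ^+ 3 * D * l2 -> v2 = F * v1 ^+ 3 ->
  F * l1 ^+ 3 * l2 ^+ m = D * l2.
Proof.
move=> nz E e; have nz3 : v1 ^+ 3 != 0 by rewrite expf_neq0.
apply: (mulfI nz3); rewrite e in E; rewrite [RHS]mulrA -E; ring.
Qed.

Lemma saturate_res (l1 l2 D F q p : R) (m N : nat) : F * l1 ^+ 3 * l2 ^+ m = D * l2 ->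
  l2 ^+ N * p = q * D -> exists N' a, (l1 * l2) ^+ N' * p = a * F.
Proof.
move=> E e; exists N.+1, (l1 ^+ N.+1 * q * l1 ^+ 3 * l2 ^+ m).
transitivity (l1 ^+ N.+1 * l2 * (l2 ^+ N * p)); first by rewrite exprMn !exprS; ring.
rewrite e; transitivity (l1 ^+ N.+1 * q * (D * l2)); first by ring.
by rewrite -E; ring.
Qed.

Lemma sqr_cancel_nu (t : {rmorphism R -> R}) (v1 v2 F : R) : v1 != 0 ->
  t v1 ^+ 2 = v1 ^+ 2 -> t v2 ^+ 2 = v2 ^+ 2 -> v2 = F * v1 ^+ 3 ->
  t F ^+ 2 = F ^+ 2.
Proof.
move=> nz e1 e2 E; have nz6 : (v1 ^+ 2) ^+ 3 != 0 by rewrite !expf_neq0.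
apply: (mulIf nz6); rewrite -[in LHS]e1.
transitivity (t v2 ^+ 2); first by rewrite E rmorphM rmorphXn /=; ring.
by rewrite e2 E; ring.
Qed.

(** Rotation preserves the polynomials concerned only up to sign; the sign is absorbed in the
    cofactor. *)
Lemma saturate_map (t : {rmorphism R -> R}) (L p q p' q' : R) :
    t p ^+ 2 = p' ^+ 2 -> t q ^+ 2 = q' ^+ 2 ->
    (exists N a, L ^+ N * p = a * q) -> exists N a, t L ^+ N * p' = a * q'.
Proof.
move=> ep eq [N [a e]]; exists N.
have {}e : t L ^+ N * t p = t a * t q by rewrite -rmorphXn -!rmorphM e.
have [p1|p1] := sqr_eq ep.
  have [q1|q1] := sqr_eq eq.
    by exists (t a); rewrite -p1 -q1.
  by exists (- t a); rewrite -p1 e q1 mulrN mulNr.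
have [q1|q1] := sqr_eq eq.
  by exists (- t a); rewrite -[p']opprK -p1 mulrN e q1 mulNr.
by exists (t a); rewrite -[p']opprK -p1 mulrN e q1 mulrN opprK.
Qed.

End Cancel.

Lemma map_identity (A B : comNzRingType) (t : {rmorphism A -> B})
    (a b c x y : A) (a' b' c' x' y' : B) m :
    t a = a' -> t b = b' -> t c = c' -> t x = x' -> t y = y' ->
    a' * b' ^+ 3 * c' ^+ m = x' ^+ 3 * y' * c' ->
  t (a * b ^+ 3 * c ^+ m) = t (x ^+ 3 * y * c).
Proof. by move=> <- <- <- <- <-; rewrite !rmorphM !rmorphXn. Qed.

Lemma map_cancel (A : comNzRingType) (K : fieldType) (t : {rmorphism A -> K})
    (F a b c : A) m : F * a ^+ 3 * b ^+ m = c * b ->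
  t a != 0 -> t b != 0 -> t c = 0 -> t F = 0.
Proof.
move=> E na nb c0; have := congr1 t E.
rewrite !rmorphM !rmorphXn /= c0 mul0r => /eqP.
by rewrite !mulf_eq0 !expf_eq0 (negPf na) (negPf nb) !andbF !orbF => /eqP.
Qed.

Section Factor.
Variable n : nat.
Hypothesis n_gt0 : (0 < n)%N.
Local Notation A0 := (res_poly n).
Local Notation g := (gen n).

(** The identity over a field applies after embedding the coefficient ring into a closed field,
    where the [lam] are nonzero; injectivity brings it back. *)
Lemma nu_identity : nu n 2 * lam n g 1 ^+ 3 * lam n g 2 ^+ (n * n) =
  nu n 1 ^+ 3 * \det (phimx n g) * lam n g 2.
Proof.
have [K [e einj]] := mpoly_int_closure #|{: 'I_3 * mono n}|; apply: (einj).
pose f i := map_mpoly e (g i).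
have fh i : f i \is n.-homog by apply/map_homog/gen_homog.
have ml d : e (lam n g d) = lam n f d := @map_lam n _ _ e g f (fun=> erefl) d.
have nzf d : lam n f d != 0.
  rewrite -ml; apply: contra_neq (lam_gen_neq0 n_gt0 d) => h.
  by apply: einj; rewrite h rmorph0.
have mnu d : e (nu n d) = volN n f (QQ n K) d by rewrite /nu -map_volN map_QQ.
have md : e (\det (phimx n g)) = \det (phimx n f).
  by rewrite -det_map_mx (@map_phimx n _ _ e g f (fun=> erefl)).
exact: (map_identity (mnu 2%N) (ml 1%N) (ml 2%N) (mnu 1%N) md (volN_identity n_gt0 fh nzf)).
Qed.

Lemma nu_neq0 d : nu n d != 0.
Proof.
apply: (@volN_ev_neq0 _ n_gt0 _ (xpn n int)); first exact: xpn_homog.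
by move=> i; rewrite map_ev_gen //; apply: xpn_homog.
Qed.

Lemma nu_factor : exists F, nu n 2 = F * nu n 1 ^+ 3.
Proof.
have lq : lead_coef (res_path (nu n 1 ^+ 3)) ^+ 2 = 1.
  rewrite (rmorphXn (@res_path n)) lead_coef_exp exprAC lead_path_nu //.
  by rewrite expr1n.
apply: (divides_LL n_gt0 lq).
have t2 := theta_nu n_gt0 2.
have t1 : theta (nu n 1 ^+ 3) ^+ 2 = (nu n 1 ^+ 3) ^+ 2.
  by rewrite (rmorphXn (@theta n)) exprAC (theta_nu n_gt0 1) exprAC.
have h0 : exists N a, LL_ n 0 ^+ N * nu n 2 = a * nu n 1 ^+ 3.
  by have [N [a h]] := saturate_nu nu_identity; exists N, a.
have h1 : exists N a, LL_ n 1 ^+ N * nu n 2 = a * nu n 1 ^+ 3.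
  by have [N [a h]] := saturate_map t2 t1 h0; exists N, a.
have h2 : exists N a, LL_ n 2 ^+ N * nu n 2 = a * nu n 1 ^+ 3.
  by have [N [a h]] := saturate_map t2 t1 h1; exists N, a.
case=> [|[|[|j]]] hj; [exact: h0|exact: h1|exact: h2|discriminate hj].
Qed.

Lemma theta_factor F : nu n 2 = F * nu n 1 ^+ 3 -> theta F ^+ 2 = F ^+ 2.
Proof.
exact: sqr_cancel_nu (nu_neq0 1) (theta_nu n_gt0 1) (theta_nu n_gt0 2).
Qed.

Lemma lead_factor F : nu n 2 = F * nu n 1 ^+ 3 -> lead_coef (res_path F) ^+ 2 = 1.
Proof.
move=> e; have := lead_path_nu n_gt0 2.
have -> : res_path (nu n 2) = res_path F * res_path (nu n 1) ^+ 3.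
  by rewrite -(rmorphXn (@res_path n)) -(rmorphM (@res_path n)); congr res_path.
rewrite lead_coefM lead_coef_exp exprMn exprAC (lead_path_nu n_gt0 1).
by rewrite expr1n mulr1.
Qed.

Lemma vanishing_factor F R : nu n 2 = F * nu n 1 ^+ 3 -> vanishing R ->
  exists w, R = w * F.
Proof.
move=> eF; have E := cancel_nu (nu_neq0 1) nu_identity eF.
have tF := theta_factor eF.
have h0 S : vanishing S -> exists N a, LL_ n 0 ^+ N * S = a * F.
  move=> vS; have [N [q e]] := vanishing_div n_gt0 vS.
  by have [N' [a h]] := saturate_res E e; exists N', a.
have st j S : (exists N a, LL_ n j ^+ N * S = a * F) ->
    exists N a, LL_ n j.+1 ^+ N * theta S = a * F.
  move=> h; have [N [a e]] := saturate_map (erefl (theta S ^+ 2)) tF h.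
  by exists N, a.
(* Since [theta] has order three, [R] is a rotation of [theta (theta R)] and a double rotation of
   [theta R], which are also vanishing; [h0] for these, rotated back, gives the two other
   denominators. *)
move=> vR; have v1 := vanishing_theta vR; have v2 := vanishing_theta v1.
have h1 : exists N a, LL_ n 1 ^+ N * R = a * F.
  by have [N [a e]] := st _ _ (h0 _ v2); exists N, a; rewrite -e theta3.
have h2 : exists N a, LL_ n 2 ^+ N * R = a * F.
  by have [N [a e]] := st _ _ (st _ _ (h0 _ v1)); exists N, a; rewrite -e theta3.
apply: (divides_LL n_gt0 (lead_factor eF)).
case=> [|[|[|j]]] hj; [exact: h0|exact: h1|exact: h2|discriminate hj].
Qed.

(** The grid triple has 0 among its eigenvalues, so [F] specializes to 0 there, while a unit would
    stay a unit. *)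
Lemma factor_nonunit F : nu n 2 = F * nu n 1 ^+ 3 -> F \isn't a GRing.unit.
Proof.
move=> eF; have E := cancel_nu (nu_neq0 1) nu_identity eF.
pose k1 := {fraction {poly rat}}.
pose eps : k1 := tofrac ('X : {poly rat}); pose f := grid n eps.
have mg i : map_mpoly (ev f) (g i) = f i by rewrite map_ev_gen //; apply: grid_homog.
have nzf := grid_lam n_gt0.
have l1 : ev f (lam n g 1) != 0 by rewrite (map_lam n mg); apply: nzf.
have l2 : ev f (lam n g 2) != 0 by rewrite (map_lam n mg); apply: nzf.
have d0 : ev f (\det (phimx n g)) = 0.
  by rewrite -det_map_mx (map_phimx n mg) grid_det_phimx.
suff F0 : ev f F = 0.
  apply/negP => h; have : ev f F \is a GRing.unit := rmorph_unit (ev f) h.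
  by rewrite F0 unitr0.
exact: (map_cancel E l1 l2 d0).
Qed.

End Factor.

Lemma unit_mpoly_int_sqr N (w : {mpoly int[N]}) : w \is a GRing.unit -> w ^+ 2 = 1.
Proof.
move=> uw; have /andP[/eqP ew u0] : mpoly_unit w := uw.
have c2 : w@_0 * w@_0 = 1.
  by have /orP[] : (w@_0 == 1) || (w@_0 == -1) := u0; move/eqP->.
by rewrite ew expr2 -mpolyCM c2.
Qed.

Lemma Res_sqr n (Res : res_poly n) F : (0 < n)%N -> is_Res Res ->
  nu n 2 = F * nu n 1 ^+ 3 -> Res ^+ 2 = F ^+ 2.
Proof.
move=> n_gt0 [[_ _ irr] ResP] eF.
have vR : vanishing Res.
  move=> k f hf h; have [_] := ResP k f hf; rewrite res_evalE; exact.
have [w e] := vanishing_factor n_gt0 eF vR.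
have [uw|uF] := irr _ _ e; last by have := factor_nonunit n_gt0 eF; rewrite uF.
by rewrite e exprMn (unit_mpoly_int_sqr uw) mul1r.
Qed.

Lemma sqr_subst (R : comNzRingType) (x v phi r : R) a b :
  x ^+ 2 = (v ^+ a * phi ^+ b) ^+ 2 -> r ^+ 2 = phi ^+ 2 ->
  x ^+ 2 = (v ^+ a * r ^+ b) ^+ 2.
Proof. by move=> -> e; rewrite !exprMn; congr (_ * _); rewrite exprAC -e exprAC. Qed.

Lemma volN_x123_Res n (Res : res_poly n) Q d : (0 < n)%N -> is_Res Res ->
    homogs (dg n 1) Q -> size Q = 'C(n, 2) ->
  volN n (@x123 n) Q d ^+ 2 = (volN n (@x123 n) Q 1 ^+ 'C(d.+1, 2) *
    res_eval Res (@x123 n) ^+ 'C(d.+1, 3)) ^+ 2.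
Proof.
move=> n_gt0 ResP hQ sQ; have [phi hphi] := volN_x123 n_gt0.
apply: (sqr_subst (hphi Q hQ sQ d)).
have hx := @x123_homog n.
have [F eF] := nu_factor n_gt0.
pose V d := volN n (@x123 n) (QQ n (KK n)) d.
have eV d' : ev (@x123 n) (nu n d') = V d' := ev_volN d' hx.
have nz : V 1%N != 0.
  apply: (@volN_generic_neq0 n n_gt0 (fun i => inl i) 1 1%g).
  by move=> i; left; rewrite perm1.
have e1 : ev (@x123 n) Res ^+ 2 = ev (@x123 n) F ^+ 2.
  by rewrite -!rmorphXn (Res_sqr n_gt0 ResP eF).
have e2 : V 2 = ev (@x123 n) F * V 1%N ^+ 3.
  by rewrite -!eV eF rmorphM rmorphXn.
have e3 : V 2 ^+ 2 = (V 1%N ^+ 3 * phi) ^+ 2.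
  exact: (hphi _ (@homogs_QQ n _) (size_QQ n_gt0 _) 2).
rewrite res_evalE e1; apply: (mulfI (expf_neq0 2 (expf_neq0 3 nz))).
by rewrite -exprMn -[RHS]exprMn -e3 e2 mulrC.
Qed.

Lemma divn_bin2 d : ((d.+1 * d) %/ 2 = 'C(d.+1, 2))%N.
Proof. by rewrite -[(d.+1 * d)%N](bin2_double d.+1) mulnK. Qed.

Lemma divn_bin3 d : ((d.+1 * d * d.-1) %/ 6 = 'C(d.+1, 3))%N.
Proof.
have h2 := bin2_double d; have h3 := mul_bin_diag d.+1 2; rewrite /= in h2 h3.
have -> : (d.+1 * d * d.-1 = 'C(d.+1, 3) * 6)%N.
  by rewrite -mulnA -h2; move: h3; move: 'C(d, 2) 'C(d.+1, 3) => a b; nia.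
by rewrite mulnK.
Qed.

Theorem theorem5p1 (n d : nat) (I : {fset nat * nat})
    (n_gt0 : (0 < n)%N) (d_gt0 : (0 < d)%N)
    (I_le : forall p : nat * nat, p \in I -> (p.1 + p.2 <= n.-1)%N)
    (I_card : #|` I| = n)
    (Res : res_poly n) (ResP : is_Res Res) :
  let rhs :=
    \det (MPI n_gt0 I_le I_card) ^+ ((d.+1 * d) %/ 2)
      * res_eval Res (@x123 n) ^+ ((d.+1 * d * d.-1) %/ 6) in
  \det (MSI d n_gt0 I_le I_card) = rhs \/
  \det (MSI d n_gt0 I_le I_card) = - rhs.
Proof.
move=> rhs; apply: sqr_eq; rewrite /rhs divn_bin2 divn_bin3 det_MSI.
rewrite (volN_x123_Res d n_gt0 ResP (homogs_QJ I n_gt0) (size_QJ n_gt0 I_le I_card)).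
by rewrite !exprMn; congr (_ * _); rewrite exprAC -(det_MPI n_gt0 I_le I_card) exprAC.
Qed.
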